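(* Let $\Omega\subseteq\mathbb C$ be a Jordan domain and $\phi:D\to\Omega$ a Riemann map. If $\phi\in A^{\infty}(D)$ and $\phi'(z)\neq 0$ for all $z\in \mathbb T$, then every $f\in C^{\infty}(\partial \Omega)$ has a unique decomposition as $f=g+\bar h$ (on $\partial\Omega$) with $g,h\in A^{\infty}(\Omega)$ and $h(\phi(0))=0$.
   Context: $D$ is the open unit disc in $\mathbb C$, $\mathbb T=\partial D$. A Jordan domain is a simply connected region whose boundary is a Jordan curve. A Riemann map $\phi:D\to\Omega$ is a biholomorphism; it extends to a homeomorphism $\phi:\overline D\to\overline\Omega$ (Carathéodory–Osgood), and $\gamma=\phi|_{\mathbb T}:\mathbb T\to\partial\Omega$. $C^\infty(\mathbb T)$ is the space of $u:\mathbb T\to\mathbb C$ with $\theta\mapsto u(e^{i\theta})$ infinitely differentiable. $C^{\infty}(\partial\Omega)$ is the space of functions $f:\partial\Omega\to\mathbb C$ with $f\circ\gamma\in C^{\infty}(\mathbb T)$. For a Jordan domain $G$ (in particular $G=D$ or $G=\Omega$), $A^\infty(G)$ is the space of holomorphic functions $f$ on $G$ all of whose derivatives $f^{(l)}$, $l\ge0$, extend continuously to $\overline G$; values of $f$ and $f^{(l)}$ on $\partial G$ (in particular $\phi'$ on $\mathbb T$) are those of the continuous extensions. *)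

(* Defs.v *)
From Stdlib Require Import Reals.
From Coquelicot Require Import Coquelicot.

Local Open Scope C_scope.

Definition unit_disc (z : C) : Prop := (Cmod z < 1)%R.

Definition unit_circle (z : C) : Prop := Cmod z = 1%R.

Definition cis (t : R) : C := (cos t, sin t).

Definition closure (G : C -> Prop) (z : C) : Prop :=
  forall V : C -> Prop, locally z V -> exists w : C, V w /\ G w.

Definition boundary (G : C -> Prop) (z : C) : Prop :=
  closure G z /\ closure (fun w => ~ G w) z.

Definition connected (G : C -> Prop) : Prop :=
  forall U V : C -> Prop, open U -> open V ->
    (forall z, G z -> U z \/ V z) ->
    (exists z, G z /\ U z) -> (exists z, G z /\ V z) ->
    exists z, G z /\ U z /\ V z.

Definition region (G : C -> Prop) : Prop :=
  open G /\ connected G /\ exists z, G z.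

Definition unit_itv (t : R) : Prop := (0 <= t <= 1)%R.

Definition null_homotopic (G : C -> Prop) (c : R -> C) : Prop :=
  exists H : R * R -> C,
    continuous_on (fun p : R * R => unit_itv (fst p) /\ unit_itv (snd p)) H /\
    (forall s t, unit_itv s -> unit_itv t -> G (H (s, t))) /\
    (forall t, unit_itv t -> H (0%R, t) = c t /\ H (1%R, t) = c 0%R) /\
    (forall s, unit_itv s -> H (s, 0%R) = c 0%R /\ H (s, 1%R) = c 0%R).

Definition simply_connected (G : C -> Prop) : Prop :=
  forall c : R -> C,
    continuous_on unit_itv c ->
    (forall t, unit_itv t -> G (c t)) ->
    c 0%R = c 1%R ->
    null_homotopic G c.

Definition jordan_curve (J : C -> Prop) : Prop :=
  exists b : C -> C,
    continuous_on unit_circle b /\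
    (forall z w, unit_circle z -> unit_circle w -> b z = b w -> z = w) /\
    (forall w, J w <-> exists z, unit_circle z /\ b z = w).

Definition jordan_domain (G : C -> Prop) : Prop :=
  region G /\ simply_connected G /\ jordan_curve (boundary G).

Definition holomorphic (G : C -> Prop) (f : C -> C) : Prop :=
  forall z, G z -> @ex_derive C_AbsRing C_NormedModule f z.

Definition riemann_map (G : C -> Prop) (phi : C -> C) : Prop :=
  holomorphic unit_disc phi /\
  (forall z, unit_disc z -> G (phi z)) /\
  exists psi : C -> C,
    holomorphic G psi /\
    (forall w, G w -> unit_disc (psi w)) /\
    (forall z, unit_disc z -> psi (phi z) = z) /\
    (forall w, G w -> phi (psi w) = w).

Fixpoint C_derive_n (f : C -> C) (l : nat) : C -> C :=
  match l with
  | O => f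
  | S l' => C_derive (C_derive_n f l')
  end.

Definition extends_continuously (G : C -> Prop) (f : C -> C) : Prop :=
  exists F : C -> C,
    continuous_on (closure G) F /\ forall z, G z -> F z = f z.

(* A function on [G] is represented by a total [f] whose values off [G] are
   irrelevant.  At [z] in the closure of [G], [bdval G f z] is the value at [z]
   of the continuous extension of [f] restricted to [G], when there is one. *)
Definition bdval (G : C -> Prop) (f : C -> C) (z : C) : C :=
  iota (fun l : C_CompleteNormedModule =>
          filterlim f (within G (locally z)) (locally l)).

(* [C_derive] is a total operator, taken as a limit along the horizontal
   direction; it is the complex derivative wherever the latter exists, hence at
   every point of the open set [G] in the iterates used here. *)
Definition A_infty (G : C -> Prop) (f : C -> C) : Prop :=
  holomorphic G f /\ forall l : nat, extends_continuously G (C_derive_n f l).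

Definition smooth_circle (u : C -> C) : Prop :=
  forall (n : nat) (t : R),
    ex_derive_n (fun s => Re (u (cis s))) n t /\
    ex_derive_n (fun s => Im (u (cis s))) n t.

(* [fun z => bdval unit_disc phi z] is the boundary correspondence from the
   circle onto the boundary of the image of [phi]. *)
Definition smooth_boundary (phi f : C -> C) : Prop :=
  smooth_circle (fun z => f (bdval unit_disc phi z)).

Definition decomposition (G : C -> Prop) (p : C) (f g h : C -> C) : Prop :=
  A_infty G g /\ A_infty G h /\ h p = 0 /\
  forall w, boundary G w -> f w = bdval G g w + Cconj (bdval G h w).

(* Main.v *)
Require Import Defs.
From Stdlib Require Import ZArith Reals Lra Lia Classical ClassicalEpsilon.
From Coquelicot Require Import Coquelicot.

(* Let G + conj H be the splitting of u(t) = f(phi(e^{it})) into its nonnegative and negative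
   Fourier frequencies: by smoothness the coefficients decay rapidly, so G and H are power
   series in A^infty(D), and g = G o psi, h = H o psi with psi the inverse of phi.

   The derivative of psi is (1 / phi') o psi, so psi belongs to A^infty(Omega) as soon as it
   extends continuously to the closure, i.e. as soon as phi is injective on the circle. There,
   phi' <> 0 makes phi locally injective, so that lifting it through the parametrization of the
   Jordan curve gives an injective angle function, whose increment is 2 pi k. The winding number
   of phi on the circle around phi(0) is 1 because (phi(z) - phi(0)) / z has no zero in the closed
   disc; it is also k times the winding number of the Jordan curve, so k = 1 or k = -1, and phi is
   injective on the circle.

   For uniqueness, the Fourier coefficients of the boundary values of a function that is C^1 up to
   the boundary are its Taylor coefficients, and those with negative index vanish. Hence
   G + conj H = 0 on the circle with H(0) = 0 forces G = H = 0. The same Taylor expansion shows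
   that the derivative of such a function is again holomorphic. *)

Local Open Scope R_scope.

(** Values on the boundary are limits taken from inside ([bdval]), so the homeomorphism of closures
    has to be derived. Interior and boundary points are kept apart by the continuity of $\psi$, and
    compactness of the closed disc turns injectivity into continuity of the inverse. Only
    injectivity on the circle itself needs topology; winding numbers enter there, as increments of
    continuous lifts.

    Fourier analysis takes the place of Cauchy's formula. If $f'$ extends continuously to the closed
    disc and $I_n(r)$ is the $n$-th Fourier coefficient of $t\mapsto f(re^{it})$, then
    $I_n'=(n/r)I_n$, so $r^{-n}I_n(r)$ is constant: $r\to1$ gives the boundary coefficient, $r\to0$
    shows that it is zero for $n<0$, and Fourier inversion at fixed $r$ gives the Taylor series.

    [A_infty] asks for holomorphy of the function alone, and its higher derivatives are iterates of
    a horizontal limit. That these are complex derivatives has to be proved before the product and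
    chain rules can be iterated. *)

Lemma small_factor (A e : R) : 0 <= A -> 0 < e -> exists h, 0 < h <= 1 /\ h * A <= e.
Proof.
  intros HA He. exists (Rmin 1 (e / (A + 1))).
  assert (Hq : 0 < e / (A + 1)) by (apply Rdiv_lt_0_compat; lra).
  split; [split; [apply Rmin_glb_lt; lra|apply Rmin_l]|].
  apply Rle_trans with (e / (A + 1) * A); [apply Rmult_le_compat_r; [exact HA|apply Rmin_r]|].
  replace e with (e / (A + 1) * (A + 1)) at 2 by (field; lra).
  apply Rmult_le_compat_l; lra.
Qed.

(** * Limits, closures and complex derivatives in terms of the modulus *)

Definition is_Cderive (f : C -> C) (z l : C) : Prop :=
  @is_derive C_AbsRing C_NormedModule f z l.

Lemma locally_Cmod (z : C) (P : C -> Prop) :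
  locally z P <-> exists d, 0 < d /\ forall w, Cmod (w - z) < d -> P w.
Proof.
  split; intros H.
  - apply locally_C in H. destruct H as [d Hd]. exists d. split.
    + apply cond_pos.
    + intros w Hw. apply Hd. exact Hw.
  - apply locally_C. destruct H as [d [Hd H]]. exists (mkposreal d Hd).
    intros w Hw. apply H. exact Hw.
Qed.

Lemma filterlim_within_Cmod (G : C -> Prop) (f : C -> C) (z l : C) :
  filterlim f (within G (locally z)) (locally l) <->
  forall e, 0 < e -> exists d, 0 < d /\
    forall w, G w -> Cmod (w - z) < d -> Cmod (f w - l) < e.
Proof.
  split; intros H.
  - intros e He.
    assert (Hl : locally l (fun y : C => Cmod (y - l) < e)).
    { apply locally_Cmod. exists e. split; auto. }
    specialize (H _ Hl). unfold filtermap, within in H.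
    apply locally_Cmod in H. destruct H as [d [Hd H]].
    exists d; split; auto.
  - intros P HP. apply locally_Cmod in HP. destruct HP as [e [He HP]].
    destruct (H e He) as [d [Hd Hd']].
    unfold filtermap, within. apply locally_Cmod. exists d; split; auto.
Qed.

Lemma continuous_on_Cmod (G : C -> Prop) (f : C -> C) :
  continuous_on G f <->
  forall z, G z -> forall e, 0 < e -> exists d, 0 < d /\
    forall w, G w -> Cmod (w - z) < d -> Cmod (f w - f z) < e.
Proof.
  split; intros H z Hz; apply filterlim_within_Cmod; apply H; exact Hz.
Qed.

Lemma closure_Cmod (G : C -> Prop) (z : C) :
  closure G z <-> forall e, 0 < e -> exists w, G w /\ Cmod (w - z) < e.
Proof.
  split; intros H.
  - intros e He. destruct (H (fun w => Cmod (w - z) < e)) as [w Hw].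
    + apply locally_Cmod. exists e; split; auto.
    + exists w; tauto.
  - intros V HV. apply locally_Cmod in HV. destruct HV as [e [He HV]].
    destruct (H e He) as [w [Hw1 Hw2]]. exists w; auto.
Qed.

Lemma open_Cmod (G : C -> Prop) (z : C) :
  open G -> G z -> exists d, 0 < d /\ forall w, Cmod (w - z) < d -> G w.
Proof. intros HG Hz. apply locally_Cmod. apply HG, Hz. Qed.

Lemma subset_closure (G : C -> Prop) (z : C) : G z -> closure G z.
Proof.
  intros Hz. apply closure_Cmod. intros e He. exists z. split; auto.
  replace (z - z)%C with (RtoC 0) by ring. now rewrite Cmod_0.
Qed.

(** Membership of [z] in the closure makes the filter [within G (locally z)] proper. Limits along it
    are then unique, and [iota] has to return the value of any continuous extension. *)
Lemma bdval_extension (G : C -> Prop) (f F : C -> C) (z : C) :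
  continuous_on (closure G) F -> (forall w, G w -> F w = f w) ->
  closure G z -> bdval G f z = F z.
Proof.
  intros HF Hf Hz. unfold bdval.
  assert (HP : ProperFilter' (within G (locally z))).
  { apply Proper_StrongProper. split.
    - intros P HPP. destruct (Hz (fun w => G w -> P w)) as [w Hw]; [exact HPP|].
      exists w; tauto.
    - apply within_filter. apply locally_filter. }
  apply (@iota_filterlim_locally C_AbsRing C_CompleteNormedModule).
  - exact HP.
  - apply filterlim_within_Cmod. intros e He.
    rewrite continuous_on_Cmod in HF.
    destruct (HF z Hz e He) as [d [Hd H]]. exists d; split; auto.
    intros w Hw1 Hw2. rewrite <- Hf by auto. apply H; auto using subset_closure.
Qed.

Lemma is_derive_eps {K : AbsRing} {V : NormedModule K} (f : K -> V) (x : K) (l : V) :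
  is_derive f x l <->
  forall e, 0 < e -> exists d, 0 < d /\ forall y, abs (minus y x) < d ->
    norm (minus (minus (f y) (f x)) (scal (minus y x) l)) <= e * abs (minus y x).
Proof.
  split.
  - intros [_ H] e He. destruct (H x (fun P HP => HP) (mkposreal e He)) as [d Hd].
    exists d. split; [apply cond_pos|exact Hd].
  - intros H. split; [apply is_linear_scal_l|]. intros x' Hx e.
    rewrite <- (@is_filter_lim_locally_unique K (AbsRing_NormedModule K) x x' Hx).
    destruct (H e (cond_pos e)) as [d [Hd Hd']]. exists (mkposreal d Hd). exact Hd'.
Qed.

Lemma is_Cderive_Cmod (f : C -> C) (z l : C) :
  is_Cderive f z l <->
  forall e, 0 < e -> exists d, 0 < d /\
    forall w, Cmod (w - z) < d -> Cmod (f w - f z - l * (w - z)) <= e * Cmod (w - z).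
Proof.
  unfold is_Cderive. rewrite (@is_derive_eps C_AbsRing C_NormedModule).
  split; intros H e He; destruct (H e He) as [d [Hd Hd']]; exists d; (split; [exact Hd|]);
    intros w Hw; specialize (Hd' w Hw).
  - rewrite (Cmult_comm l). exact Hd'.
  - rewrite (Cmult_comm l) in Hd'. exact Hd'.
Qed.

(** The product rule and the inner function of the chain rule use the normed module that the
    absolute-value ring structure puts on [C], not [C_NormedModule]. The estimates underneath
    coincide. *)
Lemma is_Cderive_absring (f : C -> C) (z l : C) :
  is_Cderive f z l <-> @is_derive C_AbsRing (AbsRing_NormedModule C_AbsRing) f z l.
Proof. split; intros [_ H]; (split; [apply is_linear_scal_l|exact H]). Qed.

Lemma is_Cderive_ext_loc (f g : C -> C) (z l : C) (G : C -> Prop) :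
  open G -> G z -> (forall w, G w -> f w = g w) ->
  is_Cderive f z l -> is_Cderive g z l.
Proof.
  intros HG Hz Hfg. apply is_derive_ext_loc.
  apply locally_C. destruct (open_Cmod G z HG Hz) as [d [Hd H]].
  apply locally_Cmod. exists d; split; auto.
Qed.

Lemma is_Cderive_mult (f g : C -> C) (z a b : C) :
  is_Cderive f z a -> is_Cderive g z b ->
  is_Cderive (fun w => f w * g w)%C z (a * g z + f z * b)%C.
Proof.
  rewrite !is_Cderive_absring. intros Hf Hg.
  apply (@is_derive_mult C_AbsRing); auto. intros; apply Cmult_comm.
Qed.

Lemma is_Cderive_plus (f g : C -> C) (z a b : C) :
  is_Cderive f z a -> is_Cderive g z b ->
  is_Cderive (fun w => f w + g w)%C z (a + b)%C.
Proof. intros Hf Hg. apply (@is_derive_plus C_AbsRing C_NormedModule); auto. Qed.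

Lemma is_Cderive_comp (f g : C -> C) (z a b : C) :
  is_Cderive f (g z) a -> is_Cderive g z b ->
  is_Cderive (fun w => f (g w)) z (a * b)%C.
Proof.
  intros Hf Hg. rewrite Cmult_comm. apply (@is_derive_comp C_AbsRing C_NormedModule); auto.
  apply is_Cderive_absring; auto.
Qed.

Lemma is_Cderive_const (c z : C) : is_Cderive (fun _ => c) z 0%C.
Proof. apply (@is_derive_const C_AbsRing C_NormedModule). Qed.

Lemma is_Cderive_id (z : C) : is_Cderive (fun w => w) z 1%C.
Proof. apply is_Cderive_absring. apply (@is_derive_id C_AbsRing). Qed.

Lemma is_Cderive_unique (f : C -> C) (z a b : C) :
  is_Cderive f z a -> is_Cderive f z b -> a = b.
Proof.
  intros Ha Hb. apply is_C_derive_unique in Ha. apply is_C_derive_unique in Hb.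
  congruence.
Qed.

Lemma is_Cderive_continuous (f : C -> C) (z l : C) :
  is_Cderive f z l -> forall e, 0 < e -> exists d, 0 < d /\
    forall w, Cmod (w - z) < d -> Cmod (f w - f z) < e.
Proof.
  intros H e He. rewrite is_Cderive_Cmod in H.
  destruct (H 1 Rlt_0_1) as [d [Hd H']].
  assert (Hl := Cmod_ge_0 l).
  exists (Rmin d (e / (2 + Cmod l))). split.
  - apply Rmin_glb_lt; auto. apply Rdiv_lt_0_compat; lra.
  - intros w Hw.
    assert (Cmod (w - z) < d) by (eapply Rlt_le_trans; [exact Hw|apply Rmin_l]).
    assert (H1 : Cmod (w - z) < e / (2 + Cmod l)) by (eapply Rlt_le_trans; [exact Hw|apply Rmin_r]).
    specialize (H' w H0).
    replace (f w - f z)%C with ((f w - f z - l * (w - z)) + l * (w - z))%C by ring.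
    eapply Rle_lt_trans; [apply Cmod_triangle|]. rewrite Cmod_mult.
    apply (Rmult_lt_compat_r (2 + Cmod l)) in H1; [|lra].
    unfold Rdiv in H1. rewrite Rmult_assoc, Rinv_l, Rmult_1_r in H1 by lra.
    assert (Hw0 := Cmod_ge_0 (w - z)). nra.
Qed.

Lemma Cmod_sub_comm (z w : C) : Cmod (z - w) = Cmod (w - z).
Proof. rewrite <- Cmod_opp. f_equal. ring. Qed.

Lemma Cmod_triangle_rev (z w : C) : Cmod z - Cmod w <= Cmod (z - w).
Proof.
  assert (H := Cmod_triangle (z - w) w). replace (z - w + w)%C with z in H by ring. lra.
Qed.

Lemma is_Cderive_inv (z : C) : z <> 0%C -> is_Cderive Cinv z (- (/ z * / z))%C.
Proof.
  intros Hz. apply is_Cderive_Cmod. intros e He.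
  assert (Hm : 0 < Cmod z) by (apply Cmod_gt_0; auto).
  set (m := Cmod z) in *.
  (* The Taylor error of the inverse is exactly $(w-z)^2/(z^2w)$. The first bound keeps $|w|>m/2$;
     the second then gives $|w-z|\le e\,m^2|w|$. *)
  exists (Rmin (m / 2) (e * m ^ 3 / 2)). split.
  - apply Rmin_glb_lt; [lra|]. assert (0 < m ^ 3) by (apply pow_lt; lra). nra.
  - intros w Hw.
    assert (H1 : Cmod (w - z) < m / 2) by (eapply Rlt_le_trans; [exact Hw|apply Rmin_l]).
    assert (H2 : Cmod (w - z) < e * m ^ 3 / 2) by (eapply Rlt_le_trans; [exact Hw|apply Rmin_r]).
    assert (H3 : m / 2 < Cmod w).
    { assert (H := Cmod_triangle_rev z w). rewrite Cmod_sub_comm in H. unfold m in *. lra. }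
    assert (Hw0 : w <> 0%C) by (apply Cmod_gt_0; lra).
    replace (/ w - / z - - (/ z * / z) * (w - z))%C
      with ((w - z) * (w - z) * / (z * z * w))%C by (field; split; assumption).
    rewrite !Cmod_mult, Cmod_inv, !Cmod_mult by (repeat apply Cmult_neq_0; auto).
    fold m. set (d := Cmod (w - z)) in *.
    assert (0 <= d) by apply Cmod_ge_0.
    set (c := Cmod w) in *.
    assert (Hmm : 0 < m * m) by (apply Rmult_lt_0_compat; lra).
    assert (Hc : 0 < m * m * c) by (apply Rmult_lt_0_compat; lra).
    apply Rmult_le_reg_r with (m * m * c); [exact Hc|].
    replace (d * d * / (m * m * c) * (m * m * c)) with (d * d) by (field; lra).
    assert (d <= e * (m * m * c)).
    { apply Rle_trans with (e * m ^ 3 / 2); [lra|].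
      replace (e * m ^ 3 / 2) with (e * (m * m) * (m / 2)) by (simpl; field).
      rewrite <- !Rmult_assoc, (Rmult_assoc e).
      apply Rmult_le_compat_l; [|lra].
      apply Rmult_le_pos; lra. }
    replace (e * d * (m * m * c)) with (e * (m * m * c) * d) by ring.
    apply Rmult_le_compat_r; assumption.
Qed.

(** * Holomorphic functions with boundary values *)

(** Successive derivatives are given existentially rather than as iterates of [C_derive]. For a
    product, composite or inverse it then suffices to name one derivative and recurse, without a
    formula for the higher ones. *)
Fixpoint smooth_upto (G : C -> Prop) (n : nat) (f : C -> C) : Prop :=
  match n with
  | O => extends_continuously G f
  | S n' => extends_continuously G f /\
      exists f1, (forall z, G z -> is_Cderive f z (f1 z)) /\ smooth_upto G n' f1
  end.

Lemma extends_continuously_ext (G : C -> Prop) (f g : C -> C) :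
  (forall z, G z -> f z = g z) -> extends_continuously G f -> extends_continuously G g.
Proof.
  intros Hfg [F [HF Hf]]. exists F. split; auto.
  intros z Hz. rewrite Hf; auto.
Qed.

Lemma extends_continuously_bdval (G : C -> Prop) (f : C -> C) :
  extends_continuously G f ->
  continuous_on (closure G) (bdval G f) /\ (forall z, G z -> bdval G f z = f z).
Proof.
  intros [F [HF Hf]]. split.
  - apply continuous_on_ext with F; auto.
    intros z Hz. symmetry. apply bdval_extension; auto.
  - intros z Hz. rewrite <- Hf; auto. apply bdval_extension; auto.
    apply subset_closure; auto.
Qed.

Lemma smooth_upto_extends (G : C -> Prop) (n : nat) (f : C -> C) :
  smooth_upto G n f -> extends_continuously G f.
Proof. destruct n; simpl; tauto. Qed.

Lemma smooth_upto_weaken (G : C -> Prop) (n : nat) (f : C -> C) :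
  smooth_upto G (S n) f -> smooth_upto G n f.
Proof.
  revert f. induction n as [|n IH]; intros f H.
  - apply H.
  - destruct H as [H0 [f1 [H1 H2]]]. split; auto. exists f1; auto.
Qed.

Lemma smooth_upto_ext (G : C -> Prop) (n : nat) (f g : C -> C) :
  open G -> (forall z, G z -> f z = g z) -> smooth_upto G n f -> smooth_upto G n g.
Proof.
  intros HG Hfg H. destruct n as [|n].
  - apply extends_continuously_ext with f; auto.
  - destruct H as [H0 [f1 [H1 H2]]]. split.
    + apply extends_continuously_ext with f; auto.
    + exists f1. split; auto. intros z Hz.
      apply is_Cderive_ext_loc with f G; auto.
Qed.


(** Complex derivatives are unique, so on the open set [G] each [C_derive] agrees with the witness
    in the chain; every differentiation uses up one order. *)
Lemma smooth_upto_A_infty (G : C -> Prop) (f : C -> C) :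
  open G -> (forall n, smooth_upto G n f) -> A_infty G f.
Proof.
  intros HG H. split.
  - intros z Hz. destruct (H 1%nat) as [_ [f1 [H1 _]]]. exists (f1 z). apply H1; auto.
  - assert (Hl : forall l n, smooth_upto G n (C_derive_n f l)).
    { induction l as [|l IH]; intros n; [apply H|].
      destruct (IH (S n)) as [_ [f1 [H1 H2]]].
      apply smooth_upto_ext with f1; auto.
      intros z Hz. symmetry. apply is_C_derive_unique. apply H1; auto. }
    intros l. apply (Hl l 0%nat).
Qed.

Lemma continuous_on_const (G : C -> Prop) (c : C) : continuous_on G (fun _ : C => c : C).
Proof. intros z _. apply filterlim_const. Qed.

Lemma continuous_on_id (G : C -> Prop) : continuous_on G (fun z : C => z).
Proof. apply continuous_on_Cmod. intros z _ e He. exists e. split; auto. Qed.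

Lemma continuous_on_Cplus (G : C -> Prop) (f g : C -> C) :
  continuous_on G f -> continuous_on G g -> continuous_on G (fun z => f z + g z)%C.
Proof.
  intros Hf Hg z Hz.
  apply (filterlim_comp_2 (G := locally (f z)) (H := locally (g z))); auto.
  apply (@filterlim_plus C_AbsRing C_NormedModule).
Qed.

Lemma extends_continuously_const (G : C -> Prop) (c : C) :
  extends_continuously G (fun _ => c).
Proof. exists (fun _ => c). split; [apply continuous_on_const|auto]. Qed.

Lemma extends_continuously_id (G : C -> Prop) : extends_continuously G (fun z => z).
Proof. exists (fun z => z). split; [apply continuous_on_id|auto]. Qed.

Lemma extends_continuously_plus (G : C -> Prop) (f g : C -> C) :
  extends_continuously G f -> extends_continuously G g ->
  extends_continuously G (fun z => f z + g z)%C.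
Proof.
  intros [F [HF Hf]] [K [HK Hg]]. exists (fun z => F z + K z)%C. split.
  - apply continuous_on_Cplus; assumption.
  - intros z Hz. rewrite Hf, Hg; auto.
Qed.

Lemma continuous_on_Cmult (G : C -> Prop) (f g : C -> C) :
  continuous_on G f -> continuous_on G g ->
  continuous_on G (fun z => f z * g z)%C.
Proof.
  rewrite !continuous_on_Cmod. intros Hf Hg z Hz e He.
  set (a := Cmod (f z)). set (b := Cmod (g z)).
  assert (Ha : 0 <= a) by apply Cmod_ge_0. assert (Hb : 0 <= b) by apply Cmod_ge_0.
  destruct (small_factor (a + b + 2) e) as [h [[Hh Hh1] Hh2]]; [lra|exact He|].
  destruct (Hf z Hz h Hh) as [d1 [Hd1 H1]]. destruct (Hg z Hz h Hh) as [d2 [Hd2 H2]].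
  exists (Rmin d1 d2). split; [apply Rmin_glb_lt; auto|].
  intros w Hw Hwz.
  assert (K1 : Cmod (f w - f z) < h) by (apply H1; auto; eapply Rlt_le_trans; [exact Hwz|apply Rmin_l]).
  assert (K2 : Cmod (g w - g z) < h) by (apply H2; auto; eapply Rlt_le_trans; [exact Hwz|apply Rmin_r]).
  replace (f w * g w - f z * g z)%C
    with ((f w - f z) * (g w - g z) + (f z * (g w - g z) + (f w - f z) * g z))%C by ring.
  eapply Rle_lt_trans; [apply Cmod_triangle|].
  eapply Rle_lt_trans; [apply Rplus_le_compat_l, Cmod_triangle|].
  rewrite !Cmod_mult. fold a b.
  assert (0 <= Cmod (f w - f z)) by apply Cmod_ge_0.
  assert (0 <= Cmod (g w - g z)) by apply Cmod_ge_0.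
  set (x := Cmod (f w - f z)) in *. set (y := Cmod (g w - g z)) in *.
  assert (x * y <= h * 1) by (apply Rmult_le_compat; lra).
  assert (a * y <= a * h) by (apply Rmult_le_compat_l; lra).
  assert (x * b <= h * b) by (apply Rmult_le_compat_r; lra).
  lra.
Qed.

Lemma extends_continuously_mult (G : C -> Prop) (f g : C -> C) :
  extends_continuously G f -> extends_continuously G g ->
  extends_continuously G (fun z => f z * g z)%C.
Proof.
  intros [F [HF Hf]] [K [HK Hg]]. exists (fun z => F z * K z)%C. split.
  - apply continuous_on_Cmult; auto.
  - intros z Hz. rewrite Hf, Hg; auto.
Qed.

Lemma closure_map (G1 G2 : C -> Prop) (M : C -> C) (z : C) :
  continuous_on (closure G1) M -> (forall w, G1 w -> G2 (M w)) ->
  closure G1 z -> closure G2 (M z).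
Proof.
  intros HM HG Hz. apply closure_Cmod. intros e He.
  rewrite continuous_on_Cmod in HM. destruct (HM z Hz e He) as [d [Hd H]].
  rewrite closure_Cmod in Hz. destruct (Hz d Hd) as [w [Hw1 Hw2]].
  exists (M w). split; auto. apply H; auto using subset_closure.
Qed.

Lemma continuous_on_Ccomp (G1 G2 : C -> Prop) (F M : C -> C) :
  continuous_on G2 F -> continuous_on G1 M -> (forall z, G1 z -> G2 (M z)) ->
  continuous_on G1 (fun z => F (M z)).
Proof.
  rewrite !continuous_on_Cmod. intros HF HM HG z Hz e He.
  destruct (HF (M z) (HG z Hz) e He) as [d [Hd H]].
  destruct (HM z Hz d Hd) as [d' [Hd' H']]. exists d'. split; auto.
Qed.

Lemma extends_continuously_comp (G1 G2 : C -> Prop) (f m : C -> C) :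
  (forall z, G1 z -> G2 (m z)) ->
  extends_continuously G2 f -> extends_continuously G1 m ->
  extends_continuously G1 (fun z => f (m z)).
Proof.
  intros HG [F [HF Hf]] [M [HM Hm]].
  assert (HGM : forall w, G1 w -> G2 (M w)) by (intros w Hw; rewrite Hm; auto).
  exists (fun z => F (M z)). split.
  - apply continuous_on_Ccomp with (closure G2); auto.
    intros z Hz. apply closure_map with G1; auto.
  - intros z Hz. rewrite Hm, Hf; auto.
Qed.

Lemma extends_continuously_inv (G : C -> Prop) (p : C -> C) :
  extends_continuously G p -> (forall z, closure G z -> bdval G p z <> 0%C) ->
  extends_continuously G (fun z => / p z)%C.
Proof.
  intros Hp Hp0. apply extends_continuously_bdval in Hp. destruct Hp as [HP Hp].
  exists (fun z => / bdval G p z)%C. split.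
  - apply continuous_on_Ccomp with (fun z : C => z <> 0%C); auto.
    apply continuous_on_Cmod. intros z Hz e He.
    destruct (is_Cderive_continuous _ _ _ (is_Cderive_inv z Hz) e He) as [d [Hd H]].
    exists d; split; auto.
  - intros z Hz. rewrite Hp; auto.
Qed.

Lemma smooth_upto_const (G : C -> Prop) (n : nat) (c : C) : smooth_upto G n (fun _ => c).
Proof.
  revert c. induction n as [|n IH]; intros c; [apply extends_continuously_const|].
  split; [apply extends_continuously_const|].
  exists (fun _ => 0%C). split; auto. intros z _. apply is_Cderive_const.
Qed.

Lemma smooth_upto_id (G : C -> Prop) (n : nat) : smooth_upto G n (fun z => z).
Proof.
  destruct n as [|n]; [apply extends_continuously_id|].
  split; [apply extends_continuously_id|].
  exists (fun _ => 1%C). split; [|apply smooth_upto_const]. intros z _. apply is_Cderive_id.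
Qed.

Lemma smooth_upto_plus (G : C -> Prop) (n : nat) (f g : C -> C) :
  smooth_upto G n f -> smooth_upto G n g -> smooth_upto G n (fun z => f z + g z)%C.
Proof.
  revert f g. induction n as [|n IH]; intros f g Hf Hg.
  - apply extends_continuously_plus; auto.
  - split; [apply extends_continuously_plus; apply smooth_upto_extends with (S n); auto|].
    destruct Hf as [_ [f1 [Hf1 Hf2]]]. destruct Hg as [_ [g1 [Hg1 Hg2]]].
    exists (fun z => f1 z + g1 z)%C. split; auto.
    intros z Hz. apply is_Cderive_plus; auto.
Qed.

Lemma smooth_upto_mult (G : C -> Prop) (n : nat) (f g : C -> C) :
  smooth_upto G n f -> smooth_upto G n g -> smooth_upto G n (fun z => f z * g z)%C.
Proof.
  revert f g. induction n as [|n IH]; intros f g Hf Hg.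
  - apply extends_continuously_mult; auto.
  - assert (Hf' := smooth_upto_weaken _ _ _ Hf). assert (Hg' := smooth_upto_weaken _ _ _ Hg).
    split; [apply extends_continuously_mult; apply smooth_upto_extends with (S n); auto|].
    destruct Hf as [_ [f1 [Hf1 Hf2]]]. destruct Hg as [_ [g1 [Hg1 Hg2]]].
    exists (fun z => f1 z * g z + f z * g1 z)%C. split.
    + intros z Hz. apply is_Cderive_mult; auto.
    + apply smooth_upto_plus; auto.
Qed.

(** The derivative [f1 (m z) * m1 z] contains a composite of one order less with the same inner
    function, so the induction generalizes over [f] and merely weakens the order of [m]. *)
Lemma smooth_upto_comp (G1 G2 : C -> Prop) (n : nat) (f m : C -> C) :
  (forall z, G1 z -> G2 (m z)) ->
  smooth_upto G2 n f -> smooth_upto G1 n m -> smooth_upto G1 n (fun z => f (m z)).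
Proof.
  intros HG. revert f. induction n as [|n IH]; intros f Hf Hm.
  - apply extends_continuously_comp with G2; auto.
  - split; [apply extends_continuously_comp with G2; auto; apply smooth_upto_extends with (S n); auto|].
    assert (Hm' := smooth_upto_weaken _ _ _ Hm).
    destruct Hf as [_ [f1 [Hf1 Hf2]]]. destruct Hm as [_ [m1 [Hm1 Hm2]]].
    exists (fun z => f1 (m z) * m1 z)%C. split.
    + intros z Hz. apply is_Cderive_comp; auto.
    + apply smooth_upto_mult; auto.
Qed.

(** The derivative $-p'/p^2$ involves $1/p$ itself, one order lower, where the induction hypothesis
    applies. *)
Lemma smooth_upto_inv (G : C -> Prop) (n : nat) (p : C -> C) :
  (forall z, closure G z -> bdval G p z <> 0%C) ->
  smooth_upto G n p -> smooth_upto G n (fun z => / p z)%C.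
Proof.
  intros Hp0. induction n as [|n IH]; intros Hp.
  - apply extends_continuously_inv; auto.
  - assert (He := smooth_upto_extends _ _ _ Hp). assert (Hp' := smooth_upto_weaken _ _ _ Hp).
    split; [apply extends_continuously_inv; auto|].
    destruct Hp as [_ [p1 [Hp1 Hp2]]].
    exists (fun z => ((-1) * (/ p z * / p z)) * p1 z)%C. split.
    + intros z Hz. replace ((-1) * (/ p z * / p z))%C with (- (/ p z * / p z))%C by ring.
      apply is_Cderive_comp; auto. apply is_Cderive_inv.
      apply extends_continuously_bdval in He. destruct He as [_ He]. rewrite <- He; auto.
      apply Hp0. apply subset_closure; auto.
    + repeat apply smooth_upto_mult; auto. apply (smooth_upto_const G n (-1)).
Qed.

(** * Compactness and continuous arguments *)

Lemma Cmod_le_abs_sum (z : C) : Cmod z <= Rabs (Re z) + Rabs (Im z).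
Proof.
  destruct z as [x y]. unfold Cmod; simpl.
  rewrite <- (sqrt_Rsqr (Rabs x + Rabs y)) by (assert (H := Rabs_pos x); assert (H' := Rabs_pos y); lra).
  apply sqrt_le_1_alt. unfold Rsqr.
  assert (Hx := Rabs_pos x). assert (Hy := Rabs_pos y).
  replace (x * (x * 1)) with (Rabs x * Rabs x) by (rewrite <- Rabs_mult, Rmult_1_r; apply Rabs_pos_eq; nra).
  replace (y * (y * 1)) with (Rabs y * Rabs y) by (rewrite <- Rabs_mult, Rmult_1_r; apply Rabs_pos_eq; nra).
  nra.
Qed.

Lemma abs_Re_le (z : C) : Rabs (Re z) <= Cmod z.
Proof. eapply Rle_trans; [apply Rmax_l|]. apply Rmax_Cmod. Qed.

Lemma abs_Im_le (z : C) : Rabs (Im z) <= Cmod z.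
Proof. eapply Rle_trans; [apply Rmax_r|]. apply Rmax_Cmod. Qed.

Definition compact_set (A : C -> Prop) : Prop :=
  (exists M, forall z, A z -> Cmod z <= M) /\
  (forall z, ~ A z -> exists d, 0 < d /\ forall w, Cmod (w - z) < d -> ~ A w).

(** [Q z d] is to be read as: the size [d] is good enough at [z]. A size that works near each point
    can be made uniform. The proof uses gauges on a square containing [A]; points off [A] receive a
    gauge so small that nothing of [A] is near them. Uniform continuity and positive lower bounds
    are both obtained by a choice of [Q]. *)
Lemma compact_uniform (A : C -> Prop) (Q : C -> R -> Prop) :
  compact_set A ->
  (forall z d d', Q z d -> 0 < d' <= d -> Q z d') ->
  (forall u, A u -> exists d, 0 < d /\ forall z, A z -> Cmod (z - u) < d -> Q z d) ->
  exists d, 0 < d /\ forall z, A z -> Q z d.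
Proof.
  intros [[M HM] HA] HQ Hloc.
  (* The gauge controls each coordinate separately, and the modulus is bounded by the sum of the
     two; hence the factor 2. *)
  assert (Hd : forall u v, exists d : posreal,
    forall z, A z -> Cmod (z - (u, v)) < 2 * d -> Q z d).
  { intros u v. destruct (classic (A (u, v))) as [Huv|Huv].
    - destruct (Hloc _ Huv) as [d [Hd H]].
      assert (Hd2 : 0 < d / 2) by lra.
      exists (mkposreal _ Hd2). simpl. intros z Hz Hzu.
      apply HQ with d; [apply H; auto; lra|lra].
    - destruct (HA _ Huv) as [d [Hd H]].
      assert (Hd2 : 0 < d / 2) by lra.
      exists (mkposreal _ Hd2). simpl. intros z Hz Hzu.
      exfalso. apply (H z); auto. lra. }
  set (delta := fun u v => proj1_sig (constructive_indefinite_description _ (Hd u v))).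
  destruct (compactness_value_2d (-M) M (-M) M delta) as [d H].
  exists d. split; [apply cond_pos|].
  intros z Hz.
  (* The covering property [H] is doubly negated, so it can only be used towards a contradiction. *)
  destruct (classic (Q z d)) as [|Hn]; [assumption|exfalso].
  assert (Hre := abs_Re_le z). assert (Him := abs_Im_le z). assert (HMz := HM z Hz).
  apply (H (Re z) (Im z)).
  - apply Rabs_le_between. lra.
  - apply Rabs_le_between. lra.
  - intros [u [v [_ [_ [H1 [H2 H3]]]]]]. apply Hn.
    apply HQ with (delta u v); [|split; [apply cond_pos|exact H3]].
    unfold delta in *.
    destruct (constructive_indefinite_description _ (Hd u v)) as [d0 Hd0]; simpl in *.
    apply Hd0; auto.
    eapply Rle_lt_trans; [apply Cmod_le_abs_sum|].
    destruct z as [x y]; simpl in *. unfold Rminus in *. lra.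
Qed.

Lemma compact_closed_disc : compact_set (fun z => Cmod z <= 1).
Proof.
  split; [exists 1; auto|]. intros z Hz. exists (Cmod z - 1). split; [lra|]. intros w Hw.
  assert (H := Cmod_triangle_rev z w). rewrite Cmod_sub_comm in H. lra.
Qed.

Lemma compact_unit_circle : compact_set unit_circle.
Proof.
  unfold unit_circle. split; [exists 1; intros; lra|]. intros z Hz.
  exists (Rabs (Cmod z - 1)). split; [apply Rabs_pos_lt; lra|]. intros w Hw E.
  assert (H1 := Cmod_triangle_rev w z). assert (H2 := Cmod_triangle_rev z w).
  rewrite Cmod_sub_comm in H2. rewrite E in *.
  revert Hw. unfold Rabs. destruct (Rcase_abs _); lra.
Qed.

Lemma compact_rectangle (a b a' b' : R) :
  compact_set (fun z => a <= Re z <= b /\ a' <= Im z <= b').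
Proof.
  split.
  - exists ((Rabs a + Rabs b) + (Rabs a' + Rabs b')). intros z [H1 H2].
    assert (Hb : forall x y t, x <= t <= y -> Rabs t <= Rabs x + Rabs y).
    { intros x y t Ht. assert (K1 := Rle_abs y). assert (K2 := Rle_abs (- x)). rewrite Rabs_Ropp in K2.
      assert (K3 := Rabs_pos x). assert (K4 := Rabs_pos y). apply Rabs_le. lra. }
    eapply Rle_trans; [apply Cmod_le_abs_sum|]. apply Rplus_le_compat; auto.
  - intros z Hz.
    assert (Hclose : forall w, Rabs (Re w - Re z) <= Cmod (w - z) /\ Rabs (Im w - Im z) <= Cmod (w - z)).
    { intros w. split; [apply (abs_Re_le (w - z))|apply (abs_Im_le (w - z))]. }
    assert (Hcase : 0 < a - Re z \/ 0 < Re z - b \/ 0 < a' - Im z \/ 0 < Im z - b') by lra.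
    destruct Hcase as [Hc|[Hc|[Hc|Hc]]]; eexists; (split; [exact Hc|]);
      intros w Hw [H1 H2]; destruct (Hclose w) as [K1 K2];
      apply Rabs_le_between in K1; apply Rabs_le_between in K2; lra.
Qed.

(** * The unit circle, polar coordinates and continuity of complex paths *)

Lemma Cmod_cis (t : R) : Cmod (cis t) = 1.
Proof.
  unfold Cmod, cis; simpl.
  replace (cos t * (cos t * 1) + sin t * (sin t * 1)) with 1; [apply sqrt_1|].
  assert (H := sin2_cos2 t). unfold Rsqr in H. lra.
Qed.

Lemma Cmod_polar (r t : R) : 0 <= r -> Cmod (r * cis t) = r.
Proof. intros Hr. rewrite Cmod_mult, Cmod_cis, Cmod_R, Rabs_pos_eq; lra. Qed.

Lemma cis_nonzero (t : R) : cis t <> 0%C.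
Proof. apply Cmod_gt_0. rewrite Cmod_cis. lra. Qed.

Lemma cis_plus (a b : R) : cis (a + b) = (cis a * cis b)%C.
Proof.
  unfold cis, Cmult; simpl. rewrite cos_plus, sin_plus. f_equal; ring.
Qed.

Lemma cis_0 : cis 0 = 1%C.
Proof. unfold cis. rewrite cos_0, sin_0. reflexivity. Qed.

Lemma cis_INR (k : nat) (t : R) : cis (INR k * t) = (cis t ^ k)%C.
Proof.
  induction k as [|k IH].
  - simpl. rewrite Rmult_0_l, cis_0. reflexivity.
  - rewrite S_INR, Cpow_S, <- IH, <- cis_plus. f_equal. ring.
Qed.

Lemma cis_opp (a : R) : cis (- a) = Cconj (cis a).
Proof. unfold cis, Cconj; simpl. rewrite cos_neg, sin_neg. reflexivity. Qed.

Lemma cis_2PI : cis (2 * PI) = 1%C.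
Proof. unfold cis. rewrite cos_2PI, sin_2PI. reflexivity. Qed.

Lemma cis_period_Z (k : Z) : cis (2 * PI * IZR k) = 1%C.
Proof.
  unfold cis. rewrite (Rmult_comm 2), Rmult_assoc, (Rmult_comm PI).
  replace (2 * IZR k * PI) with (2 * (IZR k * PI)) by ring.
  rewrite cos_2a_sin, sin_2a.
  rewrite (sin_eq_0_1 (IZR k * PI)) by (exists k; reflexivity).
  unfold RtoC. f_equal; ring.
Qed.

Lemma cis_eq_inv (a b : R) : cis a = cis b -> exists k : Z, a - b = 2 * PI * IZR k.
Proof.
  intros H. injection H as Hc Hs.
  assert (H1 : cos (a - b) = 1).
  { rewrite cos_minus, Hc, Hs. assert (H1 := sin2_cos2 b). unfold Rsqr in H1. lra. }
  assert (H2 : sin ((a - b) / 2) = 0).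
  { replace (a - b) with (2 * ((a - b) / 2)) in H1 by field. rewrite cos_2a_sin in H1. nra. }
  apply sin_eq_0_0 in H2. destruct H2 as [k Hk]. exists k. lra.
Qed.

Lemma polar_form (z : C) : exists t, 0 <= t <= 2 * PI /\ z = (Cmod z * cis t)%C.
Proof.
  assert (HPI := PI_RGT_0).
  destruct (classic (z = 0%C)) as [->|Hz].
  { exists 0. split; [lra|]. rewrite Cmod_0. ring. }
  assert (Hm : 0 < Cmod z) by (apply Cmod_gt_0; auto).
  assert (Hx := abs_Re_le z). apply Rabs_le_between in Hx.
  set (c := Re z / Cmod z).
  assert (Hc : -1 <= c <= 1).
  { unfold c. split.
    - apply Rmult_le_reg_r with (Cmod z); auto. unfold Rdiv. rewrite Rmult_assoc, Rinv_l; lra.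
    - apply Rmult_le_reg_r with (Cmod z); auto. unfold Rdiv. rewrite Rmult_assoc, Rinv_l; lra. }
  assert (Hcz : Cmod z * c = Re z) by (unfold c; field; lra).
  assert (Hs : Rsqr (Cmod z * sqrt (1 - Rsqr c)) = Rsqr (Im z)).
  { rewrite Rsqr_mult, Rsqr_sqrt by (unfold Rsqr; nra).
    assert (H := Cmod2_alt z). unfold Rsqr.
    replace (Cmod z * Cmod z * (1 - c * c)) with (Cmod z ^ 2 - (Cmod z * c) * (Cmod z * c)) by ring.
    rewrite Hcz, H. ring. }
  assert (Hp : 0 <= Cmod z * sqrt (1 - Rsqr c)) by (apply Rmult_le_pos; [lra|apply sqrt_pos]).
  assert (Hb := acos_bound c).
  destruct (Rle_dec 0 (Im z)) as [Hi|Hi].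
  - exists (acos c). split; [lra|].
    unfold cis. rewrite cos_acos, sin_acos by auto.
    rewrite (surjective_pairing z) at 1. unfold Cmult; simpl. f_equal.
    + unfold Re in Hcz. lra.
    + apply Rsqr_inj in Hs; auto. unfold Im in Hs. lra.
  - exists (2 * PI - acos c). split; [lra|].
    unfold cis. rewrite cos_minus, sin_minus, cos_2PI, sin_2PI, cos_acos, sin_acos by auto.
    rewrite (surjective_pairing z) at 1. unfold Cmult; simpl. f_equal.
    + unfold Re in Hcz. lra.
    + rewrite (Rsqr_neg (Im z)) in Hs. apply Rsqr_inj in Hs; auto; [|lra]. unfold Im in Hs. lra.
Qed.

Lemma unit_circle_cis (z : C) : unit_circle z -> exists t, 0 <= t <= 2 * PI /\ z = cis t.
Proof.
  intros Hz. destruct (polar_form z) as [t [Ht H]]. exists t. split; auto.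
  rewrite H, Hz. ring.
Qed.

Lemma is_derive_cos_sin (t : R) :
  is_derive (fun s => cos s) t (- sin t) /\ is_derive (fun s => sin s) t (cos t).
Proof. split; auto_derive; auto; ring. Qed.

Lemma cis_lipschitz (a b : R) : Cmod (cis a - cis b) <= 2 * Rabs (a - b).
Proof.
  eapply Rle_trans; [apply Cmod_le_abs_sum|]. unfold cis; simpl.
  assert (H1 : Rabs (cos a - cos b) <= Rabs (a - b)).
  { destruct (MVT_gen cos b a (fun t => - sin t)) as [c [_ Hc]].
    - intros; apply is_derive_cos_sin.
    - intros; apply continuity_cos.
    - rewrite Hc, Rabs_mult, Rabs_Ropp. assert (H := SIN_bound c).
      assert (Rabs (sin c) <= 1) by (apply Rabs_le; lra).
      assert (Hab := Rabs_pos (a - b)). nra. }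
  assert (H2 : Rabs (sin a - sin b) <= Rabs (a - b)).
  { destruct (MVT_gen sin b a cos) as [c [_ Hc]].
    - intros; apply is_derive_cos_sin.
    - intros; apply continuity_sin.
    - rewrite Hc, Rabs_mult. assert (H := COS_bound c).
      assert (Rabs (cos c) <= 1) by (apply Rabs_le; lra).
      assert (Hab := Rabs_pos (a - b)). nra. }
  unfold Rminus in *. lra.
Qed.

Lemma Cmult_reg_r (a b c : C) : c <> 0%C -> (a * c)%C = (b * c)%C -> a = b.
Proof.
  intros Hc H. apply (f_equal (fun z => z * / c)%C) in H.
  rewrite <- !Cmult_assoc, Cinv_r, !Cmult_1_r in H by auto. exact H.
Qed.

(** On the right half plane the principal argument is an arctangent, hence visibly continuous. It
    supplies the small increments from which arguments are lifted. *)
Lemma cis_atan (w : C) : 0 < Re w -> w = (Cmod w * cis (atan (Im w / Re w)))%C.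
Proof.
  intros Hw. destruct w as [x y]. simpl in *.
  unfold cis. rewrite cos_atan, sin_atan.
  assert (H : Cmod (x, y) = x * sqrt (1 + (y / x)²)).
  { unfold Cmod; simpl fst; simpl snd.
    rewrite <- (sqrt_Rsqr x) at 2 by lra. rewrite <- sqrt_mult_alt by apply Rle_0_sqr.
    f_equal. unfold Rsqr. field. lra. }
  rewrite H.
  assert (Hs : 0 < sqrt (1 + (y / x)²)).
  { apply sqrt_lt_R0. assert (Hsq := Rle_0_sqr (y / x)). lra. }
  unfold Cmult; simpl. f_equal; field; lra.
Qed.

Lemma continuous_C_eps (f : R -> C) (t : R) :
  continuous f t <-> forall e, 0 < e -> exists d, 0 < d /\
    forall s, Rabs (s - t) < d -> Cmod (f s - f t) < e.
Proof.
  split; intros H.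
  - intros e He.
    assert (Hl : locally (f t) (fun y : C => Cmod (y - f t) < e)).
    { apply locally_Cmod. exists e. split; auto. }
    specialize (H _ Hl). destruct H as [d H]. exists d. split; [apply cond_pos|].
    intros s Hs. apply H. exact Hs.
  - intros P HP. apply locally_Cmod in HP. destruct HP as [e [He HP]].
    destruct (H e He) as [d [Hd Hd']]. exists (mkposreal d Hd). intros s Hs.
    apply HP, Hd'. exact Hs.
Qed.

Lemma continuous_R_eps (f : R -> R) (t : R) :
  continuous f t <-> forall e, 0 < e -> exists d, 0 < d /\
    forall s, Rabs (s - t) < d -> Rabs (f s - f t) < e.
Proof.
  split; intros H.
  - intros e He.
    assert (Hl : locally (f t) (fun y => Rabs (y - f t) < e)).
    { exists (mkposreal e He). intros y Hy. exact Hy. }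
    specialize (H _ Hl). destruct H as [d H]. exists d. split; [apply cond_pos|].
    intros s Hs. apply H. exact Hs.
  - intros P [e HP]. destruct (H e (cond_pos e)) as [d [Hd Hd']].
    exists (mkposreal d Hd). intros s Hs. apply HP, Hd'. exact Hs.
Qed.

Lemma continuous_Re (f : R -> C) (t : R) : continuous f t -> continuous (fun s => Re (f s)) t.
Proof.
  rewrite continuous_C_eps, continuous_R_eps. intros H e He.
  destruct (H e He) as [d [Hd H']]. exists d. split; auto. intros s Hs.
  eapply Rle_lt_trans; [|apply (H' s Hs)].
  replace (Re (f s) - Re (f t)) with (Re (f s - f t)) by reflexivity.
  apply abs_Re_le.
Qed.

Lemma continuous_Im (f : R -> C) (t : R) : continuous f t -> continuous (fun s => Im (f s)) t.
Proof.
  rewrite continuous_C_eps, continuous_R_eps. intros H e He.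
  destruct (H e He) as [d [Hd H']]. exists d. split; auto. intros s Hs.
  eapply Rle_lt_trans; [|apply (H' s Hs)].
  replace (Im (f s) - Im (f t)) with (Im (f s - f t)) by reflexivity.
  apply abs_Im_le.
Qed.

Lemma continuous_cis (t : R) : continuous cis t.
Proof.
  apply continuous_C_eps. intros e He. exists (e / 2). split; [lra|].
  intros s Hs. eapply Rle_lt_trans; [apply cis_lipschitz|]. lra.
Qed.

(** In $a\bar b=|b|^2+(a-b)\bar b$ the second term has modulus less than $|b|^2$. Thus [a] has an
    argument within $\pi/2$ of that of [b]. *)
Lemma Re_mul_conj_pos (a b : C) : Cmod (a - b) < Cmod b -> 0 < Re (a * Cconj b).
Proof.
  intros H. assert (Hb := Cmod_ge_0 (a - b)).
  replace (a * Cconj b)%C with (b * Cconj b + (a - b) * Cconj b)%C by ring.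
  rewrite re_plus.
  assert (H1 : Re (b * Cconj b) = Cmod b * Cmod b).
  { assert (H1 := Cmod2_conj b). rewrite <- H1. simpl. ring. }
  assert (H2 : Rabs (Re ((a - b) * Cconj b)) <= Cmod (a - b) * Cmod b).
  { eapply Rle_trans; [apply abs_Re_le|]. rewrite Cmod_mult, Cmod_conj. lra. }
  apply Rabs_le_between in H2. nra.
Qed.

(** * Continuous arguments along homotopies *)

Definition jointly_continuous (F : R -> R -> C) : Prop :=
  forall s t e, 0 < e -> exists d, 0 < d /\
    forall s' t', Rabs (s' - s) < d -> Rabs (t' - t) < d -> Cmod (F s' t' - F s t) < e.

(** A nonvanishing function on a compact rectangle changes by less than its own modulus over short
    steps in [s]. This is the hypothesis of [Re_mul_conj_pos], uniformly in [t]. *)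
Lemma jointly_continuous_uniform_step (F : R -> R -> C) (a b : R) :
  jointly_continuous F -> (forall s t, F s t <> 0%C) ->
  exists d, 0 < d /\ forall s s' t, 0 <= s <= 1 -> a <= t <= b -> Rabs (s' - s) < d ->
    Cmod (F s' t - F s t) < Cmod (F s t).
Proof.
  intros HF HF0.
  destruct (compact_uniform (fun z => 0 <= Re z <= 1 /\ a <= Im z <= b)
    (fun z d => forall s', Rabs (s' - Re z) < d ->
       Cmod (F s' (Im z) - F (Re z) (Im z)) < Cmod (F (Re z) (Im z)))) as [d [Hd H]].
  - apply compact_rectangle.
  - intros z d d' H [_ Hd'] s' Hs'. apply H. lra.
  - intros u Hu. set (m := Cmod (F (Re u) (Im u))).
    assert (Hm : 0 < m) by (apply Cmod_gt_0; auto).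
    (* With both values within $m/3$ of the value at [u], the increment is below $2m/3$ while the
       modulus stays above $2m/3$. *)
    assert (Hm3 : 0 < m / 3) by lra.
    destruct (HF (Re u) (Im u) (m / 3) Hm3) as [d [Hd H]].
    exists (d / 2). split; [lra|].
    intros z Hz Hzu s' Hs'.
    assert (K1 : Rabs (Re z - Re u) < d / 2) by (eapply Rle_lt_trans; [apply (abs_Re_le (z - u))|auto]).
    assert (K2 : Rabs (Im z - Im u) < d / 2) by (eapply Rle_lt_trans; [apply (abs_Im_le (z - u))|auto]).
    assert (K3 : Rabs (s' - Re u) < d).
    { replace (s' - Re u) with ((s' - Re z) + (Re z - Re u)) by ring.
      eapply Rle_lt_trans; [apply Rabs_triang|]. lra. }
    assert (L1 : Cmod (F s' (Im z) - F (Re u) (Im u)) < m / 3) by (apply H; lra).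
    assert (L2 : Cmod (F (Re z) (Im z) - F (Re u) (Im u)) < m / 3) by (apply H; lra).
    assert (L3 := Cmod_triangle_rev (F (Re u) (Im u)) (F (Re z) (Im z))).
    rewrite Cmod_sub_comm in L3. fold m in L3.
    replace (F s' (Im z) - F (Re z) (Im z))%C
      with ((F s' (Im z) - F (Re u) (Im u)) + (F (Re u) (Im u) - F (Re z) (Im z)))%C by ring.
    eapply Rle_lt_trans; [apply Cmod_triangle|].
    rewrite (Cmod_sub_comm (F (Re u) (Im u))). lra.
  - exists d. split; auto. intros s s' t Hs Ht Hss. apply (H (s, t)); auto.
Qed.

Lemma jointly_continuous_snd (F : R -> R -> C) (s t : R) :
  jointly_continuous F -> continuous (F s) t.
Proof.
  intros HF. apply continuous_C_eps. intros e He. destruct (HF s t e He) as [d [Hd H]].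
  exists d. split; auto. intros t' Ht'. apply H; auto.
  rewrite Rminus_diag, Rabs_R0. auto.
Qed.

(** Scaling the parameter contracts a path to its value at 0. This is the homotopy through which a
    single path is fed to [argument_lift]. *)
Lemma jointly_continuous_product (f : R -> C) :
  (forall t, continuous f t) -> jointly_continuous (fun s t => f (s * t)).
Proof.
  intros Hf x s e He. destruct (proj1 (continuous_C_eps f (x * s)) (Hf _) e He) as [d [Hd H]].
  assert (X := Rabs_pos x). assert (S := Rabs_pos s).
  destruct (small_factor (Rabs x + Rabs s + 2) d) as [h [[Hh Hh1] Hh2]]; [lra|exact Hd|].
  exists h. split; auto. intros x' s' Hx' Hs'. apply H.
  replace (x' * s' - x * s) with ((x' - x) * (s' - s) + (x * (s' - s) + (x' - x) * s)) by ring.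
  eapply Rle_lt_trans; [apply Rabs_triang|].
  eapply Rle_lt_trans; [apply Rplus_le_compat_l, Rabs_triang|]. rewrite !Rabs_mult.
  set (p := Rabs (x' - x)) in *. set (q := Rabs (s' - s)) in *.
  assert (0 <= p) by apply Rabs_pos. assert (0 <= q) by apply Rabs_pos.
  assert (p * q <= h * 1) by (apply Rmult_le_compat; lra).
  assert (Rabs x * q <= Rabs x * h) by (apply Rmult_le_compat_l; lra).
  assert (p * Rabs s <= h * Rabs s) by (apply Rmult_le_compat_r; lra). lra.
Qed.

(* Homotopy lifting for the argument: a continuous argument is transported along
   small steps in [s], each step multiplying by a factor in the right half plane. *)
Lemma argument_lift (F : R -> R -> C) (a b : R) :
  jointly_continuous F -> (forall s t, F s t <> 0%C) -> (forall t, F 0 t = F 0 0) ->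
  exists theta : R -> R,
    (forall t, a <= t <= b -> continuous theta t /\ F 1 t = (Cmod (F 1 t) * cis (theta t))%C) /\
    (forall t t', a <= t <= b -> a <= t' <= b -> (forall s, F s t = F s t') -> theta t = theta t').
Proof.
  intros HF HF0 Hc.
  destruct (jointly_continuous_uniform_step F a b HF HF0) as [d [Hd Hstep]].
  (* The second clause travels with the induction: parameters at which the whole homotopy agrees
     keep equal arguments. It later makes the lift over a closed loop of nullhomotopic type return
     to its initial value. *)
  set (P := fun s => exists theta : R -> R,
    (forall t, a <= t <= b -> continuous theta t /\ F s t = (Cmod (F s t) * cis (theta t))%C) /\
    (forall t t', a <= t <= b -> a <= t' <= b -> (forall s, F s t = F s t') -> theta t = theta t')).
  assert (H0 : P 0).
  { destruct (polar_form (F 0 0)) as [t0 [_ Ht0]]. exists (fun _ => t0). split; [|auto].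
    intros t Ht. split; [apply continuous_const|]. rewrite Hc. exact Ht0. }
  assert (HP : forall s s', 0 <= s <= 1 -> Rabs (s' - s) < d -> P s -> P s').
  { intros s s' Hs Hss [theta [H1 H2]].
    exists (fun t => theta t + atan (Im (F s' t * Cconj (F s t)) / Re (F s' t * Cconj (F s t)))).
    split.
    - intros t Ht. destruct (H1 t Ht) as [Hcont Harg].
      assert (Hpos := Re_mul_conj_pos _ _ (Hstep s s' t Hs Ht Hss)).
      split.
      + apply (continuous_plus (V := R_NormedModule)); [exact Hcont|].
        assert (C1 := jointly_continuous_snd F s t HF). assert (C2 := jointly_continuous_snd F s' t HF).
        assert (R1 := continuous_Re _ _ C1). assert (I1 := continuous_Im _ _ C1).
        assert (R2 := continuous_Re _ _ C2). assert (I2 := continuous_Im _ _ C2).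
        assert (Hcont1 : continuous (fun t => Re (F s' t * Cconj (F s t))) t).
        { apply continuous_ext with (fun t => Re (F s' t) * Re (F s t) + Im (F s' t) * Im (F s t)).
          - intros x. rewrite re_mult, re_conj, im_conj. apply eq_sym; match goal with |- @eq _ ?x ?y => change (@eq R x y) end; ring.
          - apply (continuous_plus (V := R_NormedModule));
              apply (continuous_mult (K := R_AbsRing)); assumption. }
        assert (Hcont2 : continuous (fun t => Im (F s' t * Cconj (F s t))) t).
        { apply continuous_ext with (fun t => Im (F s' t) * Re (F s t) - Re (F s' t) * Im (F s t)).
          - intros x. rewrite im_mult, re_conj, im_conj. apply eq_sym; match goal with |- @eq _ ?x ?y => change (@eq R x y) end; ring.
          - apply (continuous_minus (V := R_NormedModule));
              apply (continuous_mult (K := R_AbsRing)); assumption. }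
        apply (continuous_comp (fun t => Im (F s' t * Cconj (F s t)) / Re (F s' t * Cconj (F s t))) atan).
        * apply (continuous_mult (K := R_AbsRing)); [exact Hcont2|].
          apply (continuous_comp (fun t => Re (F s' t * Cconj (F s t))) Rinv); [exact Hcont1|].
          apply continuity_pt_filterlim. apply continuity_pt_inv.
          -- apply derivable_continuous_pt. apply derivable_pt_id.
          -- lra.
        * apply continuity_pt_filterlim. apply derivable_continuous_pt. apply derivable_pt_atan.
      + rewrite cis_plus.
        set (w := (F s' t * Cconj (F s t))%C) in *.
        assert (Hw := cis_atan w Hpos).
        assert (Hm : Cmod w = Cmod (F s' t) * Cmod (F s t)) by (unfold w; rewrite Cmod_mult, Cmod_conj; auto).
        assert (Hb : RtoC (Cmod (F s t)) <> 0%C).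
        { apply Cmod_gt_0. rewrite Cmod_R. apply Rabs_pos_lt. apply Rgt_not_eq. apply Cmod_gt_0. auto. }
        set (al := cis (atan (Im w / Re w))) in *.
        (* The identity is proved after multiplication by $|F(s,t)|^2=F(s,t)\overline{F(s,t)}$,
           which is nonzero; this avoids quotients of values of [F]. *)
        assert (K : (F s' t * (Cmod (F s t) * Cmod (F s t)))%C
          = (Cmod (F s' t) * (cis (theta t) * al) * (Cmod (F s t) * Cmod (F s t)))%C).
        { transitivity (w * F s t)%C.
          - replace (Cmod (F s t) * Cmod (F s t))%C with (F s t * Cconj (F s t))%C; [unfold w; ring|].
            rewrite <- Cmod2_conj, <- RtoC_mult. f_equal. simpl. ring.
          - transitivity ((Cmod w * al) * (Cmod (F s t) * cis (theta t)))%C.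
            + rewrite <- Harg, <- Hw. reflexivity.
            + rewrite Hm, RtoC_mult. ring. }
        apply Cmult_reg_r in K; [exact K|]. apply Cmult_neq_0; auto.
    - intros t t' Ht Ht' Hs'. rewrite (H2 t t') by auto. now rewrite !Hs'. }
  (* Steps of length [d / 2], capped at 1, stay below the admissible [d] and reach 1 after finitely
     many of them. *)
  assert (Hn : forall n : nat, P (Rmin 1 (INR n * (d / 2)))).
  { induction n as [|n IH].
    - simpl. rewrite Rmult_0_l, Rmin_right by lra. exact H0.
    - apply HP with (Rmin 1 (INR n * (d / 2))); auto.
      + split; [|apply Rmin_l]. apply Rmin_glb; [lra|]. assert (H := pos_INR n). nra.
      + rewrite S_INR. unfold Rmin. destruct (Rle_dec 1 (INR n * (d / 2)));
          destruct (Rle_dec 1 ((INR n + 1) * (d / 2))); apply Rabs_def1; lra. }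
  destruct (INR_unbounded (2 / d)) as [n Hbig].
  specialize (Hn n). rewrite Rmin_left in Hn; [exact Hn|].
  apply Rlt_le. apply (Rmult_lt_compat_r (d / 2)) in Hbig; [|lra].
  replace (2 / d * (d / 2)) with 1 in Hbig by (field; lra). lra.
Qed.

Lemma IVT_between (f : R -> R) (a b y : R) :
  a < b -> (forall t, a <= t <= b -> continuous f t) ->
  f a < y < f b \/ f b < y < f a -> exists c, a < c < b /\ f c = y.
Proof.
  intros Hab Hf Hy.
  assert (H : exists c, a <= c <= b /\ f c = y).
  { destruct Hy as [Hy|Hy].
    - destruct (Ranalysis5.IVT_interv (fun t => f t - y) a b) as [c [Hc1 Hc2]]; try lra.
      + intros t Ht. apply continuity_pt_minus.
        * apply continuity_pt_filterlim. apply Hf; auto.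
        * apply continuity_pt_const. intros x x'; reflexivity.
      + exists c. split; auto. lra.
    - destruct (Ranalysis5.IVT_interv (fun t => y - f t) a b) as [c [Hc1 Hc2]]; try lra.
      + intros t Ht. apply continuity_pt_minus.
        * apply continuity_pt_const. intros x x'; reflexivity.
        * apply continuity_pt_filterlim. apply Hf; auto.
      + exists c. split; auto. lra. }
  destruct H as [c [Hc1 Hc2]]. exists c. split; auto.
  assert (c <> a) by (intros ->; lra). assert (c <> b) by (intros ->; lra). lra.
Qed.

(** If two multiples of $2\pi$ were attained, the intermediate value theorem would produce the value
    $f(a)+\pi$ (or $-f(a)+\pi$ for the negated function), and twice a difference of integers would
    be 1. *)
Lemma discrete_continuous_constant (f : R -> R) (a b : R) :
  a <= b -> (forall t, a <= t <= b -> continuous f t) ->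
  (forall t, a <= t <= b -> exists k : Z, f t = 2 * PI * IZR k) -> f a = f b.
Proof.
  intros Hab Hf Hk. assert (HPI := PI_RGT_0).
  assert (Hlt : forall g, (forall t, a <= t <= b -> continuous g t) ->
    (forall t, a <= t <= b -> exists k : Z, g t = 2 * PI * IZR k) -> g a < g b -> False).
  { intros g Hg Hgk Hgab.
    destruct (Hgk a) as [ka Hka]; [lra|]. destruct (Hgk b) as [kb Hkb]; [lra|].
    assert (Hkk : IZR (ka + 1) <= IZR kb).
    { apply IZR_le. assert (ka < kb)%Z; [|lia]. apply lt_IZR. nra. }
    rewrite plus_IZR in Hkk.
    assert (Hab' : a < b) by (destruct (Req_dec a b); [subst; lra|lra]).
    destruct (IVT_between g a b (g a + PI)) as [c [Hc1 Hc2]]; auto.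
    - left. nra.
    - destruct (Hgk c) as [kc Hkc]; [lra|].
      assert (H1 : 2 * (IZR kc - IZR ka) = 1).
      { apply Rmult_eq_reg_l with PI; [|lra]. lra. }
      rewrite <- minus_IZR, <- mult_IZR in H1. apply eq_IZR in H1. lia. }
  destruct (Rtotal_order (f a) (f b)) as [H|[H|H]]; auto; exfalso.
  - apply (Hlt f); auto.
  - apply (Hlt (fun t => - f t)); [| |lra].
    + intros t Ht. apply (continuous_opp (V := R_NormedModule)). auto.
    + intros t Ht. destruct (Hk t Ht) as [k Hk']. exists (- k)%Z. rewrite opp_IZR. lra.
Qed.

(** * Fourier series *)

Definition Cint (f : R -> C) (a b : R) : C := RInt (V := C_R_CompleteNormedModule) f a b.

Lemma is_RInt_Cint (f : R -> C) (a b : R) :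
  (forall t, continuous f t) -> @is_RInt C_R_NormedModule f a b (Cint f a b).
Proof.
  intros Hf. apply (@RInt_correct C_R_CompleteNormedModule).
  apply (@ex_RInt_continuous C_R_CompleteNormedModule). intros t _. apply Hf.
Qed.

Lemma Cint_unique (f : R -> C) (a b : R) (l : C) :
  @is_RInt C_R_NormedModule f a b l -> Cint f a b = l.
Proof. apply (@is_RInt_unique C_R_CompleteNormedModule). Qed.

Lemma Cint_ext (f g : R -> C) (a b : R) : (forall t, f t = g t) -> Cint f a b = Cint g a b.
Proof. intros H. apply (@RInt_ext C_R_CompleteNormedModule). auto. Qed.

Lemma Cint_plus (f g : R -> C) (a b : R) :
  (forall t, continuous f t) -> (forall t, continuous g t) ->
  Cint (fun t => f t + g t)%C a b = (Cint f a b + Cint g a b)%C.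
Proof.
  intros Hf Hg. apply Cint_unique.
  apply (@is_RInt_plus C_R_NormedModule); apply is_RInt_Cint; auto.
Qed.

(** The integral is taken in [C] as a real normed module, where only real scalars factor out; a
    complex scalar goes through real and imaginary parts. *)
Lemma Cint_scal (c : C) (f : R -> C) (a b : R) :
  (forall t, continuous f t) -> Cint (fun t => c * f t)%C a b = (c * Cint f a b)%C.
Proof.
  intros Hf. apply Cint_unique.
  assert (H := is_RInt_Cint f a b Hf).
  assert (H1 := @is_RInt_fct_extend_fst R_NormedModule R_NormedModule f a b _ H).
  assert (H2 := @is_RInt_fct_extend_snd R_NormedModule R_NormedModule f a b _ H).
  apply (@is_RInt_fct_extend_pair R_NormedModule R_NormedModule).
  - apply (@is_RInt_minus R_NormedModule).
    + apply (@is_RInt_scal R_NormedModule _ _ _ (Re c)); exact H1.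
    + apply (@is_RInt_scal R_NormedModule _ _ _ (Im c)); exact H2.
  - apply (@is_RInt_plus R_NormedModule).
    + apply (@is_RInt_scal R_NormedModule _ _ _ (Re c)); exact H2.
    + apply (@is_RInt_scal R_NormedModule _ _ _ (Im c)); exact H1.
Qed.

Lemma Cint_const (c : C) (a b : R) : Cint (fun _ => c) a b = ((b - a) * c)%C.
Proof.
  apply Cint_unique. rewrite <- RtoC_minus, <- scal_R_Cmult.
  apply (@is_RInt_const C_R_NormedModule).
Qed.

Lemma Cint_bound (f : R -> C) (a b M : R) :
  a <= b -> (forall t, continuous f t) -> (forall t, a <= t <= b -> Cmod (f t) <= M) ->
  Cmod (Cint f a b) <= (b - a) * M.
Proof.
  intros Hab Hf HM. rewrite Cmod_norm.
  apply (@norm_RInt_le_const C_R_NormedModule) with f; auto.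
  - intros t Ht. rewrite <- Cmod_norm. auto.
  - apply is_RInt_Cint; auto.
Qed.

Lemma Cint_shift (f : R -> C) (h T : R) :
  (forall t, continuous f t) -> (forall t, f (t + T) = f t) ->
  Cint (fun t => f (t + h)) 0 T = Cint f 0 T.
Proof.
  intros Hf HT.
  assert (Hs : forall u a b, Cint (fun t => f (t + u)) a b = Cint f (a + u) (b + u)).
  { intros u a b. apply Cint_unique.
    assert (H := is_RInt_Cint f (1 * a + u) (1 * b + u) Hf).
    apply (@is_RInt_comp_lin C_R_NormedModule) in H. rewrite !Rmult_1_l in H.
    apply (@is_RInt_ext C_R_NormedModule) with (2 := H).
    intros t _. rewrite Rmult_1_l. apply (@scal_one R_Ring). }
  assert (Hch : forall a b c, (Cint f a b + Cint f b c)%C = Cint f a c).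
  { intros a b c.
    apply (@RInt_Chasles C_R_CompleteNormedModule);
    apply (@ex_RInt_continuous C_R_CompleteNormedModule); intros t _; apply Hf. }
  assert (H1 : Cint f (0 + T) (h + T) = Cint f 0 h).
  { rewrite <- Hs. apply Cint_ext. auto. }
  rewrite Hs, !Rplus_0_l. rewrite Rplus_0_l in H1.
  rewrite <- (Hch h T), <- (Hch 0 h T), (Rplus_comm T h), H1. ring.
Qed.

Definition is_Rderive (f : R -> C) (t : R) (l : C) : Prop :=
  @is_derive R_AbsRing C_R_NormedModule f t l.

Lemma is_Rderive_eps (f : R -> C) (t : R) (l : C) :
  is_Rderive f t l <->
  forall e, 0 < e -> exists d, 0 < d /\
    forall s, Rabs (s - t) < d -> Cmod (f s - f t - l * (s - t)) <= e * Rabs (s - t).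
Proof.
  assert (Hn : forall s, @norm _ C_R_NormedModule (@minus C_R_NormedModule (@minus C_R_NormedModule (f s) (f t))
     (@scal _ C_R_NormedModule (@minus R_AbelianGroup s t) l)) = Cmod (f s - f t - l * (s - t))).
  { intros s. rewrite scal_R_Cmult, <- Cmod_norm. f_equal.
    change ((f s - f t - RtoC (s - t) * l)%C = (f s - f t - l * (s - t))%C).
    rewrite RtoC_minus. ring. }
  unfold is_Rderive. rewrite (@is_derive_eps R_AbsRing C_R_NormedModule).
  split; intros H e He; destruct (H e He) as [d [Hd Hd']]; exists d; (split; [exact Hd|]);
    intros s Hs; specialize (Hd' s Hs).
  - rewrite <- Hn. exact Hd'.
  - rewrite <- Hn in Hd'. exact Hd'.
Qed.

Lemma is_Rderive_continuous (f : R -> C) (t : R) (l : C) : is_Rderive f t l -> continuous f t.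
Proof.
  intros H. apply (@ex_derive_continuous R_AbsRing C_R_NormedModule). exists l. exact H.
Qed.

Lemma is_Rderive_parts (f : R -> C) (t : R) (l : C) :
  is_Rderive f t l <->
  is_derive (fun s => Re (f s)) t (Re l) /\ is_derive (fun s => Im (f s)) t (Im l).
Proof.
  assert (Heps : forall (g : R -> R) m, is_derive g t m <->
    forall e, 0 < e -> exists d, 0 < d /\
    forall s, Rabs (s - t) < d -> Rabs (g s - g t - m * (s - t)) <= e * Rabs (s - t)).
  { intros g m. rewrite (@is_derive_eps R_AbsRing R_NormedModule).
    split; intros H e He; destruct (H e He) as [d [Hd Hd']]; exists d; (split; [exact Hd|]);
      intros s Hs; specialize (Hd' s Hs).
    - rewrite (Rmult_comm m). exact Hd'.
    - rewrite (Rmult_comm m) in Hd'. exact Hd'. }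
  rewrite is_Rderive_eps, !Heps.
  assert (HRe : forall s, Re (f s - f t - l * (s - t)) = Re (f s) - Re (f t) - Re l * (s - t)).
  { intros s. unfold Cminus. rewrite !re_plus, !re_opp, re_mult, !re_plus, !re_opp, !im_plus, !im_opp, !re_RtoC, !im_RtoC. ring. }
  assert (HIm : forall s, Im (f s - f t - l * (s - t)) = Im (f s) - Im (f t) - Im l * (s - t)).
  { intros s. unfold Cminus. rewrite !im_plus, !im_opp, im_mult, !re_plus, !re_opp, !im_plus, !im_opp, !re_RtoC, !im_RtoC. ring. }
  split.
  - intros H. split; intros e He; destruct (H e He) as [d [Hd H']]; exists d; split; auto; intros s Hs.
    + rewrite <- HRe. eapply Rle_trans; [apply abs_Re_le|auto].
    + rewrite <- HIm. eapply Rle_trans; [apply abs_Im_le|auto].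
  - intros [H1 H2] e He. destruct (H1 (e / 2)) as [d1 [Hd1 K1]]; [lra|].
    destruct (H2 (e / 2)) as [d2 [Hd2 K2]]; [lra|].
    exists (Rmin d1 d2). split; [apply Rmin_glb_lt; auto|]. intros s Hs.
    eapply Rle_trans; [apply Cmod_le_abs_sum|]. rewrite HRe, HIm.
    assert (L1 := K1 s (Rlt_le_trans _ _ _ Hs (Rmin_l _ _))).
    assert (L2 := K2 s (Rlt_le_trans _ _ _ Hs (Rmin_r _ _))). lra.
Qed.

Lemma is_Rderive_mult (f g : R -> C) (t : R) (a b : C) :
  is_Rderive f t a -> is_Rderive g t b ->
  is_Rderive (fun s => f s * g s)%C t (a * g t + f t * b)%C.
Proof.
  rewrite !is_Rderive_parts. intros [F1 F2] [G1 G2].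
  assert (Hm : forall (u v : R -> R) x y, is_derive u t x -> is_derive v t y ->
    is_derive (fun s => u s * v s) t (x * v t + u t * y)).
  { intros u v x y Hu Hv. apply (@is_derive_mult R_AbsRing); auto. intros; apply Rmult_comm. }
  split.
  - apply is_derive_ext with (fun s => Re (f s) * Re (g s) - Im (f s) * Im (g s)).
    + intros s. symmetry. apply re_mult.
    + rewrite re_plus, !re_mult.
      replace (Re a * Re (g t) - Im a * Im (g t) + (Re (f t) * Re b - Im (f t) * Im b))
       with ((Re a * Re (g t) + Re (f t) * Re b) - (Im a * Im (g t) + Im (f t) * Im b)) by ring.
      apply (@is_derive_minus R_AbsRing R_NormedModule); auto.
  - apply is_derive_ext with (fun s => Re (f s) * Im (g s) + Im (f s) * Re (g s)).
    + intros s. symmetry. apply im_mult.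
    + rewrite im_plus, !im_mult.
      replace (Re a * Im (g t) + Im a * Re (g t) + (Re (f t) * Im b + Im (f t) * Re b))
       with ((Re a * Im (g t) + Re (f t) * Im b) + (Im a * Re (g t) + Im (f t) * Re b)) by ring.
      apply (@is_derive_plus R_AbsRing R_NormedModule); auto.
Qed.

Lemma is_Rderive_cis (n t : R) : is_Rderive (fun s => cis (n * s)) t (Ci * n * cis (n * t))%C.
Proof.
  apply is_Rderive_parts. unfold cis; simpl. split; auto_derive; auto; ring.
Qed.

Lemma is_Rderive_cis_1 (t : R) : is_Rderive cis t (Ci * cis t)%C.
Proof.
  apply is_Rderive_parts. unfold cis; simpl. split; auto_derive; auto; ring.
Qed.

Lemma continuous_C_parts (f : R -> C) (t : R) :
  continuous (fun s => Re (f s)) t -> continuous (fun s => Im (f s)) t -> continuous f t.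
Proof.
  rewrite continuous_C_eps, !continuous_R_eps. intros H1 H2 e He.
  destruct (H1 (e / 2)) as [d1 [Hd1 K1]]; [lra|].
  destruct (H2 (e / 2)) as [d2 [Hd2 K2]]; [lra|].
  exists (Rmin d1 d2). split; [apply Rmin_glb_lt; auto|]. intros s Hs.
  assert (L1 := K1 s (Rlt_le_trans _ _ _ Hs (Rmin_l _ _))).
  assert (L2 := K2 s (Rlt_le_trans _ _ _ Hs (Rmin_r _ _))).
  eapply Rle_lt_trans; [apply Cmod_le_abs_sum|].
  change (Rabs (Re (f s) - Re (f t)) + Rabs (Im (f s) - Im (f t)) < e). lra.
Qed.

Lemma continuous_Cmult (f g : R -> C) (t : R) :
  continuous f t -> continuous g t -> continuous (fun s => f s * g s)%C t.
Proof.
  intros Hf Hg.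
  assert (F1 := continuous_Re _ _ Hf). assert (F2 := continuous_Im _ _ Hf).
  assert (G1 := continuous_Re _ _ Hg). assert (G2 := continuous_Im _ _ Hg).
  apply continuous_C_parts.
  - apply continuous_ext with (fun s => Re (f s) * Re (g s) - Im (f s) * Im (g s)).
    + intros s. symmetry. apply re_mult.
    + apply (continuous_minus (V := R_NormedModule)); apply (continuous_mult (K := R_AbsRing)); assumption.
  - apply continuous_ext with (fun s => Re (f s) * Im (g s) + Im (f s) * Re (g s)).
    + intros s. symmetry. apply im_mult.
    + apply (continuous_plus (V := R_NormedModule)); apply (continuous_mult (K := R_AbsRing)); assumption.
Qed.

Lemma continuous_Cminus (f g : R -> C) (t : R) :
  continuous f t -> continuous g t -> continuous (fun s => f s - g s)%C t.
Proof. apply (continuous_minus (V := C_R_NormedModule)). Qed.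

Lemma continuous_Cplus (f g : R -> C) (t : R) :
  continuous f t -> continuous g t -> continuous (fun s => f s + g s)%C t.
Proof. apply (continuous_plus (V := C_R_NormedModule)). Qed.

Definition periodic (U : R -> C) : Prop := forall t, U (t + 2 * PI) = U t.

Definition fourier (U : R -> C) (n : Z) : C :=
  (/ (2 * PI) * Cint (fun t => U t * cis (- IZR n * t)) 0 (2 * PI))%C.

Lemma continuous_cis_scal (a t : R) : continuous (fun s => cis (a * s)) t.
Proof. eapply is_Rderive_continuous. apply is_Rderive_cis. Qed.

Lemma continuous_fourier_integrand (U : R -> C) (n : Z) :
  (forall t, continuous U t) -> forall t, continuous (fun t => U t * cis (- IZR n * t))%C t.
Proof. intros HU t. apply continuous_Cmult; [apply HU|apply continuous_cis_scal]. Qed.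

Lemma RtoC_2PI_nonzero : (2 * PI)%C <> 0%C.
Proof.
  assert (H := PI_RGT_0). rewrite <- RtoC_mult. intros H0. apply RtoC_inj in H0. lra.
Qed.

Lemma fourier_ext (U V : R -> C) (n : Z) : (forall t, U t = V t) -> fourier U n = fourier V n.
Proof. intros H. unfold fourier. f_equal. apply Cint_ext. intros t. now rewrite H. Qed.

Lemma fourier_plus (U V : R -> C) (n : Z) :
  (forall t, continuous U t) -> (forall t, continuous V t) ->
  fourier (fun t => U t + V t)%C n = (fourier U n + fourier V n)%C.
Proof.
  intros HU HV. unfold fourier. rewrite <- Cmult_plus_distr_l. f_equal.
  rewrite <- Cint_plus by (apply continuous_fourier_integrand; auto).
  apply Cint_ext. intros t. ring.
Qed.

Lemma fourier_scal (c : C) (U : R -> C) (n : Z) :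
  (forall t, continuous U t) -> fourier (fun t => c * U t)%C n = (c * fourier U n)%C.
Proof.
  intros HU. unfold fourier. rewrite !Cmult_assoc, (Cmult_comm c), <- !Cmult_assoc. f_equal.
  rewrite <- Cint_scal by (apply continuous_fourier_integrand; auto).
  apply Cint_ext. intros t. ring.
Qed.

Lemma fourier_mul_cis (U : R -> C) (m n : Z) :
  fourier (fun t => cis (IZR m * t) * U t)%C n = fourier U (n - m).
Proof.
  unfold fourier. f_equal. apply Cint_ext. intros t.
  rewrite minus_IZR. replace (- (IZR n - IZR m) * t) with (IZR m * t + - IZR n * t) by ring.
  rewrite cis_plus. ring.
Qed.

Lemma fourier_bound (U : R -> C) (n : Z) (M : R) :
  (forall t, continuous U t) -> (forall t, 0 <= t <= 2 * PI -> Cmod (U t) <= M) ->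
  Cmod (fourier U n) <= M.
Proof.
  intros HU HM. assert (HPI := PI_RGT_0). unfold fourier.
  rewrite Cmod_mult, Cmod_inv by apply RtoC_2PI_nonzero.
  rewrite <- RtoC_mult, Cmod_R, Rabs_pos_eq by lra.
  apply Rmult_le_reg_l with (2 * PI); [lra|].
  rewrite <- Rmult_assoc, Rinv_r, Rmult_1_l by lra.
  replace (2 * PI * M) with ((2 * PI - 0) * M) by ring.
  apply Cint_bound; [lra|apply continuous_fourier_integrand; auto|].
  intros t Ht. rewrite Cmod_mult, Cmod_cis, Rmult_1_r. auto.
Qed.

(** Integration by parts: $U(t)e^{-int}$ takes equal values at both ends of a period, so the
    integral of its derivative vanishes. *)
Lemma fourier_derive (U U' : R -> C) (n : Z) :
  periodic U -> (forall t, is_Rderive U t (U' t)) -> (forall t, continuous U' t) ->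
  fourier U' n = (Ci * IZR n * fourier U n)%C.
Proof.
  intros HP HU HU'.
  assert (HUc : forall t, continuous U t) by (intros t; eapply is_Rderive_continuous; apply HU).
  assert (H : Cint (fun t => U' t * cis (- IZR n * t) + (- (Ci * IZR n)) * (U t * cis (- IZR n * t)))%C
     0 (2 * PI) = 0%C).
  { assert (HD : forall t, is_Rderive (fun t => U t * cis (- IZR n * t))%C t
      (U' t * cis (- IZR n * t) + (- (Ci * IZR n)) * (U t * cis (- IZR n * t)))%C).
    { intros t. assert (H := is_Rderive_mult _ _ _ _ _ (HU t) (is_Rderive_cis (- IZR n) t)).
      rewrite RtoC_opp in H.
      replace (U' t * cis (- IZR n * t) + (- (Ci * IZR n)) * (U t * cis (- IZR n * t)))%C
        with (U' t * cis (- IZR n * t) + U t * (Ci * - IZR n * cis (- IZR n * t)))%C by ring.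
      exact H. }
    assert (HF := @is_RInt_derive C_R_CompleteNormedModule _ _ 0 (2 * PI) (fun t _ => HD t)).
    apply Cint_unique.
    assert (H0 : (U (2 * PI)%R * cis (- IZR n * (2 * PI)) - U 0%R * cis (- IZR n * 0))%C = 0%C).
    { rewrite <- (Rplus_0_l (2 * PI)), HP, Rplus_0_l.
      replace (- IZR n * (2 * PI)) with (2 * PI * IZR (- n)) by (rewrite opp_IZR; ring).
      rewrite cis_period_Z, Rmult_0_r, cis_0. ring. }
    rewrite <- H0. apply HF.
    intros t _. apply continuous_Cplus.
    - apply continuous_fourier_integrand; auto.
    - apply (continuous_Cmult (fun _ => (- (Ci * IZR n))%C)); [apply continuous_const|].
      apply continuous_fourier_integrand; auto. }
  rewrite Cint_plus in H.
  - rewrite Cint_scal in H by (apply continuous_fourier_integrand; auto).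
    unfold fourier.
    set (A := Cint (fun t => U' t * cis (- IZR n * t))%C 0 (2 * PI)) in *.
    set (B := Cint (fun t => U t * cis (- IZR n * t))%C 0 (2 * PI)) in *.
    replace A with (Ci * IZR n * B)%C; [ring|].
    transitivity (A - (A + - (Ci * IZR n) * B))%C; [ring|]. rewrite H. ring.
  - apply continuous_fourier_integrand; auto.
  - intros t. apply (continuous_Cmult (fun _ => (- (Ci * IZR n))%C)); [apply continuous_const|].
    apply continuous_fourier_integrand; auto.
Qed.

Lemma periodic_Z (U : R -> C) (k : Z) (t : R) : periodic U -> U (t + 2 * PI * IZR k) = U t.
Proof.
  intros HU.
  assert (Hn : forall (n : nat) t, U (t + 2 * PI * INR n) = U t).
  { induction n as [|n IH]; intros s.
    - simpl. f_equal. ring.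
    - rewrite S_INR. replace (s + 2 * PI * (INR n + 1)) with (s + 2 * PI * INR n + 2 * PI) by ring.
      rewrite HU. apply IH. }
  destruct (Z.le_gt_cases 0 k) as [Hk|Hk].
  - rewrite <- (Z2Nat.id k Hk), <- INR_IZR_INZ. apply Hn.
  - rewrite <- (Hn (Z.to_nat (- k)) (t + 2 * PI * IZR k)).
    rewrite INR_IZR_INZ, Z2Nat.id, opp_IZR by lia. f_equal. ring.
Qed.

Lemma periodic_cis_eq (U : R -> C) (s t : R) : periodic U -> cis s = cis t -> U s = U t.
Proof.
  intros HU H. apply cis_eq_inv in H. destruct H as [k Hk].
  replace s with (t + 2 * PI * IZR k) by lra. apply periodic_Z; auto.
Qed.

Lemma continuous_bounded (U : R -> C) (a b : R) :
  a <= b -> (forall t, continuous U t) -> exists M, forall t, a <= t <= b -> Cmod (U t) <= M.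
Proof.
  intros Hab HU.
  destruct (continuity_ab_maj (fun t => Cmod (U t)) a b Hab) as [x [Hx _]].
  - intros t _. apply continuity_pt_filterlim. apply (continuous_R_eps (fun t => Cmod (U t))).
    intros e He. destruct (proj1 (continuous_C_eps U t) (HU t) e He) as [d [Hd H]].
    exists d. split; auto. intros s Hs. specialize (H s Hs).
    assert (H1 := Cmod_triangle_rev (U s) (U t)). assert (H2 := Cmod_triangle_rev (U t) (U s)).
    rewrite Cmod_sub_comm in H2. apply Rabs_def1; lra.
  - exists (Cmod (U x)). exact Hx.
Qed.

Lemma fourier_shift (V : R -> C) (h : R) (n : Z) :
  (forall t, continuous V t) -> periodic V ->
  fourier (fun t => V (t + h)) n = (cis (IZR n * h) * fourier V n)%C.
Proof.
  intros HV HP. unfold fourier.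
  rewrite <- (Cint_shift (fun t => V t * cis (- IZR n * t))%C h (2 * PI)).
  - rewrite !Cmult_assoc, (Cmult_comm (cis _)), <- !Cmult_assoc. f_equal.
    rewrite <- Cint_scal.
    + apply Cint_ext. intros t.
      replace (- IZR n * (t + h)) with (- IZR n * t + - IZR n * h) by ring.
      rewrite cis_plus.
      replace (- IZR n * h) with (- (IZR n * h)) by ring.
      transitivity ((cis (IZR n * h) * cis (- (IZR n * h))) * (V (t + h)%R * cis (- IZR n * t)))%C; [|ring].
      rewrite <- cis_plus, Rplus_opp_r, cis_0. ring.
    + intros t. apply (continuous_comp (fun t => t + h) (fun t => V t * cis (- IZR n * t))%C).
      * apply (continuous_plus (V := R_NormedModule)); [apply continuous_id|apply continuous_const].
      * apply continuous_fourier_integrand; auto.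
  - apply continuous_fourier_integrand; auto.
  - intros t. rewrite HP. f_equal.
    rewrite Rmult_plus_distr_l, cis_plus.
    replace (- IZR n * (2 * PI)) with (2 * PI * IZR (- n)) by (rewrite opp_IZR; ring).
    rewrite cis_period_Z. ring.
Qed.

Lemma continuous_uniform (V : R -> C) (a b e : R) :
  (forall t, continuous V t) -> 0 < e ->
  exists d, 0 < d /\ forall t h, a <= t <= b -> Rabs h < d -> Cmod (V (t + h) - V t) < e.
Proof.
  intros HV He.
  destruct (compact_uniform (fun z => a <= Re z <= b /\ 0 <= Im z <= 0)
    (fun z d => forall h, Rabs h < d -> Cmod (V (Re z + h) - V (Re z)) < e)) as [d [Hd H]].
  - apply compact_rectangle.
  - intros z d d' H [_ Hd'] h Hh. apply H. lra.
  - intros u Hu. destruct (proj1 (continuous_C_eps V (Re u)) (HV _) (e / 2)) as [d [Hd H]]; [lra|].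
    exists (d / 2). split; [lra|]. intros z Hz Hzu h Hh.
    assert (K1 : Rabs (Re z - Re u) < d / 2) by (eapply Rle_lt_trans; [apply (abs_Re_le (z - u))|auto]).
    assert (L1 : Cmod (V (Re z) - V (Re u)) < e / 2) by (apply H; lra).
    assert (L2 : Cmod (V (Re z + h) - V (Re u)) < e / 2).
    { apply H. replace (Re z + h - Re u) with ((Re z - Re u) + h) by ring.
      eapply Rle_lt_trans; [apply Rabs_triang|]. lra. }
    replace (V (Re z + h)%R - V (Re z))%C
      with ((V (Re z + h)%R - V (Re u)) + (V (Re u) - V (Re z)))%C by ring.
    eapply Rle_lt_trans; [apply Cmod_triangle|]. rewrite (Cmod_sub_comm (V (Re u))). lra.
  - exists d. split; auto. intros t h Ht Hh. apply (H (t, 0)); [simpl; lra|exact Hh].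
Qed.

(** A shift by $h=\pi/n$ multiplies the $n$-th coefficient by $e^{i\pi}=-1$. Hence $-2\hat V(n)$ is
    the coefficient of $V(t+h)-V(t)$, which is uniformly small when $|n|$ is large. *)
Lemma riemann_lebesgue (V : R -> C) (e : R) :
  (forall t, continuous V t) -> periodic V -> 0 < e ->
  exists N : nat, forall n : Z, INR N <= Rabs (IZR n) -> Cmod (fourier V n) < e.
Proof.
  intros HV HP He. assert (HPI := PI_RGT_0).
  destruct (continuous_uniform V 0 (2 * PI) e HV He) as [d [Hd H]].
  destruct (INR_unbounded (PI / d)) as [N HN].
  exists (S N). intros n Hn. rewrite S_INR in Hn.
  assert (HN0 := pos_INR N).
  assert (Hn0 : IZR n <> 0) by (intros H0; rewrite H0, Rabs_R0 in Hn; lra).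
  set (h := PI / IZR n).
  assert (Hh : Rabs h < d).
  { unfold h. rewrite Rabs_div, (Rabs_pos_eq PI) by lra.
    apply Rmult_lt_reg_r with (Rabs (IZR n)); [lra|].
    unfold Rdiv. rewrite Rmult_assoc, Rinv_l, Rmult_1_r by lra.
    apply (Rmult_lt_compat_r d) in HN; [|lra].
    unfold Rdiv in HN. rewrite Rmult_assoc, Rinv_l, Rmult_1_r in HN by lra. nra. }
  assert (Hc : forall t, continuous (fun t => V (t + h)) t).
  { intros t. apply (continuous_comp (fun t => t + h) V); [|apply HV].
    apply (continuous_plus (V := R_NormedModule)); [apply continuous_id|apply continuous_const]. }
  assert (Hc' : forall t, continuous (fun t => (-1) * V t)%C t).
  { intros t. apply (continuous_Cmult (fun _ => (-1)%C) V); [apply continuous_const|apply HV]. }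
  assert (K : fourier (fun t => V (t + h)%R + (-1) * V t)%C n = ((-2) * fourier V n)%C).
  { rewrite (fourier_plus (fun t => V (t + h)) (fun t => (-1) * V t)%C) by auto.
    rewrite fourier_scal, fourier_shift by auto.
    replace (IZR n * h) with PI by (unfold h; field; auto).
    replace (cis PI) with (RtoC (-1)); [|unfold cis; rewrite cos_PI, sin_PI; reflexivity].
    ring. }
  assert (B : Cmod ((-2) * fourier V n) <= e).
  { rewrite <- K. apply fourier_bound.
    - intros t. apply continuous_Cplus; auto.
    - intros t Ht. left. replace (V (t + h)%R + (-1) * V t)%C with (V (t + h)%R - V t)%C by ring. auto. }
  rewrite Cmod_mult, Cmod_R in B. rewrite Rabs_left in B by lra. lra.
Qed.

(* Chernoff's argument: with [V = (U - U t0) / (cis - cis t0)], which is continuous,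
   the Fourier series of [U] at [t0] telescopes to [U t0] plus two coefficients of [V]. *)
Lemma fourier_quotient (U U' : R -> C) (t0 : R) :
  periodic U -> (forall t, is_Rderive U t (U' t)) -> (forall t, continuous U' t) -> periodic U' ->
  exists V : R -> C, periodic V /\ (forall t, continuous V t) /\
    forall t, U t = (U t0 + (cis t - cis t0) * V t)%C.
Proof.
  intros HP HU HU' HP'.
  assert (HPc : periodic cis) by (intros t; rewrite cis_plus, cis_2PI; ring).
  (* At parameters congruent to [t0] the quotient is given its limit, the ratio of the derivatives
     of [U] and [cis]. *)
  exists (fun t => if Ceq_dec (cis t) (cis t0) then U' t * / (Ci * cis t)
                   else (U t - U t0) * / (cis t - cis t0))%C.
  split; [|split].
  - intros t. now rewrite HPc, HP, HP'.
  - intros t1. destruct (Ceq_dec (cis t1) (cis t0)) as [E|E].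
    + set (D := (Ci * cis t1)%C). set (l := U' t1).
      assert (HD0 : D <> 0%C) by (apply Cmult_neq_0; [apply Ci_nz|apply cis_nonzero]).
      assert (HD1 : Cmod D = 1) by (unfold D; rewrite Cmod_mult, Cmod_Ci, Cmod_cis; ring).
      assert (Hl := Cmod_ge_0 l).
      apply continuous_C_eps. intros e He.
      (* Here [e1 <= 1/2] keeps the chord $|e^{is}-e^{it_1}|$ at least $|s-t_1|/2$. The numerator is
         at most $(1+|l|)\,e_1|s-t_1|\le e|s-t_1|/4$, half of what the chord permits. *)
      destruct (small_factor (4 * (1 + Cmod l)) (Rmin 1 e)) as [e1 [[He1 _] He3']];
        [lra|apply Rmin_glb_lt; lra|].
      assert (He3 := Rle_trans _ _ _ He3' (Rmin_r _ _)).
      assert (He2 : e1 <= 1 / 2) by (assert (K := Rle_trans _ _ _ He3' (Rmin_l _ _)); nra).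
      destruct (proj1 (is_Rderive_eps _ _ _) (HU t1) e1 He1) as [d1 [Hd1 K1]].
      assert (Hcis : is_Rderive cis t1 D) by apply is_Rderive_cis_1.
      destruct (proj1 (is_Rderive_eps _ _ _) Hcis e1 He1) as [d2 [Hd2 K2]].
      destruct (proj1 (continuous_C_eps _ _) (HU' t1) e He) as [d3 [Hd3 K3]].
      exists (Rmin d1 (Rmin d2 d3)). split; [repeat apply Rmin_glb_lt; auto|].
      intros s Hs.
      assert (L1 := K1 s (Rlt_le_trans _ _ _ Hs (Rmin_l _ _))).
      assert (Hs' := Rlt_le_trans _ _ _ Hs (Rmin_r _ _)).
      assert (L2 := K2 s (Rlt_le_trans _ _ _ Hs' (Rmin_l _ _))).
      assert (L3 := K3 s (Rlt_le_trans _ _ _ Hs' (Rmin_r _ _))).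
      destruct (Ceq_dec (cis t1) (cis t0)) as [_|F]; [|contradiction].
      destruct (Ceq_dec (cis s) (cis t0)) as [E'|E'].
      * rewrite E', <- E. fold D l.
        replace (U' s * / D - l * / D)%C with ((U' s - l) * / D)%C by ring.
        rewrite Cmod_mult, Cmod_inv, HD1, Rinv_1, Rmult_1_r by auto. exact L3.
      * fold D l. rewrite (periodic_cis_eq U t0 t1) by auto. rewrite <- E in *.
        assert (Hsub : (cis s - cis t1)%C <> 0%C) by (apply Cminus_eq_contra; auto).
        set (h := Rabs (s - t1)) in *. assert (Hh0 : 0 <= h) by apply Rabs_pos.
        assert (Hden : h / 2 <= Cmod (cis s - cis t1)).
        { assert (Hr := Cmod_triangle_rev (D * (s - t1)) (D * (s - t1) - (cis s - cis t1))).
          replace (D * (s - t1) - (D * (s - t1) - (cis s - cis t1)))%C with (cis s - cis t1)%C in Hr by ring.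
          rewrite (Cmod_sub_comm (D * (s - t1))) in Hr.
          rewrite Cmod_mult, HD1, <- RtoC_minus, Cmod_R in Hr.
          rewrite <- RtoC_minus in L2. fold h in Hr.
          assert (e1 * h <= 1 / 2 * h) by (apply Rmult_le_compat_r; auto). lra. }
        assert (Hpos : 0 < Cmod (cis s - cis t1)) by (apply Cmod_gt_0; auto).
        replace ((U s - U t1) * / (cis s - cis t1) - l * / D)%C
          with (((U s - U t1 - l * (s - t1)) * D - l * (cis s - cis t1 - D * (s - t1)))
                 * / (cis s - cis t1) * / D)%C by (field; auto).
        rewrite !Cmod_mult, (Cmod_inv D), HD1, Rinv_1, Rmult_1_r, Cmod_inv by auto.
        apply Rmult_lt_reg_r with (Cmod (cis s - cis t1)); [exact Hpos|].
        rewrite Rmult_assoc, Rinv_l, Rmult_1_r by lra.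
        eapply Rle_lt_trans; [apply Cmod_triangle|].
        rewrite Cmod_opp, !Cmod_mult, HD1, Rmult_1_r.
        apply Rle_lt_trans with (e1 * h + Cmod l * (e1 * h)).
        { apply Rplus_le_compat; auto. apply Rmult_le_compat_l; auto. }
        replace (e1 * h + Cmod l * (e1 * h)) with (e1 * (4 * (1 + Cmod l)) * (h / 4)) by field.
        apply Rle_lt_trans with (e * (h / 4)); [apply Rmult_le_compat_r; lra|].
        apply Rmult_lt_compat_l; lra.
    + apply continuous_C_eps. intros e He.
      assert (Hsub : (cis t1 - cis t0)%C <> 0%C) by (apply Cminus_eq_contra; auto).
      assert (Hc : continuous (fun t => (U t - U t0) * / (cis t - cis t0))%C t1).
      { assert (Hpl : forall (W : R -> C) c, continuous W t1 -> continuous (fun t => W t - c)%C t1).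
        { intros W c HW. apply (continuous_Cminus W (fun _ => c)); auto.
          apply continuous_const. }
        apply (continuous_Cmult (fun t => U t - U t0)%C).
        - apply Hpl. eapply is_Rderive_continuous. apply HU.
        - assert (H := Hpl _ (cis t0) (continuous_cis t1)).
          apply continuous_C_eps. intros e' He'.
          destruct (is_Cderive_continuous _ _ _ (is_Cderive_inv _ Hsub) e' He') as [d [Hd K]].
          destruct (proj1 (continuous_C_eps _ _) H d Hd) as [d' [Hd' K']].
          exists d'. split; auto. }
      destruct (proj1 (continuous_C_eps _ _) Hc e He) as [d [Hd K]].
      assert (Hm : 0 < Cmod (cis t1 - cis t0)) by (apply Cmod_gt_0; auto).
      (* Since [cis] has Lipschitz constant 2, the second bound excludes [cis s = cis t0], so the
         generic branch applies near [t1]. *)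
      exists (Rmin d (Cmod (cis t1 - cis t0) / 2)). split; [apply Rmin_glb_lt; lra|].
      intros s Hs.
      assert (L1 := K s (Rlt_le_trans _ _ _ Hs (Rmin_l _ _))).
      assert (L2 := Rlt_le_trans _ _ _ Hs (Rmin_r _ _)).
      destruct (Ceq_dec (cis t1) (cis t0)) as [F|_]; [contradiction|].
      destruct (Ceq_dec (cis s) (cis t0)) as [E'|_]; [|exact L1].
      exfalso. assert (L3 := cis_lipschitz s t1). rewrite E', Cmod_sub_comm in L3. lra.
  - intros t. destruct (Ceq_dec (cis t) (cis t0)) as [E|E].
    + rewrite (periodic_cis_eq U t t0) by auto. rewrite E. ring.
    + assert (Hsub : (cis t - cis t0)%C <> 0%C) by (apply Cminus_eq_contra; auto).
      field. exact Hsub.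
Qed.

(** For $n\neq0$ the coefficient satisfies $0=in\,\hat c(n)$, because the derivative of a constant
    is zero. *)
Lemma fourier_const (c : C) (n : Z) :
  fourier (fun _ => c) n = if Z.eq_dec n 0 then c else 0%C.
Proof.
  assert (Hc : forall c t, continuous (fun _ : R => c : C) t) by (intros; apply continuous_const).
  destruct (Z.eq_dec n 0) as [->|Hn].
  - unfold fourier. rewrite (Cint_ext _ (fun _ => c)).
    + rewrite Cint_const, RtoC_mult.
      replace (/ (2 * PI) * ((2 * PI - 0) * c))%C with ((2 * PI) * / (2 * PI) * c)%C by ring.
      rewrite Cinv_r by apply RtoC_2PI_nonzero. ring.
    + intros t. rewrite Ropp_0, Rmult_0_l, cis_0. ring.
  - assert (H : fourier (fun _ => 0%C) n = (Ci * IZR n * fourier (fun _ => c) n)%C).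
    { apply fourier_derive; auto.
      - intros t. reflexivity.
      - intros t. apply (@is_derive_const R_AbsRing C_R_NormedModule). }
    assert (H0 : fourier (fun _ => 0%C) n = 0%C).
    { rewrite (fourier_ext _ (fun _ => 0 * 0)%C) by (intros; ring).
      rewrite (fourier_scal 0%C (fun _ => 0%C)) by auto. ring. }
    rewrite H0 in H. symmetry in H.
    apply NNPP. intros K. revert H. apply Cmult_neq_0; auto.
    apply Cmult_neq_0; [apply Ci_nz|]. intros H. apply RtoC_inj in H. apply eq_IZR in H. auto.
Qed.

(** The frequencies $0,\dots,N$ and $-1,\dots,-(N+1)$ are summed separately because they become two
    distinct power series. After telescoping, [riemann_lebesgue] disposes of the two end terms. *)
Lemma fourier_inversion (U U' : R -> C) (t0 e : R) :
  periodic U -> (forall t, is_Rderive U t (U' t)) -> (forall t, continuous U' t) -> periodic U' ->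
  0 < e -> exists N0, forall N, (N0 <= N)%nat ->
    Cmod (sum_n (fun k => fourier U (Z.of_nat k) * cis (INR k * t0))%C N
        + sum_n (fun k => fourier U (- Z.of_nat (S k)) * cis (- INR (S k) * t0))%C N - U t0) < e.
Proof.
  intros HP HU HU' HP' He.
  destruct (fourier_quotient U U' t0 HP HU HU' HP') as [V [HVP [HV HUV]]].
  assert (HVc : forall c, forall t, continuous (fun t => c * V t)%C t).
  { intros c t. apply (continuous_Cmult (fun _ => c)); [apply continuous_const|apply HV]. }
  (* With the quotient [V], each term equals $W(n-1)-W(n)$, plus $U(t_0)$ when $n=0$. The lowest
     frequency is $-(N+1)$, so the lower end term is $W(-N-2)$. *)
  set (W := fun n : Z => (fourier V n * cis ((IZR n + 1) * t0))%C).
  assert (HW : forall n : Z, (fourier U n * cis (IZR n * t0))%C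
     = ((if Z.eq_dec n 0 then U t0 else 0%C) + W (n - 1)%Z - W n)%C).
  { intros n.
    assert (H1 : fourier U n = (fourier (fun _ => U t0) n + fourier V (n - 1) + (- cis t0) * fourier V n)%C).
    { rewrite <- (fourier_mul_cis V 1 n).
      assert (Hm : forall t, continuous (fun t => cis (1 * t) * V t)%C t).
      { intros t. apply continuous_Cmult; [apply continuous_cis_scal|apply HV]. }
      rewrite <- (fourier_plus (fun _ => U t0)), <- (fourier_scal (- cis t0)) by (auto; intros; apply continuous_const).
      rewrite <- fourier_plus.
      - apply fourier_ext. intros t. rewrite HUV at 1. rewrite Rmult_1_l. ring.
      - intros t. apply continuous_Cplus; [apply continuous_const|apply Hm].
      - apply HVc. }
    rewrite H1, fourier_const. unfold W. rewrite minus_IZR.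
    replace (IZR n - 1 + 1) with (IZR n) by ring.
    replace ((IZR n + 1) * t0) with (IZR n * t0 + t0) by ring. rewrite cis_plus.
    destruct (Z.eq_dec n 0) as [->|Hn]; [rewrite Rmult_0_l, cis_0; ring|ring]. }
  assert (Hsum : forall N, (sum_n (fun k => fourier U (Z.of_nat k) * cis (INR k * t0)) N
        + sum_n (fun k => fourier U (- Z.of_nat (S k)) * cis (- INR (S k) * t0)) N)%C
        = (U t0 + W (- Z.of_nat N - 2)%Z - W (Z.of_nat N))%C).
  { assert (Ha : forall k : nat, (fourier U (Z.of_nat k) * cis (INR k * t0))%C
       = ((if Z.eq_dec (Z.of_nat k) 0 then U t0 else 0%C) + W (Z.of_nat k - 1)%Z - W (Z.of_nat k))%C).
    { intros k. rewrite INR_IZR_INZ. apply HW. }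
    assert (Hb : forall k : nat, (fourier U (- Z.of_nat (S k)) * cis (- INR (S k) * t0))%C
       = (W (- Z.of_nat k - 2)%Z - W (- Z.of_nat k - 1)%Z)%C).
    { intros k. rewrite INR_IZR_INZ, <- opp_IZR, HW.
      destruct (Z.eq_dec (- Z.of_nat (S k)) 0) as [H|H]; [lia|].
      replace (- Z.of_nat (S k) - 1)%Z with (- Z.of_nat k - 2)%Z by lia.
      replace (- Z.of_nat (S k))%Z with (- Z.of_nat k - 1)%Z by lia. ring. }
    induction N as [|N IH].
    - rewrite !sum_O. rewrite Ha, Hb. simpl Z.of_nat. simpl Z.sub.
      destruct (Z.eq_dec 0 0) as [_|H]; [|lia]. ring.
    - rewrite !sum_Sn. rewrite Ha, Hb.
      set (A := sum_n _ N) in *. set (B := sum_n _ N) in *.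
      change (@plus C_AbelianMonoid) with Cplus.
      match goal with |- (?x + ?a + (?y + ?b))%C = _ =>
        transitivity (x + y + (a + b))%C; [ring|] end.
      rewrite IH.
      destruct (Z.eq_dec (Z.of_nat (S N)) 0) as [H|H]; [lia|].
      replace (Z.of_nat (S N) - 1)%Z with (Z.of_nat N) by lia.
      replace (- Z.of_nat (S N) - 1)%Z with (- Z.of_nat N - 2)%Z by lia. ring. }
  destruct (riemann_lebesgue V (e / 2) HV HVP) as [N0 HN0]; [lra|].
  exists N0. intros N HN. rewrite Hsum.
  replace (U t0 + W (- Z.of_nat N - 2)%Z - W (Z.of_nat N) - U t0)%C
    with (W (- Z.of_nat N - 2)%Z + - W (Z.of_nat N))%C by ring.
  eapply Rle_lt_trans; [apply Cmod_triangle|]. rewrite Cmod_opp.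
  apply le_INR in HN. rewrite (INR_IZR_INZ N) in HN.
  assert (H0 : 0 <= IZR (Z.of_nat N)) by (rewrite <- INR_IZR_INZ; apply pos_INR).
  unfold W. rewrite !Cmod_mult, !Cmod_cis, !Rmult_1_r.
  assert (Cmod (fourier V (- Z.of_nat N - 2)) < e / 2).
  { apply HN0. rewrite minus_IZR, opp_IZR, Rabs_left; lra. }
  assert (Cmod (fourier V (Z.of_nat N)) < e / 2).
  { apply HN0. rewrite Rabs_pos_eq; lra. }
  lra.
Qed.

(** Each differentiation multiplies the $n$-th coefficient by $in$. Thus $|n|^k|\hat U(n)|$ is the
    modulus of a coefficient of the $k$-th derivative, bounded by its maximum over a period. *)
Lemma fourier_decay (U : nat -> R -> C) :
  (forall k, periodic (U k)) -> (forall k t, is_Rderive (U k) t (U (S k) t)) ->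
  forall k, exists M, forall n, Cmod (fourier (U 0%nat) n) * Rabs (IZR n) ^ k <= M.
Proof.
  intros HP HU k.
  assert (Hc : forall k t, continuous (U k) t) by (intros; eapply is_Rderive_continuous; apply HU).
  assert (Hk : forall k n, Cmod (fourier (U k) n) = Cmod (fourier (U 0%nat) n) * Rabs (IZR n) ^ k).
  { induction k0 as [|k0 IH]; intros n.
    - simpl. ring.
    - rewrite (fourier_derive (U k0)) by auto.
      rewrite !Cmod_mult, Cmod_Ci, Cmod_R, IH. simpl. ring. }
  assert (HPI := PI_RGT_0).
  destruct (continuous_bounded (U k) 0 (2 * PI)) as [M HM]; [lra|apply Hc|].
  exists M. intros n. rewrite <- Hk. apply fourier_bound; auto.
Qed.

(** * Power series *)

Definition is_Cseries (a : nat -> C) (l : C) : Prop :=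
  forall e, 0 < e -> exists N0, forall N, (N0 <= N)%nat -> Cmod (sum_n a N - l) < e.

Definition CSeries (a : nat -> C) : C :=
  (Series (fun n => Re (a n)), Series (fun n => Im (a n))).

Lemma is_Cseries_unique (a : nat -> C) (l m : C) : is_Cseries a l -> is_Cseries a m -> l = m.
Proof.
  intros Hl Hm. apply NNPP. intros Hn.
  assert (Hp : 0 < Cmod (l - m)) by (apply Cmod_gt_0; apply Cminus_eq_contra; auto).
  destruct (Hl (Cmod (l - m) / 2)) as [N1 H1]; [lra|].
  destruct (Hm (Cmod (l - m) / 2)) as [N2 H2]; [lra|].
  specialize (H1 (max N1 N2) (Nat.le_max_l _ _)). specialize (H2 (max N1 N2) (Nat.le_max_r _ _)).
  assert (H := Cmod_triangle (l - sum_n a (max N1 N2)) (sum_n a (max N1 N2) - m)).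
  rewrite (Cmod_sub_comm l) in H.
  replace (l - sum_n a (max N1 N2) + (sum_n a (max N1 N2) - m))%C with (l - m)%C in H by ring.
  lra.
Qed.

Lemma is_Cseries_plus (a b : nat -> C) (l m : C) :
  is_Cseries a l -> is_Cseries b m -> is_Cseries (fun n => a n + b n)%C (l + m)%C.
Proof.
  intros Ha Hb e He.
  destruct (Ha (e / 2)) as [N1 H1]; [lra|]. destruct (Hb (e / 2)) as [N2 H2]; [lra|].
  exists (max N1 N2). intros N HN.
  assert (K1 := H1 N ltac:(lia)). assert (K2 := H2 N ltac:(lia)).
  rewrite (sum_n_plus (G := C_AbelianMonoid) a b).
  replace (@plus C_AbelianMonoid (sum_n a N) (sum_n b N) - (l + m))%C
    with ((sum_n a N - l) + (sum_n b N - m))%C by (change (@plus C_AbelianMonoid) with Cplus; ring).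
  eapply Rle_lt_trans; [apply Cmod_triangle|]. lra.
Qed.

Lemma sum_n_Cmult (a : nat -> C) (c : C) (N : nat) :
  sum_n (fun n => c * a n)%C N = (c * sum_n a N)%C.
Proof. apply (sum_n_mult_l (K := C_Ring)). Qed.

Lemma is_Cseries_scal (c : C) (a : nat -> C) (l : C) :
  is_Cseries a l -> is_Cseries (fun n => c * a n)%C (c * l)%C.
Proof.
  intros Ha e He. assert (Hc := Cmod_ge_0 c).
  destruct (Ha (e / (1 + Cmod c))) as [N0 H]; [apply Rdiv_lt_0_compat; lra|].
  exists N0. intros N HN. specialize (H N HN). rewrite sum_n_Cmult.
  replace (c * sum_n a N - c * l)%C with (c * (sum_n a N - l))%C by ring. rewrite Cmod_mult.
  apply (Rmult_lt_compat_r (1 + Cmod c)) in H; [|lra].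
  unfold Rdiv in H. rewrite Rmult_assoc, Rinv_l, Rmult_1_r in H by lra.
  assert (H0 := Cmod_ge_0 (sum_n a N - l)). nra.
Qed.

Lemma is_Cseries_ext (a b : nat -> C) (l : C) :
  (forall n, a n = b n) -> is_Cseries a l -> is_Cseries b l.
Proof.
  intros Hab Ha e He. destruct (Ha e He) as [N0 H]. exists N0. intros N HN.
  rewrite <- (sum_n_ext a b) by auto. auto.
Qed.

Lemma is_Cseries_at_0 (a : nat -> C) : is_Cseries (fun k => a k * 0 ^ k)%C (a 0%nat).
Proof.
  intros e He. exists 0%nat. intros N _.
  replace (sum_n (fun k => a k * 0 ^ k)%C N) with (a 0%nat).
  - replace (a 0%nat - a 0%nat)%C with (RtoC 0) by ring. rewrite Cmod_0. exact He.
  - induction N as [|N IH].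
    + rewrite sum_O. simpl. ring.
    + rewrite sum_Sn, <- IH, Cpow_S. change (@plus C_AbelianMonoid) with Cplus. ring.
Qed.

Lemma is_Cseries_decr_1 (a : nat -> C) (l : C) :
  a 0%nat = 0%C -> is_Cseries (fun n => a (S n)) l -> is_Cseries a l.
Proof.
  intros H0 Ha e He. destruct (Ha e He) as [N0 H]. exists (S N0). intros N HN.
  destruct N as [|N]; [lia|].
  replace (sum_n a (S N)) with (sum_n (fun n => a (S n)) N); [apply H; lia|].
  clear -H0. induction N as [|N IH].
  - rewrite sum_Sn, !sum_O, H0. symmetry. apply Cplus_0_l.
  - rewrite sum_Sn, IH, <- (sum_Sn a (S N)). reflexivity.
Qed.

Lemma CSeries_correct (a : nat -> C) (b : nat -> R) :
  (forall n, Cmod (a n) <= b n) -> ex_series b ->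
  is_Cseries a (CSeries a) /\ Cmod (CSeries a) <= Series b.
Proof.
  intros Hab Hb.
  assert (HRe : ex_series (fun n => Re (a n))).
  { apply (ex_series_le (V := R_CompleteNormedModule)) with b; auto.
    intros n. eapply Rle_trans; [apply (abs_Re_le (a n))|auto]. }
  assert (HIm : ex_series (fun n => Im (a n))).
  { apply (ex_series_le (V := R_CompleteNormedModule)) with b; auto.
    intros n. eapply Rle_trans; [apply (abs_Im_le (a n))|auto]. }
  assert (SRe : forall N, Re (sum_n a N) = sum_n (fun n => Re (a n)) N).
  { induction N as [|N IH]; [rewrite !sum_O; auto|]. rewrite !sum_Sn, <- IH. reflexivity. }
  assert (SIm : forall N, Im (sum_n a N) = sum_n (fun n => Im (a n)) N).
  { induction N as [|N IH]; [rewrite !sum_O; auto|]. rewrite !sum_Sn, <- IH. reflexivity. }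
  assert (H1 : is_Cseries a (CSeries a)).
  { intros e He.
    assert (K1 : is_lim_seq (sum_n (fun n => Re (a n))) (Series (fun n => Re (a n))))
      by apply (Series_correct _ HRe).
    assert (K2 : is_lim_seq (sum_n (fun n => Im (a n))) (Series (fun n => Im (a n))))
      by apply (Series_correct _ HIm).
    apply is_lim_seq_spec in K1. apply is_lim_seq_spec in K2.
    assert (He2 : 0 < e / 2) by lra.
    destruct (K1 (mkposreal _ He2)) as [N1 L1]. destruct (K2 (mkposreal _ He2)) as [N2 L2].
    exists (max N1 N2). intros N HN.
    assert (M1 := L1 N ltac:(lia)). assert (M2 := L2 N ltac:(lia)). simpl in M1, M2.
    eapply Rle_lt_trans; [apply Cmod_le_abs_sum|].
    change (Rabs (Re (sum_n a N) - Series (fun n => Re (a n)))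
      + Rabs (Im (sum_n a N) - Series (fun n => Im (a n))) < e).
    rewrite SRe, SIm. lra. }
  split; [exact H1|].
  apply Rnot_lt_le. intros Hlt.
  destruct (H1 (Cmod (CSeries a) - Series b)) as [N0 H]; [lra|].
  specialize (H N0 (le_n _)).
  assert (K := Cmod_triangle_rev (CSeries a) (sum_n a N0)). rewrite Cmod_sub_comm in K.
  assert (B1 : Cmod (sum_n a N0) <= sum_n b N0).
  { clear -Hab. induction N0 as [|N IH]; [rewrite !sum_O; auto|].
    rewrite !sum_Sn. eapply Rle_trans; [apply Cmod_triangle|].
    apply Rplus_le_compat; auto. }
  assert (B2 : sum_n b N0 <= Series b).
  { apply (is_lim_seq_incr_compare (sum_n b) (Series b)).
    - apply (Series_correct _ Hb).
    - intros n. rewrite sum_Sn. change (sum_n b n <= sum_n b n + b (S n)).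
      assert (H0 := Cmod_ge_0 (a (S n))). specialize (Hab (S n)). lra. }
  lra.
Qed.

(** Decay faster than every power, enough for termwise differentiation to all orders on the closed
    disc. The weight [INR n + 1] does not vanish at [n = 0]. *)
Definition rapid (c : nat -> C) : Prop :=
  forall k, exists M, forall n, Cmod (c n) * (INR n + 1) ^ k <= M.

(** Comparison with twice the telescoping series of $\frac1{n+1}-\frac1{n+2}$, using
    $n+2\le2(n+1)$. *)
Lemma ex_series_inv_square : ex_series (fun n => / (INR n + 1) ^ 2).
Proof.
  assert (H : is_series (fun n => / (INR n + 1) - / (INR n + 2)) 1).
  { assert (Hs : forall N, sum_n (fun n => / (INR n + 1) - / (INR n + 2)) N = 1 - / (INR N + 2)).
    { induction N as [|N IH].
      - rewrite sum_O. simpl. field.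
      - rewrite sum_Sn, IH, S_INR. assert (H0 := pos_INR N).
        change (1 - / (INR N + 2) + (/ (INR N + 1 + 1) - / (INR N + 1 + 2)) = 1 - / (INR N + 1 + 2)).
        field. lra. }
    change (is_lim_seq (sum_n (fun n => / (INR n + 1) - / (INR n + 2))) 1).
    apply is_lim_seq_ext with (fun N => 1 - / (INR N + 2)); [auto|].
    replace (Finite 1) with (Finite (1 - 0)) by (f_equal; ring).
    apply is_lim_seq_minus'; [apply is_lim_seq_const|].
    replace (Finite 0) with (Rbar_inv p_infty) by reflexivity.
    apply is_lim_seq_inv; [|discriminate].
    apply (is_lim_seq_plus _ _ p_infty 2); [apply is_lim_seq_INR|apply is_lim_seq_const|reflexivity]. }
  assert (H2 : ex_series (fun n => scal 2 (/ (INR n + 1) - / (INR n + 2)))).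
  { apply (ex_series_scal_l (V := R_NormedModule) 2). exists 1. exact H. }
  apply (ex_series_le (V := R_CompleteNormedModule)) with (2 := H2).
  intros n. assert (H0 := pos_INR n).
  change (Rabs (/ (INR n + 1) ^ 2) <= 2 * (/ (INR n + 1) - / (INR n + 2))).
  rewrite Rabs_pos_eq by (left; apply Rinv_0_lt_compat; nra).
  replace (2 * (/ (INR n + 1) - / (INR n + 2))) with (/ ((INR n + 1) * ((INR n + 2) / 2))) by (field; lra).
  apply Rinv_le_contravar; nra.
Qed.

Lemma rapid_ex_series (c : nat -> C) (k : nat) :
  rapid c -> ex_series (fun n => Cmod (c n) * (INR n + 1) ^ k).
Proof.
  (* Two spare powers leave the summable factor $1/(n+1)^2$. *)
  intros Hc. destruct (Hc (k + 2)%nat) as [M HM].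
  apply (ex_series_le (V := R_CompleteNormedModule)) with (fun n => scal M (/ (INR n + 1) ^ 2)).
  - intros n. assert (H0 := pos_INR n).
    assert (Hp : 0 < (INR n + 1) ^ 2) by (apply pow_lt; lra).
    assert (Hk : 0 < (INR n + 1) ^ k) by (apply pow_lt; lra).
    change (Rabs (Cmod (c n) * (INR n + 1) ^ k) <= M * / (INR n + 1) ^ 2).
    assert (Hm := Cmod_ge_0 (c n)).
    rewrite Rabs_pos_eq by nra.
    apply Rmult_le_reg_r with ((INR n + 1) ^ 2); [exact Hp|].
    rewrite (Rmult_assoc M), Rinv_l, Rmult_1_r, Rmult_assoc, <- pow_add by lra. apply HM.
  - apply (ex_series_scal_l (V := R_NormedModule) M). apply ex_series_inv_square.
Qed.

Lemma rapid_shift (c : nat -> C) : rapid c -> rapid (fun n => INR (S n) * c (S n))%C.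
Proof.
  intros Hc k. destruct (Hc (S k)) as [M HM]. exists M. intros n.
  specialize (HM (S n)). rewrite Cmod_mult, Cmod_R, S_INR in *.
  assert (H0 := pos_INR n). rewrite Rabs_pos_eq by lra.
  eapply Rle_trans; [|exact HM]. assert (Hm := Cmod_ge_0 (c (S n))).
  simpl pow.
  assert (Hp : (INR n + 1) ^ k <= (INR n + 1 + 1) ^ k) by (apply pow_incr; lra).
  assert (0 <= (INR n + 1) ^ k) by (apply pow_le; lra).
  replace ((INR n + 1) * Cmod (c (S n)) * (INR n + 1) ^ k)
    with (Cmod (c (S n)) * ((INR n + 1) * (INR n + 1) ^ k)) by ring.
  apply Rmult_le_compat_l; auto. apply Rmult_le_compat; lra.
Qed.

(** The remainders satisfy $R_{n+1}=wR_n+nz^{n-1}(w-z)^2$, and $n^2+n\le(n+1)^2$. The bound is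
    uniform on the closed disc and its polynomial growth in $n$ is absorbed by rapid coefficients.
    At [n = 0] the value of [pred] is harmless, since its factor is 0. *)
Lemma Cpow_taylor (w z : C) (n : nat) :
  Cmod w <= 1 -> Cmod z <= 1 ->
  Cmod (w ^ n - z ^ n - INR n * z ^ pred n * (w - z)) <= INR n ^ 2 * Cmod (w - z) ^ 2.
Proof.
  intros Hw Hz. assert (Hd := Cmod_ge_0 (w - z)). induction n as [|n IH].
  - simpl. replace (1 - 1 - 0 * 1 * (w - z))%C with (RtoC 0) by ring. rewrite Cmod_0. lra.
  - assert (Hn := pos_INR n).
    assert (E : (w ^ S n - z ^ S n - INR (S n) * z ^ pred (S n) * (w - z))%C
      = (w * (w ^ n - z ^ n - INR n * z ^ pred n * (w - z))
         + INR n * z ^ pred n * ((w - z) * (w - z)))%C).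
    { rewrite S_INR, !Cpow_S, RtoC_plus. simpl pred. destruct n as [|n].
      - simpl. ring.
      - simpl pred. rewrite !Cpow_S. ring. }
    rewrite E. eapply Rle_trans; [apply Cmod_triangle|]. rewrite !Cmod_mult, Cmod_pow, Cmod_R, S_INR.
    rewrite Rabs_pos_eq by auto.
    assert (0 <= Cmod w) by apply Cmod_ge_0. assert (0 <= Cmod z) by apply Cmod_ge_0.
    assert (Hp : Cmod z ^ pred n <= 1) by (rewrite <- (pow1 (pred n)); apply pow_incr; lra).
    assert (Hp0 : 0 <= Cmod z ^ pred n) by (apply pow_le; auto).
    set (x := Cmod (w ^ n - z ^ n - INR n * z ^ pred n * (w - z))) in *.
    assert (0 <= x) by apply Cmod_ge_0.
    set (d := Cmod (w - z)) in *. set (y := Cmod z ^ pred n) in *.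
    assert (Cmod w * x <= 1 * (INR n ^ 2 * d ^ 2)) by (apply Rmult_le_compat; auto).
    assert (INR n * y * (d * d) <= INR n * 1 * (d * d)).
    { apply Rmult_le_compat_r; [nra|]. apply Rmult_le_compat_l; auto. }
    nra.
Qed.

Definition power_series (c : nat -> C) (z : C) : C := CSeries (fun n => c n * z ^ n)%C.

Lemma is_Cseries_power_series (c : nat -> C) (z : C) :
  rapid c -> Cmod z <= 1 -> is_Cseries (fun n => c n * z ^ n)%C (power_series c z).
Proof.
  intros Hc Hz. apply CSeries_correct with (fun n => Cmod (c n) * (INR n + 1) ^ 0).
  - intros n. rewrite Cmod_mult, Cmod_pow. apply Rmult_le_compat_l; [apply Cmod_ge_0|].
    simpl. rewrite <- (pow1 n). apply pow_incr. split; [apply Cmod_ge_0|auto].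
  - apply rapid_ex_series; auto.
Qed.

(** One quadratic bound on the whole closed disc yields both complex differentiability inside and
    continuity up to the circle. *)
Lemma power_series_taylor (c : nat -> C) : rapid c ->
  exists M, 0 <= M /\ forall w z, Cmod w <= 1 -> Cmod z <= 1 ->
    Cmod (power_series c w - power_series c z
          - power_series (fun n => INR (S n) * c (S n))%C z * (w - z)) <= M * Cmod (w - z) ^ 2.
Proof.
  intros Hc. assert (Hex := rapid_ex_series c 2 Hc).
  exists (Series (fun n => Cmod (c n) * (INR n + 1) ^ 2)).
  split.
  { apply Rle_trans with (Cmod (CSeries (fun _ => 0%C))); [apply Cmod_ge_0|].
    apply CSeries_correct; auto. intros n. rewrite Cmod_0.
    apply Rmult_le_pos; [apply Cmod_ge_0|]. apply pow_le. assert (H := pos_INR n). lra. }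
  intros w z Hw Hz.
  set (D := fun n => (c n * (w ^ n - z ^ n - INR n * z ^ pred n * (w - z)))%C).
  assert (HD : is_Cseries D (power_series c w - power_series c z
          - power_series (fun n => INR (S n) * c (S n)) z * (w - z))%C).
  { assert (H1 := is_Cseries_power_series c w Hc Hw).
    assert (H2 := is_Cseries_power_series c z Hc Hz).
    assert (H3 := is_Cseries_power_series _ z (rapid_shift c Hc) Hz).
    (* The derived series is reindexed with a zero term in front, so that the three series can be
       combined term by term into [D]. *)
    assert (H4 : is_Cseries (fun n => INR n * c n * z ^ pred n)%C
      (power_series (fun n => INR (S n) * c (S n)) z)%C).
    { apply is_Cseries_decr_1; [simpl; ring|]. exact H3. }
    apply (is_Cseries_scal (- (w - z))) in H4. apply (is_Cseries_scal (-1)) in H2.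
    assert (H := is_Cseries_plus _ _ _ _ (is_Cseries_plus _ _ _ _ H1 H2) H4).
    replace (power_series c w - power_series c z - power_series (fun n => INR (S n) * c (S n)) z * (w - z))%C
      with (power_series c w + -1 * power_series c z + - (w - z) * power_series (fun n => INR (S n) * c (S n)) z)%C by ring.
    apply is_Cseries_ext with (2 := H). intros n. unfold D. ring. }
  assert (Hb : forall n, Cmod (D n) <= scal (Cmod (w - z) ^ 2) (Cmod (c n) * (INR n + 1) ^ 2)).
  { intros n. unfold D. rewrite Cmod_mult.
    change (Cmod (c n) * Cmod (w ^ n - z ^ n - INR n * z ^ pred n * (w - z))
      <= Cmod (w - z) ^ 2 * (Cmod (c n) * (INR n + 1) ^ 2)).
    assert (H := Cpow_taylor w z n Hw Hz). assert (H0 := pos_INR n).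
    assert (Hd : 0 <= Cmod (w - z) ^ 2) by (apply pow_le, Cmod_ge_0).
    assert (Hm := Cmod_ge_0 (c n)).
    replace (Cmod (w - z) ^ 2 * (Cmod (c n) * (INR n + 1) ^ 2))
      with (Cmod (c n) * ((INR n + 1) ^ 2 * Cmod (w - z) ^ 2)) by ring.
    apply Rmult_le_compat_l; auto. eapply Rle_trans; [exact H|].
    apply Rmult_le_compat_r; auto. apply pow_incr. lra. }
  destruct (CSeries_correct D _ Hb) as [K1 K2].
  { apply (ex_series_scal_l (V := R_NormedModule)). exact Hex. }
  rewrite (is_Cseries_unique _ _ _ HD K1).
  eapply Rle_trans; [exact K2|]. right.
  rewrite (Series_scal_l (Cmod (w - z) ^ 2)). ring.
Qed.

Lemma closure_unit_disc (z : C) : closure unit_disc z <-> Cmod z <= 1.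
Proof.
  rewrite closure_Cmod. split; intros H.
  - apply Rnot_lt_le. intros Hz. destruct (H (Cmod z - 1)) as [w [Hw1 Hw2]]; [lra|].
    unfold unit_disc in Hw1. assert (K := Cmod_triangle_rev z w). rewrite Cmod_sub_comm in K. lra.
  - intros e He. set (r := 1 - Rmin 1 (e / 2)).
    assert (H1 : 0 < Rmin 1 (e / 2)) by (apply Rmin_glb_lt; lra).
    assert (H2 := Rmin_l 1 (e / 2)). assert (H3 := Rmin_r 1 (e / 2)).
    assert (Hm := Cmod_ge_0 z).
    exists (r * z)%C. split.
    + unfold unit_disc. rewrite Cmod_mult, Cmod_R, Rabs_pos_eq by (unfold r; lra). unfold r. nra.
    + replace (r * z - z)%C with (RtoC (r - 1) * z)%C by (rewrite RtoC_minus; ring).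
      rewrite Cmod_mult, Cmod_R, Rabs_left by (unfold r; lra). unfold r. nra.
Qed.

Lemma open_unit_disc : open unit_disc.
Proof.
  intros z Hz. apply locally_Cmod. unfold unit_disc in *. exists (1 - Cmod z). split; [lra|].
  intros w Hw. assert (H := Cmod_triangle_rev w z). lra.
Qed.

Lemma taylor_is_Cderive (f : C -> C) (l z : C) (M : R) (G : C -> Prop) :
  open G -> G z -> 0 <= M ->
  (forall w, G w -> Cmod (f w - f z - l * (w - z)) <= M * Cmod (w - z) ^ 2) -> is_Cderive f z l.
Proof.
  intros HG Hz HM H. apply is_Cderive_Cmod. intros e He.
  destruct (open_Cmod G z HG Hz) as [d [Hd HGd]].
  exists (Rmin d (e / (M + 1))). split; [apply Rmin_glb_lt; auto; apply Rdiv_lt_0_compat; lra|].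
  intros w Hw.
  destruct (Rmin_Rgt_l _ _ _ Hw) as [W1 W2].
  eapply Rle_trans; [apply H; auto|].
  apply (Rmult_lt_compat_r (M + 1)) in W2; [|lra].
  unfold Rdiv in W2. rewrite Rmult_assoc, Rinv_l, Rmult_1_r in W2 by lra.
  assert (H0 := Cmod_ge_0 (w - z)).
  replace (M * Cmod (w - z) ^ 2) with (M * Cmod (w - z) * Cmod (w - z)) by ring.
  apply Rmult_le_compat_r; auto. nra.
Qed.

Lemma power_series_is_Cderive (c : nat -> C) (z : C) :
  rapid c -> unit_disc z ->
  is_Cderive (power_series c) z (power_series (fun n => INR (S n) * c (S n))%C z).
Proof.
  intros Hc Hz. destruct (power_series_taylor c Hc) as [M [HM H]].
  apply taylor_is_Cderive with M unit_disc; auto using open_unit_disc.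
  intros w Hw. apply H; unfold unit_disc in *; lra.
Qed.

Lemma power_series_continuous_on (c : nat -> C) :
  rapid c -> continuous_on (closure unit_disc) (power_series c).
Proof.
  intros Hc. apply continuous_on_Cmod. intros z Hz e He. apply closure_unit_disc in Hz.
  destruct (power_series_taylor c Hc) as [M [HM H]].
  set (l := power_series (fun n => INR (S n) * c (S n))%C z) in *.
  assert (Hl := Cmod_ge_0 l).
  exists (Rmin 1 (e / (M + Cmod l + 1))). split; [apply Rmin_glb_lt; [lra|]; apply Rdiv_lt_0_compat; lra|].
  intros w Hw Hwz. apply closure_unit_disc in Hw.
  destruct (Rmin_Rgt_l _ _ _ Hwz) as [W1 W2].
  specialize (H w z Hw Hz). fold l in H.
  apply (Rmult_lt_compat_r (M + Cmod l + 1)) in W2; [|lra].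
  unfold Rdiv in W2. rewrite Rmult_assoc, Rinv_l, Rmult_1_r in W2 by lra.
  replace (power_series c w - power_series c z)%C
    with ((power_series c w - power_series c z - l * (w - z)) + l * (w - z))%C by ring.
  eapply Rle_lt_trans; [apply Cmod_triangle|]. rewrite (Cmod_mult l).
  assert (H0 := Cmod_ge_0 (w - z)). set (d := Cmod (w - z)) in *.
  assert (M * d ^ 2 <= M * d) by (apply Rmult_le_compat_l; auto; nra). nra.
Qed.

Lemma power_series_smooth_upto (c : nat -> C) (n : nat) :
  rapid c -> smooth_upto unit_disc n (power_series c).
Proof.
  revert c. induction n as [|n IH]; intros c Hc.
  - exists (power_series c). split; auto. apply power_series_continuous_on; auto.
  - split.
    + exists (power_series c). split; auto. apply power_series_continuous_on; auto.
    + exists (power_series (fun n => INR (S n) * c (S n))%C). split.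
      * intros z Hz. apply power_series_is_Cderive; auto.
      * apply IH. apply rapid_shift; auto.
Qed.

(** * Taylor expansion from boundary values *)

Lemma is_Rderive_Ccomp (f : C -> C) (m : R -> C) (t : R) (a b : C) :
  is_Cderive f (m t) a -> is_Rderive m t b -> is_Rderive (fun s => f (m s)) t (a * b)%C.
Proof.
  rewrite is_Cderive_Cmod, !is_Rderive_eps. intros Hf Hm e He.
  assert (Ha := Cmod_ge_0 a). assert (Hb := Cmod_ge_0 b).
  destruct (small_factor (2 * (Cmod b + 1)) e) as [e1 [[He1 _] He1']]; [lra|exact He|].
  destruct (small_factor (2 * (Cmod a + 1)) e) as [e2 [[He2 He2'] He2'']]; [lra|exact He|].
  destruct (Hf e1 He1) as [d1 [Hd1 K1]]. destruct (Hm e2 He2) as [d2 [Hd2 K2]].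
  exists (Rmin d2 (d1 / (Cmod b + 1))).
  split; [apply Rmin_glb_lt; auto; apply Rdiv_lt_0_compat; lra|].
  intros s Hs.
  destruct (Rmin_Rgt_l _ _ _ Hs) as [S1 S2].
  specialize (K2 s S1). set (h := Rabs (s - t)) in *. assert (Hh : 0 <= h) by apply Rabs_pos.
  assert (Hms : Cmod (m s - m t) <= (Cmod b + 1) * h).
  { replace (m s - m t)%C with ((m s - m t - b * (s - t)) + b * (s - t))%C by ring.
    eapply Rle_trans; [apply Cmod_triangle|]. rewrite Cmod_mult, <- RtoC_minus, Cmod_R.
    rewrite <- RtoC_minus in K2. fold h. nra. }
  apply (Rmult_lt_compat_l (Cmod b + 1)) in S2; [|lra].
  replace ((Cmod b + 1) * (d1 / (Cmod b + 1))) with d1 in S2 by (field; lra).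
  specialize (K1 (m s) ltac:(lra)).
  replace (f (m s) - f (m t) - a * b * (s - t))%C
    with ((f (m s) - f (m t) - a * (m s - m t)) + a * (m s - m t - b * (s - t)))%C by ring.
  eapply Rle_trans; [apply Cmod_triangle|]. rewrite (Cmod_mult a).
  assert (e1 * Cmod (m s - m t) <= e1 * ((Cmod b + 1) * h)) by (apply Rmult_le_compat_l; lra).
  assert (Cmod a * Cmod (m s - m t - b * (s - t)) <= Cmod a * (e2 * h)) by (apply Rmult_le_compat_l; lra).
  assert (e1 * (Cmod b + 1) * h <= e / 2 * h) by (apply Rmult_le_compat_r; lra).
  assert (Cmod a * e2 <= e / 2) by nra.
  assert (Cmod a * e2 * h <= e / 2 * h) by (apply Rmult_le_compat_r; auto). lra.
Qed.

Lemma is_Rderive_on_circle (f f1 F F1 : C -> C) (r t : R) :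
  (forall z, unit_disc z -> is_Cderive f z (f1 z)) ->
  (forall z, unit_disc z -> F z = f z) -> (forall z, unit_disc z -> F1 z = f1 z) -> 0 < r < 1 ->
  is_Rderive (fun t => F (r * cis t)%C) t (F1 (r * cis t) * (r * (Ci * cis t)))%C.
Proof.
  intros Hf HF HF1 Hr.
  assert (Hdisc : unit_disc (r * cis t)).
  { unfold unit_disc. rewrite Cmod_polar; lra. }
  replace (F1 (r * cis t) * (r * (Ci * cis t)))%C
    with (f1 (r * cis t) * (0 * cis t + r * (Ci * cis t)))%C by (rewrite HF1 by exact Hdisc; ring).
  apply (is_Rderive_Ccomp F (fun t => r * cis t)%C).
  - apply is_Cderive_ext_loc with f unit_disc; auto using open_unit_disc.
    intros w Hw. symmetry; auto.
  - apply (is_Rderive_mult (fun _ => RtoC r) cis).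
    + apply (@is_derive_const R_AbsRing C_R_NormedModule).
    + apply is_Rderive_cis_1.
Qed.

Lemma is_Rderive_affine (z v : C) (t : R) : is_Rderive (fun s => z + s * v)%C t v.
Proof.
  apply is_Rderive_eps. intros e He. exists 1. split; [lra|]. intros s _.
  replace (z + s * v - (z + t * v) - v * (s - t))%C with (RtoC 0) by ring.
  rewrite Cmod_0. apply Rmult_le_pos; [lra|apply Rabs_pos].
Qed.

Lemma is_Rderive_const (c : C) (t : R) : is_Rderive (fun _ => c) t 0%C.
Proof. apply (@is_derive_const R_AbsRing C_R_NormedModule). Qed.

Lemma is_Rderive_plus (f g : R -> C) (t : R) (a b : C) :
  is_Rderive f t a -> is_Rderive g t b -> is_Rderive (fun s => f s + g s)%C t (a + b)%C.
Proof. apply (@is_derive_plus R_AbsRing C_R_NormedModule). Qed.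

(* The real mean value theorem, applied to the increment times its own conjugate. *)
Lemma Cderive_mean_value (f f1 : C -> C) (c z w : C) (e : R) :
  (forall s, 0 <= s <= 1 -> is_Cderive f (z + s * (w - z))%C (f1 (z + s * (w - z))%C) /\
     Cmod (f1 (z + s * (w - z))%C - c) <= e) ->
  Cmod (f w - f z - c * (w - z)) <= e * Cmod (w - z).
Proof.
  intros H. set (v := (f w - f z - c * (w - z))%C).
  set (g := fun s : R => (Cconj v * (f (z + s * (w - z)) + (- c) * (0 + s * (w - z))))%C).
  assert (Hg : forall s, 0 <= s <= 1 ->
     is_Rderive g s (Cconj v * ((f1 (z + s * (w - z)) - c) * (w - z)))%C).
  { intros s Hs. unfold g.
    replace (Cconj v * ((f1 (z + s * (w - z)) - c) * (w - z)))%C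
      with (0 * (f (z + s * (w - z)) + (- c) * (0 + s * (w - z)))
            + Cconj v * (f1 (z + s * (w - z)) * (w - z) +
                (0 * (0 + s * (w - z)) + (- c) * (w - z))))%C by ring.
    apply is_Rderive_mult; [apply is_Rderive_const|].
    apply is_Rderive_plus.
    - apply (is_Rderive_Ccomp f (fun s => z + s * (w - z))%C); [apply H; auto|].
      apply is_Rderive_affine.
    - apply is_Rderive_mult; [apply is_Rderive_const|apply is_Rderive_affine]. }
  destruct (MVT_gen (fun s => Re (g s)) 0 1
     (fun s => Re (Cconj v * ((f1 (z + s * (w - z)) - c) * (w - z)))%C)) as [s [Hs Hs']].
  - intros s Hs. rewrite Rmin_left, Rmax_right in Hs by lra.
    apply (proj1 (is_Rderive_parts _ _ _) (Hg s ltac:(lra))).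
  - intros s Hs. rewrite Rmin_left, Rmax_right in Hs by lra.
    apply continuity_pt_filterlim. apply (continuous_Re g).
    eapply is_Rderive_continuous. apply Hg. lra.
  - rewrite Rmin_left, Rmax_right in Hs by lra.
    assert (Hv : Re (g 1) - Re (g 0) = Cmod v * Cmod v).
    { assert (E : Re (g 1) - Re (g 0) = Re (g 1 - g 0)) by reflexivity. rewrite E.
      replace (g 1 - g 0)%C with (v * Cconj v)%C.
      - rewrite <- Cmod2_conj. simpl. ring.
      - unfold g. replace (z + 1 * (w - z))%C with w by ring.
        replace (z + 0 * (w - z))%C with z by ring. unfold v at 1. ring. }
    rewrite Hv, Rminus_0_r, Rmult_1_r in Hs'.
    assert (Hb : Cmod v * Cmod v <= Cmod v * (e * Cmod (w - z))).
    { rewrite Hs'. eapply Rle_trans; [apply Rle_abs|]. eapply Rle_trans; [apply abs_Re_le|].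
      rewrite !Cmod_mult, Cmod_conj. apply Rmult_le_compat_l; [apply Cmod_ge_0|].
      apply Rmult_le_compat_r; [apply Cmod_ge_0|]. apply H; auto. }
    assert (Hv0 := Cmod_ge_0 v).
    destruct (Req_dec (Cmod v) 0) as [E|E].
    + rewrite E. apply Rmult_le_pos; [|apply Cmod_ge_0].
      apply Rle_trans with (1 := Cmod_ge_0 _) (2 := proj2 (H s Hs)).
    + apply Rmult_le_reg_l with (Cmod v); lra.
Qed.

Lemma compact_uniform_continuity (A : C -> Prop) (F : C -> C) (e : R) :
  compact_set A -> continuous_on A F -> 0 < e ->
  exists d, 0 < d /\ forall z w, A z -> A w -> Cmod (w - z) < d -> Cmod (F w - F z) < e.
Proof.
  intros HA HF He. rewrite continuous_on_Cmod in HF.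
  destruct (compact_uniform A (fun z d => forall w, A w -> Cmod (w - z) < d -> Cmod (F w - F z) < e))
    as [d [Hd H]]; auto.
  - intros z d d' H [_ Hd'] w Hw Hwz. apply H; auto. lra.
  - intros u Hu. destruct (HF u Hu (e / 2)) as [d [Hd H]]; [lra|].
    exists (d / 2). split; [lra|]. intros z Hz Hzu w Hw Hwz.
    assert (L1 : Cmod (F z - F u) < e / 2) by (apply H; auto; lra).
    assert (L2 : Cmod (F w - F u) < e / 2).
    { apply H; auto. replace (w - u)%C with ((w - z) + (z - u))%C by ring.
      eapply Rle_lt_trans; [apply Cmod_triangle|]. lra. }
    replace (F w - F z)%C with ((F w - F u) + (F u - F z))%C by ring.
    eapply Rle_lt_trans; [apply Cmod_triangle|]. rewrite (Cmod_sub_comm (F u)). lra.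
  - exists d. split; auto.
Qed.

Lemma disc_uniform_continuity (F : C -> C) (e : R) :
  continuous_on (closure unit_disc) F -> 0 < e ->
  exists d, 0 < d /\ forall z w, Cmod z <= 1 -> Cmod w <= 1 -> Cmod (w - z) < d -> Cmod (F w - F z) < e.
Proof.
  intros HF He.
  apply (compact_uniform_continuity (fun z => Cmod z <= 1) F e); auto.
  - apply compact_closed_disc.
  - apply continuous_on_subset with (2 := HF). intros z Hz. apply closure_unit_disc; auto.
Qed.

Lemma continuous_on_disc_circle (F : C -> C) (r : R) :
  continuous_on (closure unit_disc) F -> 0 <= r <= 1 -> forall t, continuous (fun t => F (r * cis t)%C) t.
Proof.
  intros HF Hr t. apply continuous_C_eps. intros e He.
  assert (Hin : forall t, closure unit_disc (r * cis t)).
  { intros s. apply closure_unit_disc. rewrite Cmod_polar; lra. }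
  rewrite continuous_on_Cmod in HF. destruct (HF _ (Hin t) e He) as [d [Hd H]].
  exists (d / 2). split; [lra|]. intros s Hs. apply H; auto.
  replace (r * cis s - r * cis t)%C with (r * (cis s - cis t))%C by ring.
  rewrite Cmod_mult, Cmod_R, Rabs_pos_eq by lra.
  assert (K := cis_lipschitz s t). assert (K0 := Cmod_ge_0 (cis s - cis t)).
  assert (r * Cmod (cis s - cis t) <= 1 * Cmod (cis s - cis t)) by (apply Rmult_le_compat_r; lra). lra.
Qed.

Lemma fourier_minus (U V : R -> C) (n : Z) :
  (forall t, continuous U t) -> (forall t, continuous V t) ->
  fourier (fun t => U t - V t)%C n = (fourier U n - fourier V n)%C.
Proof.
  intros HU HV.
  rewrite (fourier_ext _ (fun t => U t + (-1) * V t)%C) by (intros; ring).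
  assert (Hc : forall t, continuous (fun t => (-1) * V t)%C t).
  { intros t. apply (continuous_Cmult (fun _ => (-1)%C)); [apply continuous_const|auto]. }
  rewrite (fourier_plus U (fun t => (-1) * V t)%C), fourier_scal by auto. ring.
Qed.

(** * Fourier coefficients on concentric circles *)

Definition C1_closed_disc (f f1 F F1 : C -> C) : Prop :=
  (forall z, unit_disc z -> is_Cderive f z (f1 z)) /\
  continuous_on (closure unit_disc) F /\ (forall z, unit_disc z -> F z = f z) /\
  continuous_on (closure unit_disc) F1 /\ (forall z, unit_disc z -> F1 z = f1 z).

Lemma C1_closed_disc_bdval (f f1 : C -> C) :
  (forall z, unit_disc z -> is_Cderive f z (f1 z)) ->
  extends_continuously unit_disc f -> extends_continuously unit_disc f1 ->
  C1_closed_disc f f1 (bdval unit_disc f) (bdval unit_disc f1).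
Proof.
  intros Hd Hf Hf1.
  apply extends_continuously_bdval in Hf. apply extends_continuously_bdval in Hf1.
  destruct Hf as [Hc He]. destruct Hf1 as [H1c H1e].
  exact (conj Hd (conj Hc (conj He (conj H1c H1e)))).
Qed.

(** The Cauchy-Riemann equation in polar form: $\partial_rK(re^{it})=K'(re^{it})e^{it}$ is $1/(ir)$
    times $\partial_tK(re^{it})$, and a $t$-derivative multiplies the $n$-th coefficient by $in$. *)
Lemma is_Rderive_fourier_circle (K K1 Kh K1h : C -> C) (n : Z) (r : R) :
  C1_closed_disc K K1 Kh K1h ->
  0 < r < 1 ->
  is_Rderive (fun r => fourier (fun t => Kh (r * cis t)%C) n) r
    (IZR n / r * fourier (fun t => Kh (r * cis t)%C) n)%C.
Proof.
  intros HC Hr. pose proof HC as [HK [HKc [HKe [HK1c HK1e]]]].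
  assert (Hdisc : forall r t, 0 < r < 1 -> unit_disc (r * cis t)).
  { intros x t Hx. unfold unit_disc. rewrite Cmod_polar; lra. }
  set (L := fun t => (K1h (r * cis t) * cis t)%C).
  assert (HLc : forall t, continuous L t).
  { intros t. apply continuous_Cmult; [|apply continuous_cis].
    apply continuous_on_disc_circle; auto; lra. }
  (* [L] is the radial derivative; its coefficient is computed from the angular derivative
     [Ci * r * L]. *)
  assert (Hbyparts : (IZR n / r * fourier (fun t => Kh (r * cis t)%C) n)%C = fourier L n).
  { assert (HD : forall t, is_Rderive (fun t => Kh (r * cis t)%C) t (Ci * r * L t)%C).
    { intros t. unfold L.
      replace (Ci * r * (K1h (r * cis t) * cis t))%C with (K1h (r * cis t) * (r * (Ci * cis t)))%C by ring.
      exact (is_Rderive_on_circle K K1 Kh K1h r t HK HKe HK1e Hr). }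
    assert (H := fourier_derive (fun t => Kh (r * cis t)%C) (fun t => Ci * r * L t)%C n).
    rewrite fourier_scal in H by auto.
    assert (Hr0 : RtoC r <> 0%C) by (intros E; apply RtoC_inj in E; lra).
    apply Cmult_reg_r with (Ci * r)%C; [apply Cmult_neq_0; [apply Ci_nz|auto]|].
    transitivity (Ci * IZR n * fourier (fun t => Kh (r * cis t)%C) n)%C; [field; auto|].
    rewrite <- H.
    - ring.
    - intros t. now rewrite cis_plus, cis_2PI, Cmult_1_r.
    - exact HD.
    - intros t. apply (continuous_Cmult (fun _ => Ci * r)%C); [apply continuous_const|auto]. }
  rewrite Hbyparts. apply is_Rderive_eps. intros e He.
  destruct (disc_uniform_continuity K1h e HK1c He) as [d [Hd Hu]].
  (* The last two bounds keep [s], and the segment between the two radii, inside the open disc.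
     There the mean value inequality and uniform continuity of [K1h] justify differentiation under
     the integral. *)
  exists (Rmin d (Rmin (r / 2) ((1 - r) / 2))). split; [repeat apply Rmin_glb_lt; lra|].
  intros s Hs.
  destruct (Rmin_Rgt_l _ _ _ Hs) as [S1 S2].
  destruct (Rmin_Rgt_l _ _ _ S2) as [S3 S4].
  apply Rabs_def2 in S3. apply Rabs_def2 in S4.
  assert (Hs01 : 0 < s < 1) by lra.
  assert (Hc : forall x t, 0 < x < 1 -> continuous (fun t => Kh (x * cis t)%C) t).
  { intros x t Hx. apply continuous_on_disc_circle; auto; lra. }
  assert (HLs : forall t, continuous (fun t => (s - r) * L t)%C t).
  { intros t. apply (continuous_Cmult (fun _ => (s - r)%C)); [apply continuous_const|auto]. }
  replace (fourier (fun t => Kh (s * cis t)%C) n - fourier (fun t => Kh (r * cis t)%C) n - fourier L n * (s - r))%C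
    with (fourier (fun t => (Kh (s * cis t) - Kh (r * cis t)) - (s - r) * L t)%C n).
  - apply fourier_bound.
    + intros t. apply (continuous_Cminus (fun t => Kh (s * cis t) - Kh (r * cis t))%C); auto.
      apply continuous_Cminus; auto.
    + intros t _. unfold L.
      assert (B := Cderive_mean_value Kh K1h (K1h (r * cis t)%C) (r * cis t)%C (s * cis t)%C e).
      replace (s * cis t - r * cis t)%C with ((s - r) * cis t)%C in B by ring.
      rewrite (Cmod_mult (s - r)%C), Cmod_cis, Rmult_1_r, <- RtoC_minus, Cmod_R in B.
      rewrite RtoC_minus in B.
      replace (Kh (s * cis t) - Kh (r * cis t) - (s - r) * (K1h (r * cis t) * cis t))%C
        with (Kh (s * cis t) - Kh (r * cis t) - K1h (r * cis t) * ((s - r) * cis t))%C by ring.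
      apply B. intros x Hx.
      replace (r * cis t + x * ((s - r) * cis t))%C with (RtoC (r + x * (s - r)) * cis t)%C
        by (rewrite RtoC_plus, RtoC_mult, RtoC_minus; ring).
      assert (Hx01 : 0 < r + x * (s - r) < 1) by nra.
      split.
      * rewrite HK1e by auto. apply is_Cderive_ext_loc with K unit_disc; auto using open_unit_disc.
        intros w Hw. symmetry; auto.
      * left. apply Hu.
        -- left. apply Hdisc; auto.
        -- left. apply Hdisc; auto.
        -- replace (RtoC (r + x * (s - r)) * cis t - r * cis t)%C with (RtoC (x * (s - r)) * cis t)%C
             by (rewrite RtoC_plus; ring).
           rewrite Cmod_mult, Cmod_cis, Cmod_R, Rmult_1_r, Rabs_mult, (Rabs_pos_eq x) by lra.
           assert (H0 := Rabs_pos (s - r)). nra.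
  - rewrite (fourier_minus (fun t => Kh (s * cis t) - Kh (r * cis t))%C), fourier_minus, fourier_scal; auto.
    + ring.
    + intros t. apply continuous_Cminus; auto.
Qed.

Definition boundary_fourier (F : C -> C) (n : Z) : C := fourier (fun t => F (cis t)) n.

Lemma is_Rderive_real (f : R -> R) (t l : R) :
  is_derive f t l -> is_Rderive (fun s => RtoC (f s)) t (RtoC l).
Proof.
  intros H. apply is_Rderive_parts. split; [exact H|].
  apply (@is_derive_const R_AbsRing R_NormedModule 0 t).
Qed.

Lemma continuous_on_disc_unit_circle (F : C -> C) :
  continuous_on (closure unit_disc) F -> forall t, continuous (fun t => F (cis t)) t.
Proof.
  intros HF t. apply continuous_ext with (fun t => F (1 * cis t)%C).
  - intros x. now rewrite Cmult_1_l.
  - apply continuous_on_disc_circle; auto; lra.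
Qed.

(** By $I_n'=(n/r)I_n$ the product $r^{-n}I_n(r)$ has derivative zero, hence is constant; its limit
    at $r=1$ is found by uniform continuity on the closed disc. The exponential stands for $r^{-n}$
    with [n] of either sign. *)
Lemma fourier_circle_scaling (K K1 Kh K1h : C -> C) (n : Z) :
  C1_closed_disc K K1 Kh K1h ->
  forall r, 0 < r < 1 ->
    (exp (- IZR n * ln r) * fourier (fun t => Kh (r * cis t)%C) n)%C = boundary_fourier Kh n.
Proof.
  intros HC. pose proof HC as [HK [HKc [HKe [HK1c HK1e]]]].
  set (I := fun r : R => fourier (fun t => Kh (r * cis t)%C) n).
  set (J := fun r : R => (RtoC (exp (- IZR n * ln r)) * I r)%C).
  assert (HJ : forall r, 0 < r < 1 -> is_Rderive J r 0%C).
  { intros r Hr. unfold J.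
    replace (RtoC 0) with (RtoC (exp (- IZR n * ln r) * (- IZR n * / r)) * I r
      + RtoC (exp (- IZR n * ln r)) * (IZR n / r * I r))%C.
    - apply (is_Rderive_mult (fun r => RtoC (exp (- IZR n * ln r))) I).
      + apply (is_Rderive_real (fun r => exp (- IZR n * ln r))). auto_derive; [lra|]. ring.
      + exact (is_Rderive_fourier_circle K K1 Kh K1h n r HC Hr).
    - rewrite RtoC_mult, RtoC_mult, RtoC_opp, RtoC_inv by lra. unfold Cdiv. ring. }
  assert (Hconst : forall r s, 0 < r -> r < s -> s < 1 -> J r = J s).
  { intros r s Hr Hrs Hs. apply (@eq_is_derive C_R_NormedModule); auto.
    intros t Ht. apply HJ. lra. }
  intros r Hr. change (J r = boundary_fourier Kh n).
  apply NNPP. intros Hne.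
  assert (Hp : 0 < Cmod (J r - boundary_fourier Kh n)) by (apply Cmod_gt_0; apply Cminus_eq_contra; auto).
  set (e := Cmod (J r - boundary_fourier Kh n)) in *.
  set (M := Cmod (boundary_fourier Kh n)).
  assert (HM : 0 <= M) by apply Cmod_ge_0.
  (* With $|x|\le2$ the final estimate is $e\le2e_1+e_2M\le e/2+e/4$, a contradiction. *)
  set (e1 := e / 4).
  destruct (disc_uniform_continuity Kh e1 HKc) as [d [Hd Hu]]; [unfold e1; lra|].
  assert (Hexp : continuous (fun r => exp (- IZR n * ln r)) 1).
  { apply (ex_derive_continuous (V := R_NormedModule)). auto_derive. lra. }
  destruct (small_factor (4 * (M + 1)) e) as [e2 [[He2 He2'] He2'']]; [lra|exact Hp|].
  destruct (proj1 (continuous_R_eps _ _) Hexp e2 He2) as [d' [Hd' Hexp']].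
  (* A radius beyond [r], close enough to 1 for both the coefficient and the factor $s^{-n}$ to be
     near their limits. *)
  set (s := 1 - Rmin ((1 - r) / 2) (Rmin (d / 2) (d' / 2))).
  assert (Hs1 := Rmin_l ((1 - r) / 2) (Rmin (d / 2) (d' / 2))).
  assert (Hs2 := Rmin_r ((1 - r) / 2) (Rmin (d / 2) (d' / 2))).
  assert (Hs3 := Rmin_l (d / 2) (d' / 2)). assert (Hs4 := Rmin_r (d / 2) (d' / 2)).
  assert (Hs0 : 0 < Rmin ((1 - r) / 2) (Rmin (d / 2) (d' / 2))) by (repeat apply Rmin_glb_lt; lra).
  assert (Hsr : r < s < 1) by (unfold s; lra).
  assert (HJs := Hconst r s ltac:(lra) ltac:(lra) ltac:(lra)).
  assert (HIs : Cmod (I s - boundary_fourier Kh n) <= e1).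
  { unfold I, boundary_fourier.
    assert (C1 := continuous_on_disc_unit_circle Kh HKc).
    assert (C2 : forall t, continuous (fun t => Kh (s * cis t)%C) t).
    { apply continuous_on_disc_circle; auto; lra. }
    rewrite <- fourier_minus by auto.
    apply fourier_bound.
    - intros t. apply continuous_Cminus; auto.
    - intros t _. left. apply Hu.
      + rewrite Cmod_cis. lra.
      + rewrite Cmod_polar; lra.
      + replace (s * cis t - cis t)%C with (RtoC (s - 1) * cis t)%C by (rewrite RtoC_minus; ring).
        rewrite Cmod_mult, Cmod_cis, Cmod_R, Rmult_1_r, Rabs_left by lra. unfold s. lra. }
  set (x := exp (- IZR n * ln s)).
  assert (Hx : Rabs (x - 1) < e2).
  { specialize (Hexp' s). simpl in Hexp'. rewrite ln_1, Rmult_0_r, exp_0 in Hexp'.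
    apply Hexp'. rewrite Rabs_left by lra. unfold s. lra. }
  assert (Hee : e <= Rabs x * e1 + Rabs (x - 1) * M).
  { unfold e. rewrite HJs. unfold J. fold x.
    replace (x * I s - boundary_fourier Kh n)%C
      with (x * (I s - boundary_fourier Kh n) + RtoC (x - 1) * boundary_fourier Kh n)%C
      by (rewrite RtoC_minus; ring).
    eapply Rle_trans; [apply Cmod_triangle|]. rewrite !Cmod_mult, !Cmod_R. fold M.
    apply Rplus_le_compat_r. apply Rmult_le_compat_l; [apply Rabs_pos|auto]. }
  assert (Hx2 : Rabs x <= 2).
  { replace x with ((x - 1) + 1) by ring. eapply Rle_trans; [apply Rabs_triang|].
    rewrite Rabs_R1. lra. }
  assert (Rabs x * e1 <= 2 * e1) by (apply Rmult_le_compat_r; unfold e1; lra).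
  assert (Rabs (x - 1) * M <= e2 * M) by (apply Rmult_le_compat_r; lra).
  unfold e1 in *. nra.
Qed.

(** In $\hat K(n)=r^{-n}I_n(r)$ let $r\to0$: [K] is bounded near the centre, while $r^{-n}$ tends to
    0 for negative [n]. *)
Lemma boundary_fourier_negative (K K1 Kh K1h : C -> C) (n : Z) :
  C1_closed_disc K K1 Kh K1h ->
  (n < 0)%Z -> boundary_fourier Kh n = 0%C.
Proof.
  intros HC Hn. pose proof HC as [HK [HKc [HKe _]]].
  assert (HS := fourier_circle_scaling K K1 Kh K1h n HC).
  assert (Hb : exists d, 0 < d /\ forall z, Cmod z < d -> Cmod (K z) <= Cmod (K 0) + 1).
  { assert (H0 : unit_disc 0) by (unfold unit_disc; rewrite Cmod_0; lra).
    destruct (is_Cderive_continuous _ _ _ (HK 0%C H0) 1 Rlt_0_1) as [d [Hd H]].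
    exists d. split; auto. intros z Hz. specialize (H z).
    replace (z - 0)%C with z in H by ring. specialize (H Hz).
    assert (T := Cmod_triangle_rev (K z) (K 0%C)). lra. }
  destruct Hb as [d [Hd Hb]]. set (M := Cmod (K 0) + 1) in *.
  assert (HM : 0 < M) by (unfold M; assert (T := Cmod_ge_0 (K 0)); lra).
  apply NNPP. intros Hne. apply Cmod_gt_0 in Hne. set (e := Cmod (boundary_fourier Kh n)) in *.
  destruct (small_factor (2 * (1 + M)) (Rmin 1 (Rmin d e))) as [r [[Hr0 _] Hr]];
    [lra|repeat apply Rmin_glb_lt; lra|].
  assert (Hr' := Rle_trans _ _ _ Hr (Rmin_r _ _)).
  assert (HrM : 0 < r * M) by (apply Rmult_lt_0_compat; lra).
  assert (Hr1 : r <= 1 / 2) by (assert (Hm := Rle_trans _ _ _ Hr (Rmin_l _ _)); lra).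
  assert (Hr2 : r <= d / 2) by (assert (Hm := Rle_trans _ _ _ Hr' (Rmin_l _ _)); lra).
  assert (Hr4 : r * M <= e / 2) by (assert (Hm := Rle_trans _ _ _ Hr' (Rmin_r _ _)); lra).
  assert (He : e <= exp (- IZR n * ln r) * M).
  { unfold e. rewrite <- (HS r) by lra. rewrite Cmod_mult, Cmod_R.
    rewrite Rabs_pos_eq by (left; apply exp_pos).
    apply Rmult_le_compat_l; [left; apply exp_pos|].
    apply fourier_bound.
    - apply continuous_on_disc_circle; auto; lra.
    - intros t _.
      assert (Hm : Cmod (r * cis t) = r) by (apply Cmod_polar; lra).
      rewrite HKe by (unfold unit_disc; lra). apply Hb. lra. }
  (* Since $-n\ge1$ and $\ln r<0$, the exponent is at most $\ln r$. *)
  assert (Hexp : exp (- IZR n * ln r) <= r).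
  { rewrite <- (exp_ln r) at 2 by auto.
    assert (Hln : ln r < 0) by (rewrite <- ln_1; apply ln_increasing; lra).
    assert (HnR : IZR n <= -1) by (apply IZR_le; lia).
    destruct (Req_dec (- IZR n * ln r) (ln r)) as [E|E]; [rewrite E; lra|].
    left. apply exp_increasing. nra. }
  assert (exp (- IZR n * ln r) * M <= r * M) by (apply Rmult_le_compat_r; lra). lra.
Qed.

Lemma exp_INR_ln (k : nat) (r : R) : 0 < r -> exp (INR k * ln r) = r ^ k.
Proof. intros Hr. rewrite <- Rpower_pow by auto. reflexivity. Qed.

(** On the circle of radius $r=|z|$ the coefficient of frequency $k\ge0$ is $a_kr^k$ and those of
    negative frequency vanish. Fourier inversion at the angle of [z] is therefore the power series
    at [z]. *)
Lemma disc_taylor (K K1 Kh K1h : C -> C) :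
  C1_closed_disc K K1 Kh K1h ->
  forall z, unit_disc z -> is_Cseries (fun k => boundary_fourier Kh (Z.of_nat k) * z ^ k)%C (K z).
Proof.
  intros HC. pose proof HC as [HK [HKc [HKe [HK1c HK1e]]]].
  assert (HS : forall (k : nat) r, 0 < r < 1 ->
    fourier (fun t => Kh (r * cis t)%C) (Z.of_nat k) = (boundary_fourier Kh (Z.of_nat k) * RtoC r ^ k)%C).
  { intros k r Hr.
    rewrite <- (fourier_circle_scaling K K1 Kh K1h (Z.of_nat k) HC r Hr).
    rewrite <- RtoC_pow, <- exp_INR_ln, INR_IZR_INZ by lra.
    match goal with |- ?X = (RtoC ?a * ?X * RtoC ?b)%C => transitivity (RtoC (a * b) * X)%C end.
    - rewrite <- exp_plus. replace (- IZR (Z.of_nat k) * ln r + IZR (Z.of_nat k) * ln r) with 0 by ring.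
      rewrite exp_0. ring.
    - rewrite RtoC_mult. ring. }
  assert (HN : forall (n : Z) r, 0 < r < 1 -> (n < 0)%Z -> fourier (fun t => Kh (r * cis t)%C) n = 0%C).
  { intros n r Hr Hn.
    assert (H := fourier_circle_scaling K K1 Kh K1h n HC r Hr).
    rewrite (boundary_fourier_negative K K1 Kh K1h n) in H by auto.
    apply Cmult_reg_r with (RtoC (exp (- IZR n * ln r))).
    - intros E. apply RtoC_inj in E. assert (P := exp_pos (- IZR n * ln r)). lra.
    - rewrite Cmult_comm, H. ring. }
  intros z Hz.
  destruct (classic (z = 0%C)) as [->|Hz0].
  (* The centre lies on no circle of positive radius. There only the constant term counts, and it is
     the mean of [K] over arbitrarily small circles. *)
  - assert (E : boundary_fourier Kh 0 = K 0%C).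
    { apply NNPP. intros Hne.
      assert (Hp : 0 < Cmod (boundary_fourier Kh 0 - K 0)) by (apply Cmod_gt_0; apply Cminus_eq_contra; auto).
      set (e := Cmod (boundary_fourier Kh 0 - K 0)) in *.
      destruct (is_Cderive_continuous _ _ _ (HK 0%C Hz) (e / 2)) as [d [Hd H]]; [lra|].
      set (r := Rmin (1 / 2) (d / 2)).
      assert (Hr0 : 0 < r) by (apply Rmin_glb_lt; lra).
      assert (Hr1 : r <= 1 / 2) by apply Rmin_l. assert (Hr2 : r <= d / 2) by apply Rmin_r.
      assert (Hb : e <= e / 2); [|lra].
      assert (E0 := HS 0%nat r ltac:(lra)). simpl Z.of_nat in E0.
      unfold e at 1. replace (boundary_fourier Kh 0) with (fourier (fun t => Kh (r * cis t)%C) 0)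
        by (rewrite E0; simpl; ring).
      assert (Ec := fourier_const (K 0%C) 0). simpl in Ec. rewrite <- Ec.
      assert (C1 : forall t, continuous (fun t => Kh (r * cis t)%C) t) by (apply continuous_on_disc_circle; auto; lra).
      rewrite <- (fourier_minus (fun t => Kh (r * cis t)%C) (fun _ => K 0%C)) by (auto; intros; apply continuous_const).
      apply fourier_bound.
      - intros t. apply continuous_Cminus; auto. apply continuous_const.
      - intros t _.
        assert (Hm : Cmod (r * cis t) = r) by (apply Cmod_polar; lra).
        rewrite HKe by (unfold unit_disc; lra). left. apply H.
        replace (r * cis t - 0)%C with (r * cis t)%C by ring. lra. }
    rewrite <- E. exact (is_Cseries_at_0 (fun k => boundary_fourier Kh (Z.of_nat k))).
  - destruct (polar_form z) as [t0 [_ Ht0]]. set (r := Cmod z) in *.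
    assert (Hr : 0 < r < 1) by (split; [apply Cmod_gt_0; auto|exact Hz]).
    assert (Hdisc : forall t, unit_disc (r * cis t)).
    { intros t. unfold unit_disc. rewrite Cmod_polar; lra. }
    assert (Hper : periodic (fun t => Kh (r * cis t)%C)).
    { intros t. now rewrite cis_plus, cis_2PI, Cmult_1_r. }
    intros e He.
    destruct (fourier_inversion (fun t => Kh (r * cis t)%C)
      (fun t => K1h (r * cis t) * (r * (Ci * cis t)))%C t0 e) as [N0 HN0]; auto.
    + intros t. exact (is_Rderive_on_circle K K1 Kh K1h r t HK HKe HK1e Hr).
    + intros t. apply (continuous_Cmult (fun t => K1h (r * cis t)%C)).
      * apply continuous_on_disc_circle; auto; lra.
      * apply (continuous_Cmult (fun _ => RtoC r)); [apply continuous_const|].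
        apply (continuous_Cmult (fun _ => Ci)); [apply continuous_const|apply continuous_cis].
    + intros t. now rewrite cis_plus, cis_2PI, Cmult_1_r.
    + exists N0. intros N HN'. specialize (HN0 N HN').
      rewrite HKe, <- Ht0 in HN0 by auto.
      replace (sum_n (fun k => boundary_fourier Kh (Z.of_nat k) * z ^ k)%C N) with
        (sum_n (fun k => fourier (fun t => Kh (r * cis t)%C) (Z.of_nat k) * cis (INR k * t0))%C N
         + sum_n (fun k => fourier (fun t => Kh (r * cis t)%C) (- Z.of_nat (S k)) * cis (- INR (S k) * t0))%C N)%C;
        [exact HN0|].
      clear HN0 HN'. induction N as [|N IH].
      * rewrite !sum_O, HS, HN by (auto; lia). simpl. rewrite Rmult_0_l, cis_0. ring.
      * rewrite !sum_Sn, <- IH. rewrite HS, HN by (auto; lia).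
        rewrite Ht0. rewrite Cpow_mult_l, cis_INR.
        change (@plus C_AbelianMonoid) with Cplus. ring.
Qed.

(** Writing $r=s^2$, one factor $s^n$ serves the induction and the other absorbs a single $n+1$: by
    Bernoulli, $s^n(1+nx)\le1$ with $x=1/s-1$. *)
Lemma geometric_times_power_bounded (k : nat) (r : R) :
  0 < r < 1 -> exists M, forall n, r ^ n * (INR n + 1) ^ k <= M.
Proof.
  revert r. induction k as [|k IH]; intros r Hr.
  - exists 1. intros n. simpl. rewrite Rmult_1_r, <- (pow1 n). apply pow_incr. lra.
  - set (s := sqrt r).
    assert (Hs0 : 0 < s) by (apply sqrt_lt_R0; lra).
    assert (Hss : s * s = r) by (apply sqrt_sqrt; lra).
    assert (Hs1 : s < 1) by nra.
    destruct (IH s ltac:(lra)) as [M HM].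
    set (x := / s - 1).
    assert (Hx : 0 < x).
    { unfold x. assert (H : 1 < / s) by (rewrite <- Rinv_1; apply Rinv_lt_contravar; lra). lra. }
    assert (Hb : forall n, s ^ n * (INR n + 1) <= 1 + / x).
    { intros n. assert (H := poly n x Hx). assert (Hn := pos_INR n).
      replace (1 + x) with (/ s) in H by (unfold x; ring). rewrite pow_inv in H.
      assert (Hp : 0 < s ^ n) by (apply pow_lt; auto).
      assert (Hix : 0 < / x) by (apply Rinv_0_lt_compat; auto).
      assert (Hxx : x * / x = 1) by (apply Rinv_r; lra).
      assert (H1 : s ^ n * (1 + INR n * x) <= 1).
      { apply Rle_trans with (s ^ n * / s ^ n); [apply Rmult_le_compat_l; lra|]. rewrite Rinv_r; lra. }
      apply Rle_trans with (s ^ n * ((1 + INR n * x) * (1 + / x))).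
      - apply Rmult_le_compat_l; [lra|].
        replace ((1 + INR n * x) * (1 + / x)) with (1 + INR n * x + / x + INR n * (x * / x)) by ring.
        rewrite Hxx. assert (0 <= INR n * x) by (apply Rmult_le_pos; lra). lra.
      - rewrite <- Rmult_assoc. rewrite <- (Rmult_1_l (1 + / x)) at 2.
        apply Rmult_le_compat_r; lra. }
    exists (M * (1 + / x)). intros n.
    rewrite <- Hss, Rpow_mult_distr. simpl pow at 3.
    replace (s ^ n * s ^ n * ((INR n + 1) * (INR n + 1) ^ k))
      with ((s ^ n * (INR n + 1) ^ k) * (s ^ n * (INR n + 1))) by ring.
    assert (Hn := pos_INR n).
    assert (0 <= s ^ n) by (apply pow_le; lra).
    assert (0 <= (INR n + 1) ^ k) by (apply pow_le; lra).
    apply Rmult_le_compat; auto; apply Rmult_le_pos; lra.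
Qed.

(** The Taylor coefficients are only known to be bounded. Rescaled to radius $r=(1+|z_0|)/2$,
    strictly between $|z_0|$ and 1, they decay geometrically and so are [rapid]; near [z0] the
    function is a power series in $z/r$ that can be differentiated twice. *)
Lemma disc_derivative_holomorphic (K K1 : C -> C) :
  (forall z, unit_disc z -> is_Cderive K z (K1 z)) ->
  extends_continuously unit_disc K -> extends_continuously unit_disc K1 ->
  holomorphic unit_disc K1.
Proof.
  intros HK HKx HK1x z0 Hz0. assert (HC := C1_closed_disc_bdval K K1 HK HKx HK1x).
  assert (HT := disc_taylor _ _ _ _ HC). destruct HC as [_ [HKc _]].
  set (Kh := bdval unit_disc K) in *.
  set (A := fun k => boundary_fourier Kh (Z.of_nat k)) in *.
  assert (HPI := PI_RGT_0).
  assert (Hc := continuous_on_disc_unit_circle Kh HKc).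
  destruct (continuous_bounded (fun t => Kh (cis t)) 0 (2 * PI)) as [M HM]; [lra|auto|].
  assert (HA : forall k, Cmod (A k) <= M) by (intros k; exact (fourier_bound (fun t => Kh (cis t)) (Z.of_nat k) M Hc HM)).
  unfold unit_disc in Hz0. assert (Hz00 := Cmod_ge_0 z0).
  set (r := (1 + Cmod z0) / 2). assert (Hr : 0 < r < 1) by (unfold r; lra).
  assert (Hr0 : RtoC r <> 0%C) by (intros E; apply RtoC_inj in E; lra).
  set (c := fun k => (A k * RtoC r ^ k)%C).
  assert (Hrap : rapid c).
  { intros k. destruct (geometric_times_power_bounded k r Hr) as [B HB].
    exists (M * B). intros n. unfold c. rewrite Cmod_mult, Cmod_pow, Cmod_R, Rabs_pos_eq by lra.
    rewrite Rmult_assoc. assert (Hn := pos_INR n).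
    apply Rmult_le_compat; auto; [apply Cmod_ge_0|].
    apply Rmult_le_pos; apply pow_le; lra. }
  set (D := fun z => Cmod z < r).
  assert (HDopen : open D).
  { intros z Hz. apply locally_Cmod. unfold D in *. exists (r - Cmod z). split; [lra|].
    intros w Hw. assert (H := Cmod_triangle_rev w z). lra. }
  assert (HDz0 : D z0) by (unfold D, r; lra).
  assert (Hin : forall z, D z -> unit_disc (/ r * z)).
  { intros z Hz. unfold D, unit_disc in *. rewrite Cmod_mult, Cmod_inv, Cmod_R, Rabs_pos_eq by (auto; lra).
    apply Rmult_lt_reg_l with r; [lra|]. rewrite <- Rmult_assoc, Rinv_r; lra. }
  assert (Hlin : forall z, is_Cderive (fun z => / r * z)%C z (/ r)%C).
  { intros z.
    assert (Hm := is_Cderive_mult (fun _ => / r)%C (fun z => z) z _ _ (is_Cderive_const _ z) (is_Cderive_id z)).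
    refine (eq_ind _ (is_Cderive _ z) Hm _ _). ring. }
  assert (HKD : forall z, D z -> K z = power_series c (/ r * z)).
  { intros z Hz. assert (Hz1 : unit_disc z) by (unfold D, unit_disc in *; lra).
    apply is_Cseries_unique with (1 := HT z Hz1).
    assert (Hz2 := Hin z Hz). unfold unit_disc in Hz2.
    apply is_Cseries_ext with (2 := is_Cseries_power_series c (/ r * z) Hrap ltac:(lra)).
    intros n. unfold c. rewrite <- Cmult_assoc, <- Cpow_mult_l. f_equal. f_equal. field. auto. }
  set (c1 := fun n => (INR (S n) * c (S n))%C).
  assert (HK1D : forall z, D z -> K1 z = (power_series c1 (/ r * z) * / r)%C).
  { intros z Hz. assert (Hz1 : unit_disc z) by (unfold D, unit_disc in *; lra).
    apply is_Cderive_unique with (1 := HK z Hz1).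
    apply is_Cderive_ext_loc with (fun z => power_series c (/ r * z)) D; auto.
    - intros w Hw. symmetry. auto.
    - apply (is_Cderive_comp (power_series c) (fun z => / r * z)%C); [|apply Hlin].
      apply power_series_is_Cderive; auto. }
  exists ((power_series (fun n => INR (S n) * c1 (S n)) (/ r * z0) * / r) * / r +
     power_series c1 (/ r * z0) * 0)%C.
  apply is_Cderive_ext_loc with (fun z => power_series c1 (/ r * z) * / r)%C D; auto.
  - intros w Hw. symmetry. auto.
  - apply (is_Cderive_mult (fun z => power_series c1 (/ r * z)) (fun _ => / r)%C); [|apply is_Cderive_const].
    apply (is_Cderive_comp (power_series c1) (fun z => / r * z)%C); [|apply Hlin].
    apply power_series_is_Cderive; auto. apply rapid_shift; auto.
Qed.

(** Holomorphy passes from each iterate of [C_derive] to the next by [disc_derivative_holomorphic],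
    so that the iterates are genuine complex derivatives. *)
Lemma A_infty_disc_smooth_upto (f : C -> C) (n : nat) :
  A_infty unit_disc f -> smooth_upto unit_disc n f.
Proof.
  intros [Hf Hext].
  assert (Hd : forall l z, unit_disc z ->
    is_Cderive (C_derive_n f l) z (C_derive_n f (S l) z)).
  { induction l as [|l IH]; intros z Hz.
    - apply C_derive_correct; [exact z|]. apply Hf; auto.
    - apply C_derive_correct; [exact z|].
      apply (disc_derivative_holomorphic (C_derive_n f l) (C_derive_n f (S l))); auto. }
  assert (H : forall n l, smooth_upto unit_disc n (C_derive_n f l)).
  { induction n0 as [|n0 IH]; intros l; [apply Hext|].
    split; [apply Hext|]. exists (C_derive_n f (S l)). auto. }
  apply (H n 0%nat).
Qed.

(** * Uniqueness of the decomposition in the disc *)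

Lemma Cint_conj (f : R -> C) (a b : R) :
  (forall t, continuous f t) -> Cint (fun t => Cconj (f t)) a b = Cconj (Cint f a b).
Proof.
  intros Hf. apply Cint_unique.
  assert (H := is_RInt_Cint f a b Hf).
  apply (@is_RInt_fct_extend_pair R_NormedModule R_NormedModule).
  - apply (@is_RInt_fct_extend_fst R_NormedModule R_NormedModule f a b _ H).
  - apply (@is_RInt_opp R_NormedModule).
    apply (@is_RInt_fct_extend_snd R_NormedModule R_NormedModule f a b _ H).
Qed.

Lemma fourier_conj (U : R -> C) (n : Z) :
  (forall t, continuous U t) -> fourier (fun t => Cconj (U t)) n = Cconj (fourier U (- n)).
Proof.
  intros HU. unfold fourier. rewrite Cmult_conj, Cinv_conj by apply RtoC_2PI_nonzero.
  rewrite <- Cint_conj by (apply continuous_fourier_integrand; auto). f_equal.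
  - f_equal. rewrite <- RtoC_mult. unfold Cconj, RtoC; simpl. f_equal. ring.
  - apply Cint_ext. intros t. rewrite Cmult_conj, opp_IZR, <- cis_opp. f_equal. f_equal. ring.
Qed.

Lemma disc_conj_decomposition_unique (G H : C -> C) :
  smooth_upto unit_disc 1 G -> smooth_upto unit_disc 1 H ->
  (forall z, unit_circle z -> (bdval unit_disc G z + Cconj (bdval unit_disc H z))%C = 0%C) ->
  H 0%C = 0%C -> forall z, unit_disc z -> G z = 0%C /\ H z = 0%C.
Proof.
  intros [HG [G1 [HG1 HG2]]] [HH [H1 [HH1 HH2]]] Hbd H0.
  assert (CG := C1_closed_disc_bdval G G1 HG1 HG HG2).
  assert (CH := C1_closed_disc_bdval H H1 HH1 HH HH2).
  assert (TG := disc_taylor _ _ _ _ CG). assert (TH := disc_taylor _ _ _ _ CH).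
  assert (NG := fun n => boundary_fourier_negative _ _ _ _ n CG).
  assert (NH := fun n => boundary_fourier_negative _ _ _ _ n CH).
  destruct CG as [_ [HGc _]]. destruct CH as [_ [HHc _]].
  set (Gh := bdval unit_disc G) in *. set (Hh := bdval unit_disc H) in *.
  assert (Hcirc := continuous_on_disc_unit_circle).
  (* Conjugation reverses frequencies: the index [n] of one function is tied to [- n] of the other,
     and for $n\neq0$ one of the two is negative, where the coefficient vanishes. *)
  assert (Hrel : forall n, boundary_fourier Gh n = (-1 * Cconj (boundary_fourier Hh (- n)))%C).
  { intros n. unfold boundary_fourier. rewrite <- fourier_conj by auto.
    rewrite <- fourier_scal.
    - apply fourier_ext. intros t. specialize (Hbd (cis t) (Cmod_cis t)).
      transitivity (Gh (cis t) - (Gh (cis t) + Cconj (Hh (cis t))))%C; [rewrite Hbd; ring|ring].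
    - intros t. apply continuous_C_eps. intros e He.
      destruct (proj1 (continuous_C_eps _ _) (Hcirc Hh HHc t) e He) as [d [Hd K]].
      exists d. split; auto. intros s Hs. rewrite <- Cminus_conj, Cmod_conj. auto. }
  assert (Hz0 : forall a : nat -> C, (forall k, a k = 0%C) -> is_Cseries a 0%C).
  { intros a Ha e He. exists 0%nat. intros N _.
    replace (sum_n a N) with (RtoC 0).
    - replace (0 - 0)%C with (RtoC 0) by ring. rewrite Cmod_0. auto.
    - induction N as [|N IH]; [rewrite sum_O; auto|]. rewrite sum_Sn, <- IH, Ha.
      symmetry. apply Cplus_0_l. }
  (* At frequency 0 the relation leaves a common constant free; the normalization of [H] at the
     centre fixes it. *)
  assert (HH0 : boundary_fourier Hh 0 = 0%C).
  { assert (D0 : unit_disc 0) by (unfold unit_disc; rewrite Cmod_0; lra).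
    rewrite <- H0. apply is_Cseries_unique with (2 := TH 0%C D0).
    exact (is_Cseries_at_0 (fun k => boundary_fourier Hh (Z.of_nat k))). }
  assert (HG0 : forall k : nat, boundary_fourier Gh (Z.of_nat k) = 0%C).
  { intros k. rewrite Hrel. destruct k as [|k].
    - simpl. rewrite HH0. unfold Cconj; simpl. rewrite Ropp_0. change (-1 * 0 = 0)%C. ring.
    - rewrite NH by lia. unfold Cconj; simpl. rewrite Ropp_0. change (-1 * 0 = 0)%C. ring. }
  assert (HHk : forall k : nat, boundary_fourier Hh (Z.of_nat k) = 0%C).
  { intros [|k]; [exact HH0|].
    assert (E := Hrel (- Z.of_nat (S k))%Z). rewrite NG, Z.opp_involutive in E by lia.
    rewrite <- (Cconj_conj (boundary_fourier Hh (Z.of_nat (S k)))).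
    replace (Cconj (boundary_fourier Hh (Z.of_nat (S k)))) with (RtoC 0).
    - unfold Cconj, RtoC; simpl. f_equal. ring.
    - transitivity (-1 * (-1 * Cconj (boundary_fourier Hh (Z.of_nat (S k)))))%C; [rewrite <- E; ring|ring]. }
  intros z Hz. split.
  - apply is_Cseries_unique with (1 := TG z Hz). apply Hz0. intros k. rewrite HG0. ring.
  - apply is_Cseries_unique with (1 := TH z Hz). apply Hz0. intros k. rewrite HHk. ring.
Qed.

(** * Injectivity on the circle *)

Definition injective_on (f : R -> R) (a b : R) : Prop :=
  forall s t, a <= s <= b -> a <= t <= b -> f s = f t -> s = t.

(** Near such a maximum [f] would be strictly smaller on both sides. The larger of $f(x-h)$ and
    $f(x+h)$ would then also be attained on the opposite side of [x], against local injectivity. *)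
Lemma no_interior_maximum (f : R -> R) (a b x d : R) :
  a < x < b -> 0 < d -> (forall t, a <= t <= b -> continuous f t) ->
  (forall s t, a <= s <= b -> a <= t <= b -> Rabs (s - x) < d -> Rabs (t - x) < d -> f s = f t -> s = t) ->
  ~ (forall t, a <= t <= b -> f t <= f x).
Proof.
  intros Hx Hd Hf Hinj Hmax.
  set (h := Rmin (d / 2) (Rmin (x - a) (b - x))).
  assert (h1 : h <= d / 2) by apply Rmin_l.
  assert (h2 : h <= x - a) by (eapply Rle_trans; [apply Rmin_r|apply Rmin_l]).
  assert (h3 : h <= b - x) by (eapply Rle_trans; [apply Rmin_r|apply Rmin_r]).
  assert (h0 : 0 < h) by (repeat apply Rmin_glb_lt; lra).
  assert (Hnear : forall t, x - h <= t <= x + h -> Rabs (t - x) < d).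
  { intros t Ht. apply Rabs_def1; lra. }
  assert (Hlt : forall t, x - h <= t <= x + h -> t <> x -> f t < f x).
  { intros t Ht Htx. destruct (Hmax t ltac:(lra)) as [|E]; auto.
    exfalso. apply Htx. apply Hinj; auto; try lra; apply Hnear; lra. }
  assert (Hp := Hlt (x - h) ltac:(lra) ltac:(lra)). assert (Hq := Hlt (x + h) ltac:(lra) ltac:(lra)).
  destruct (Rtotal_order (f (x - h)) (f (x + h))) as [H|[H|H]].
  - destruct (IVT_between f (x - h) x (f (x + h))) as [c [Hc1 Hc2]]; [lra| |lra|].
    + intros t Ht. apply Hf. lra.
    + assert (c = x + h); [|lra]. apply Hinj; auto; try lra; apply Hnear; lra.
  - assert (x - h = x + h); [|lra]. apply Hinj; auto; try lra; apply Hnear; lra.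
  - destruct (IVT_between f x (x + h) (f (x - h))) as [c [Hc1 Hc2]]; [lra| |lra|].
    + intros t Ht. apply Hf. lra.
    + assert (c = x - h); [|lra]. apply Hinj; auto; try lra; apply Hnear; lra.
Qed.

(** If $f(s)=f(t)$ with $s<t$, neither extremum over $[s,t]$ can lie inside. Both are then attained
    at the ends, so [f] is constant there, which contradicts injectivity near the midpoint. *)
Lemma continuous_locally_injective_injective (f : R -> R) (a b : R) :
  (forall t, a <= t <= b -> continuous f t) ->
  (forall x, a < x < b -> exists d, 0 < d /\ forall s t, a <= s <= b -> a <= t <= b ->
     Rabs (s - x) < d -> Rabs (t - x) < d -> f s = f t -> s = t) ->
  injective_on f a b.
Proof.
  intros Hf Hloc.
  assert (Hlt : forall s t, a <= s -> s < t -> t <= b -> f s <> f t).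
  { intros s t Hs Hst Ht E.
    assert (Hc : forall x, s <= x <= t -> continuity_pt f x).
    { intros x Hx. apply continuity_pt_filterlim. apply Hf. lra. }
    destruct (continuity_ab_maj f s t ltac:(lra) Hc) as [M [HM HMi]].
    destruct (continuity_ab_min f s t ltac:(lra) Hc) as [m [Hm Hmi]].
    destruct (classic (s < M < t)) as [HMin|HMout].
    - destruct (Hloc M ltac:(lra)) as [d [Hd Hinj]].
      apply (no_interior_maximum f s t M d); auto.
      + intros x Hx. apply Hf. lra.
      + intros x y Hx Hy. apply Hinj; lra.
    - destruct (classic (s < m < t)) as [Hmin|Hmout].
      + destruct (Hloc m ltac:(lra)) as [d [Hd Hinj]].
        apply (no_interior_maximum (fun x => - f x) s t m d); auto.
        * intros x Hx. apply (continuous_opp (V := R_NormedModule)). apply Hf. lra.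
        * intros x y Hx Hy Hxm Hym Exy. apply Hinj; lra.
        * intros x Hx. specialize (Hm x Hx). lra.
      + assert (EM : f M = f s) by (assert (M = s \/ M = t) as [-> | ->] by lra; auto).
        assert (Em : f m = f s) by (assert (m = s \/ m = t) as [-> | ->] by lra; auto).
        destruct (Hloc ((s + t) / 2) ltac:(lra)) as [d [Hd Hinj]].
        assert (Hd1 := Rmin_l (d / 2) ((t - s) / 2)). assert (Hd2 := Rmin_r (d / 2) ((t - s) / 2)).
        assert (Hd0 : 0 < Rmin (d / 2) ((t - s) / 2)) by (apply Rmin_glb_lt; lra).
        set (x := (s + t) / 2) in *. set (y := x + Rmin (d / 2) ((t - s) / 2)).
        assert (Hx : s <= x <= t) by (unfold x; lra).
        assert (Hy : s <= y <= t) by (unfold y, x; lra).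
        assert (x = y); [|unfold y in *; lra].
        assert (HMx := HM x Hx). assert (HMy := HM y Hy).
        assert (Hmx := Hm x Hx). assert (Hmy := Hm y Hy).
        apply Hinj; try lra.
        * rewrite Rminus_diag, Rabs_R0. auto.
        * unfold y. apply Rabs_def1; lra. }
  intros s t Hs Ht E. destruct (Rtotal_order s t) as [H|[H|H]]; auto; exfalso.
  - apply (Hlt s t); auto; lra.
  - apply (Hlt t s); auto; lra.
Qed.

(** The part of strict monotonicity that is needed: comparison with the end values. Any other order
    would, by the intermediate value theorem, make [f] repeat an end value. *)
Lemma injective_between (f : R -> R) (a b t : R) :
  (forall t, a <= t <= b -> continuous f t) -> injective_on f a b -> a < t < b ->
  f a < f t < f b \/ f b < f t < f a.
Proof.
  intros Hf Hinj Ht.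
  assert (Hab : f a <> f b) by (intros E; apply Hinj in E; lra).
  assert (Hat : f a <> f t) by (intros E; apply Hinj in E; lra).
  assert (Htb : f t <> f b) by (intros E; apply Hinj in E; lra).
  assert (H1 : ~ (f t < f a < f b \/ f b < f a < f t)).
  { intros H. destruct (IVT_between f t b (f a)) as [c [Hc1 Hc2]]; [lra| |lra|].
    - intros s Hs. apply Hf. lra.
    - apply Hinj in Hc2; lra. }
  assert (H2 : ~ (f a < f b < f t \/ f t < f b < f a)).
  { intros H. destruct (IVT_between f a t (f b)) as [c [Hc1 Hc2]]; [lra| |lra|].
    - intros s Hs. apply Hf. lra.
    - apply Hinj in Hc2; lra. }
  lra.
Qed.

(** The values of [theta] lie between its end values, which are $2\pi$ apart. Apart from the pair of
    end parameters, two values differ by less than $2\pi$, so if they are congruent they are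
    equal. *)
Lemma unit_degree_lift_injective (theta : R -> R) (s t : R) :
  (forall t, 0 <= t <= 2 * PI -> continuous theta t) -> injective_on theta 0 (2 * PI) ->
  Rabs (theta (2 * PI) - theta 0) = 2 * PI ->
  0 <= s <= 2 * PI -> 0 <= t <= 2 * PI -> cis (theta s) = cis (theta t) -> cis s = cis t.
Proof.
  intros Hc Hinj Hdeg. assert (HPI := PI_RGT_0).
  assert (Hwlog : forall s t, 0 <= s -> s < t -> t <= 2 * PI ->
     cis (theta s) = cis (theta t) -> cis s = cis t).
  { clear s t. intros s t Hs Hst Ht E.
    apply cis_eq_inv in E. destruct E as [k Hk].
    assert (Hend : forall x, 0 <= x <= 2 * PI -> x = 0 \/ x = 2 * PI \/
      theta 0 < theta x < theta (2 * PI) \/ theta (2 * PI) < theta x < theta 0).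
    { intros x Hx. destruct (classic (0 < x < 2 * PI)) as [H|H].
      - right. right. apply injective_between; auto.
      - lra. }
    destruct (classic (s = 0 /\ t = 2 * PI)) as [[-> ->]|Hn].
    - now rewrite cis_2PI, cis_0.
    - exfalso.
      assert (Hlt : - (2 * PI) < theta s - theta t < 2 * PI).
      { assert (Hcase : theta (2 * PI) - theta 0 = 2 * PI \/ theta (2 * PI) - theta 0 = - (2 * PI)).
        { revert Hdeg. unfold Rabs. destruct (Rcase_abs _); lra. }
        destruct (Hend s ltac:(lra)) as [->|[->|Hs']]; [| lra |];
        destruct (Hend t ltac:(lra)) as [->|[->|Ht']]; try lra;
        exfalso; apply Hn; lra. }
      assert (Hk0 : k = 0%Z).
      { assert (-1 < k < 1)%Z; [|lia]. split; apply lt_IZR; nra. }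
      rewrite Hk0, Rmult_0_r in Hk. assert (s = t); [|lra]. apply Hinj; lra. }
  intros Hs Ht E. destruct (Rtotal_order s t) as [H|[H|H]].
  - apply Hwlog; auto; lra.
  - now subst.
  - symmetry. apply Hwlog; auto; lra.
Qed.

(* [c] winds an integer number [m] of times around [w0] per period, and [gamma], which
   runs [k] times through [c], winds once: hence [m * k = 1]. *)
Lemma lift_degree_unit (c gamma : R -> C) (w0 : C) (theta lambda : R -> R) (k : Z) :
  (forall s, continuous c s) -> periodic c -> (forall s, c s <> w0) ->
  (forall t, 0 <= t <= 2 * PI -> continuous theta t) -> injective_on theta 0 (2 * PI) ->
  theta (2 * PI) - theta 0 = 2 * PI * IZR k ->
  (forall t, 0 <= t <= 2 * PI -> gamma t = c (theta t)) ->
  (forall t, 0 <= t <= 2 * PI -> continuous lambda t) -> lambda 0 = lambda (2 * PI) ->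
  (forall t, 0 <= t <= 2 * PI -> (gamma t - w0)%C = (Cmod (gamma t - w0) * cis (t + lambda t))%C) ->
  Rabs (theta (2 * PI) - theta 0) = 2 * PI.
Proof.
  intros Hc Hper Hw Hth Hinj Hk Hgam Hlam Hlam0 Harg. assert (HPI := PI_RGT_0).
  (* The interval $[-M,M]$ contains the range of [theta], and the added $2\pi$ guarantees room for
     at least one full period. *)
  set (M := Rabs (theta 0) + Rabs (theta (2 * PI)) + 2 * PI).
  assert (A1 := Rle_abs (theta 0)). assert (A2 := Rle_abs (theta (2 * PI))).
  assert (A3 := Rle_abs (- theta 0)). assert (A4 := Rle_abs (- theta (2 * PI))).
  rewrite Rabs_Ropp in A3, A4.
  assert (A5 := Rabs_pos (theta 0)). assert (A6 := Rabs_pos (theta (2 * PI))).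
  assert (HthM : forall t, 0 <= t <= 2 * PI -> - M <= theta t <= M).
  { intros t Ht. destruct (classic (0 < t < 2 * PI)) as [H|H].
    - destruct (injective_between theta 0 (2 * PI) t) as [H'|H']; auto; unfold M; lra.
    - assert (t = 0 \/ t = 2 * PI) as [-> | ->] by lra; unfold M; lra. }
  destruct (argument_lift (fun x s => c (x * s)%R - w0)%C (- M) M) as [mu [Hmu _]].
  - apply (jointly_continuous_product (fun s => c s - w0)%C). intros s.
    apply continuous_Cminus; [apply Hc|apply continuous_const].
  - intros x s. apply Cminus_eq_contra. apply Hw.
  - intros s. now rewrite !Rmult_0_l.
  - simpl in Hmu.
    assert (Hmu' : forall s, - M <= s <= M -> continuous mu s /\ (c s - w0)%C = (Cmod (c s - w0) * cis (mu s))%C).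
    { intros s Hs. specialize (Hmu s Hs). rewrite Rmult_1_l in Hmu. exact Hmu. }
    assert (Hcancel : forall (v : C) x y, v <> 0%C -> v = (Cmod v * cis x)%C -> v = (Cmod v * cis y)%C ->
      exists j : Z, x - y = 2 * PI * IZR j).
    { intros v x y Hv Hx Hy. apply cis_eq_inv. apply Cmult_reg_r with (RtoC (Cmod v)).
      - intros E. apply RtoC_inj in E. apply Cmod_gt_0 in Hv. lra.
      - rewrite Cmult_comm, <- Hx, Cmult_comm. exact Hy. }
    (* Both [mu (theta t)] and [t + lambda t] are arguments of [gamma t - w0]. Their difference is
       constant, and [lambda] has equal end values. *)
    assert (H1 : mu (theta (2 * PI)) - mu (theta 0) = 2 * PI).
    { assert (H := discrete_continuous_constant (fun t => mu (theta t) - (t + lambda t)) 0 (2 * PI)).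
      assert (E : mu (theta 0) - (0 + lambda 0) = mu (theta (2 * PI)) - (2 * PI + lambda (2 * PI))); [|lra].
      apply H; [lra| |].
      - intros t Ht. apply (continuous_minus (V := R_NormedModule)).
        + apply (continuous_comp theta mu); [apply Hth; auto|]. apply Hmu'. apply HthM; auto.
        + apply (continuous_plus (V := R_NormedModule)); [apply continuous_id|apply Hlam; auto].
      - intros t Ht. apply (Hcancel (c (theta t) - w0)%C).
        + apply Cminus_eq_contra. apply Hw.
        + apply Hmu'. apply HthM; auto.
        + rewrite <- Hgam by auto. apply Harg; auto. }
    assert (H2 : forall s, - M <= s <= M - 2 * PI -> exists m : Z, mu (s + 2 * PI) - mu s = 2 * PI * IZR m).
    { intros s Hs. apply (Hcancel (c s - w0)%C).
      - apply Cminus_eq_contra. apply Hw.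
      - rewrite <- (Hper s). apply Hmu'. lra.
      - apply Hmu'. lra. }
    destruct (H2 (- M)) as [m Hm]; [unfold M; lra|].
    (* The increment of [mu] over a period is continuous with values in $2\pi\mathbb Z$, so the
       integer found at $-M$ serves everywhere. *)
    assert (H3 : forall s, - M <= s <= M - 2 * PI -> mu (s + 2 * PI) - mu s = 2 * PI * IZR m).
    { intros s Hs. rewrite <- Hm. symmetry.
      apply (discrete_continuous_constant (fun s => mu (s + 2 * PI) - mu s) (- M) s); [lra| |].
      - intros x Hx. apply (continuous_minus (V := R_NormedModule)).
        + apply (continuous_comp (fun s => s + 2 * PI) mu).
          * apply (continuous_plus (V := R_NormedModule)); [apply continuous_id|apply continuous_const].
          * apply Hmu'. lra.
        + apply Hmu'. lra.
      - intros x Hx. apply H2. lra. }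
    assert (H4 : forall (n : nat) s, - M <= s -> s + 2 * PI * INR n <= M ->
      mu (s + 2 * PI * INR n) - mu s = 2 * PI * IZR m * INR n).
    { induction n as [|n IH]; intros s Hs Hsn.
      - simpl. rewrite Rmult_0_r, Rplus_0_r. ring.
      - rewrite S_INR in *. assert (Hn := pos_INR n).
        assert (0 <= PI * INR n) by (apply Rmult_le_pos; lra).
        replace (s + 2 * PI * (INR n + 1)) with (s + 2 * PI * INR n + 2 * PI) by ring.
        assert (E1 := H3 (s + 2 * PI * INR n) ltac:(lra)). assert (E2 := IH s Hs ltac:(lra)). lra. }
    (* Periods are counted upwards from the smaller end value of [theta]; the sign of [k] decides
       which end that is. *)
    assert (Hmk : IZR m * IZR k = 1).
    { destruct (Z.le_gt_cases 0 k) as [Hk0|Hk0].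
      - assert (Hkn : INR (Z.to_nat k) = IZR k) by (rewrite INR_IZR_INZ, Z2Nat.id; auto).
        assert (E := H4 (Z.to_nat k) (theta 0) ltac:(apply HthM; lra)). rewrite Hkn in E.
        replace (theta 0 + 2 * PI * IZR k) with (theta (2 * PI)) in E by lra.
        rewrite H1 in E. specialize (E (proj2 (HthM (2 * PI) ltac:(lra)))).
        apply Rmult_eq_reg_l with (2 * PI); lra.
      - assert (Hkn : INR (Z.to_nat (- k)) = - IZR k) by (rewrite INR_IZR_INZ, Z2Nat.id, opp_IZR; auto; lia).
        assert (E := H4 (Z.to_nat (- k)) (theta (2 * PI)) ltac:(apply HthM; lra)). rewrite Hkn in E.
        replace (theta (2 * PI) + 2 * PI * - IZR k) with (theta 0) in E by lra.
        specialize (E (proj2 (HthM 0 ltac:(lra)))).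
        apply Rmult_eq_reg_l with (2 * PI); lra. }
    rewrite <- mult_IZR in Hmk. apply eq_IZR in Hmk.
    assert (Hk1 : (k | 1)%Z) by (exists m; auto).
    apply Z.divide_1_r in Hk1. rewrite Hk. destruct Hk1 as [-> | ->].
    + rewrite Rabs_pos_eq; lra.
    + change (- (1))%Z with (-1)%Z; rewrite Rabs_left; lra.
Qed.

(** * Boundary behaviour of the Riemann map *)

Lemma compact_dist_lower_bound (A : C -> Prop) (F : C -> C) (w : C) :
  compact_set A -> continuous_on A F -> (forall z, A z -> F z <> w) ->
  exists d, 0 < d /\ forall z, A z -> d <= Cmod (F z - w).
Proof.
  intros HA HF Hw. rewrite continuous_on_Cmod in HF.
  apply (compact_uniform A (fun z d => d <= Cmod (F z - w))); auto.
  - intros; lra.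
  - intros u Hu. set (m := Cmod (F u - w)).
    assert (Hm : 0 < m) by (apply Cmod_gt_0; apply Cminus_eq_contra; auto).
    destruct (HF u Hu (m / 2)) as [d [Hd H]]; [lra|].
    assert (H1 := Rmin_l d (m / 2)). assert (H2 := Rmin_r d (m / 2)).
    exists (Rmin d (m / 2)). split; [apply Rmin_glb_lt; lra|].
    intros z Hz Hzu. specialize (H z Hz ltac:(lra)).
    assert (T := Cmod_triangle_rev (F u - w) (F z - w)). fold m in T.
    replace (F u - w - (F z - w))%C with (F u - F z)%C in T by ring.
    rewrite (Cmod_sub_comm (F u) (F z)) in T. lra.
Qed.

(** Continuity of the inverse of a map on a compact set: the points of [A] at distance at least [e]
    from [z0] form a compact set on which [F] stays away from [F z0]. *)
Lemma compact_inverse_continuous (A : C -> Prop) (F : C -> C) (z0 : C) (e : R) :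
  compact_set A -> continuous_on A F -> (forall z, A z -> F z = F z0 -> z = z0) -> 0 < e ->
  exists d, 0 < d /\ forall z, A z -> Cmod (F z - F z0) < d -> Cmod (z - z0) < e.
Proof.
  intros [[M HM] HA] HF Hinj He.
  destruct (compact_dist_lower_bound (fun z => A z /\ e <= Cmod (z - z0)) F (F z0)) as [d [Hd H]].
  - split; [exists M; intros z [Hz _]; auto|].
    intros z Hz. destruct (classic (A z)) as [HAz|HAz].
    + assert (Hlt : Cmod (z - z0) < e) by (apply Rnot_le_lt; intros K; apply Hz; auto).
      exists (e - Cmod (z - z0)). split; [lra|]. intros w Hw [_ Hwe].
      assert (T := Cmod_triangle (w - z) (z - z0)).
      replace (w - z + (z - z0))%C with (w - z0)%C in T by ring. lra.
    + destruct (HA z HAz) as [d [Hd H]]. exists d. split; auto.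
      intros w Hw [Hw' _]. apply (H w); auto.
  - apply continuous_on_subset with (2 := HF). tauto.
  - intros z [Hz Hze] E. apply Hinj in E; auto. rewrite E in Hze.
    replace (z0 - z0)%C with (RtoC 0) in Hze by ring. rewrite Cmod_0 in Hze. lra.
  - exists d. split; auto. intros z Hz Hzd. apply Rnot_le_lt. intros K.
    assert (H' := H z (conj Hz K)). lra.
Qed.

Lemma Cmod_segment (z w : C) (s : R) :
  0 <= s <= 1 -> Cmod (z + s * (w - z)) <= (1 - s) * Cmod z + s * Cmod w.
Proof.
  intros Hs. replace (z + s * (w - z))%C with (RtoC (1 - s) * z + s * w)%C by (rewrite RtoC_minus; ring).
  eapply Rle_trans; [apply Cmod_triangle|]. rewrite !Cmod_mult, !Cmod_R, !Rabs_pos_eq; lra.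
Qed.

Lemma convex_combination_lt (a b c s : R) :
  a < c -> b < c -> 0 <= s <= 1 -> (1 - s) * a + s * b < c.
Proof.
  intros Ha Hb Hs. assert (H1 := Rmax_l a b). assert (H2 := Rmax_r a b).
  assert (H3 : Rmax a b < c) by (apply Rmax_lub_lt; auto).
  assert ((1 - s) * a <= (1 - s) * Rmax a b) by (apply Rmult_le_compat_l; lra).
  assert (s * b <= s * Rmax a b) by (apply Rmult_le_compat_l; lra). lra.
Qed.

(** Where [Phi1] is within $m/2$ of [Phi1 z0], the mean value inequality gives
    $|\Phi(z)-\Phi(w)|\ge\frac m2|z-w|$. The derivative is known only in the open disc, so the two
    points are first pulled inside radially, at a cost controlled by uniform continuity. *)
Lemma disc_extension_locally_injective (phi phi1 Phi Phi1 : C -> C) (z0 : C) :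
  C1_closed_disc phi phi1 Phi Phi1 ->
  Cmod z0 <= 1 -> Phi1 z0 <> 0%C ->
  exists d, 0 < d /\ forall z w, Cmod z <= 1 -> Cmod w <= 1 ->
    Cmod (z - z0) < d -> Cmod (w - z0) < d -> Phi z = Phi w -> z = w.
Proof.
  intros [Hd [Hc [He [H1c H1e]]]] Hz0 Hnz.
  set (m := Cmod (Phi1 z0)). assert (Hm : 0 < m) by (apply Cmod_gt_0; auto).
  rewrite continuous_on_Cmod in H1c.
  destruct (H1c z0 (proj2 (closure_unit_disc z0) Hz0) (m / 2)) as [d [Hd0 Hd1]]; [lra|].
  exists d. split; auto. intros z w Hz Hw Hzd Hwd E.
  apply NNPP. intros Hne.
  assert (Hp : 0 < Cmod (z - w)) by (apply Cmod_gt_0; apply Cminus_eq_contra; auto).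
  set (p := Cmod (z - w)) in *.
  (* Moving both points costs at most $mp/8$ in total, less than the lower bound $\frac m2rp\ge
     mp/4$ for $r\ge1/2$. *)
  destruct (disc_uniform_continuity Phi (m * p / 16)) as [h [Hh Hu]]; auto; [nra|].
  (* The terms ensure, in order, that $r\ge1/2$, that uniform continuity applies, and that each
     shrunk point stays within [d] of [z0]. *)
  set (x := Rmin (1 / 2) (Rmin (h / 2) (Rmin ((d - Cmod (z - z0)) / 2) ((d - Cmod (w - z0)) / 2)))).
  assert (Hx0 : 0 < x) by (repeat apply Rmin_glb_lt; lra).
  assert (Hx1 : x <= 1 / 2) by apply Rmin_l.
  assert (Hx' : x <= Rmin (h / 2) (Rmin ((d - Cmod (z - z0)) / 2) ((d - Cmod (w - z0)) / 2))) by apply Rmin_r.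
  assert (Hx2 : x <= h / 2) by (eapply Rle_trans; [exact Hx'|apply Rmin_l]).
  assert (Hx'' : x <= Rmin ((d - Cmod (z - z0)) / 2) ((d - Cmod (w - z0)) / 2)) by (eapply Rle_trans; [exact Hx'|apply Rmin_r]).
  assert (Hx3 : x <= (d - Cmod (z - z0)) / 2) by (eapply Rle_trans; [exact Hx''|apply Rmin_l]).
  assert (Hx4 : x <= (d - Cmod (w - z0)) / 2) by (eapply Rle_trans; [exact Hx''|apply Rmin_r]).
  set (r := 1 - x).
  assert (Hshrink : forall v, Cmod v <= 1 -> Cmod (r * v) < 1 /\ Cmod (r * v - v) <= x).
  { intros v Hv. assert (Hv0 := Cmod_ge_0 v). split.
    - rewrite Cmod_mult, Cmod_R, Rabs_pos_eq by (unfold r; lra). unfold r. nra.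
    - replace (r * v - v)%C with (RtoC (- x) * v)%C by (unfold r; rewrite RtoC_minus, RtoC_opp; ring).
      rewrite Cmod_mult, Cmod_R, Rabs_Ropp, Rabs_pos_eq by lra. nra. }
  destruct (Hshrink z Hz) as [Z1 Z2]. destruct (Hshrink w Hw) as [W1 W2].
  assert (Hnear : forall v, Cmod (r * v - v) <= x -> Cmod (v - z0) + x < d -> Cmod (r * v - z0) < d).
  { intros v Hv Hvd. replace (r * v - z0)%C with ((r * v - v) + (v - z0))%C by ring.
    eapply Rle_lt_trans; [apply Cmod_triangle|]. lra. }
  assert (Zd := Hnear z Z2 ltac:(lra)). assert (Wd := Hnear w W2 ltac:(lra)).
  assert (MV := Cderive_mean_value Phi Phi1 (Phi1 z0) (r * w)%C (r * z)%C (m / 2)).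
  assert (B1 : Cmod (Phi (r * z)%C - Phi (r * w)%C - Phi1 z0 * (r * z - r * w)) <= m / 2 * Cmod (r * z - r * w)).
  { apply MV. intros s Hs.
    assert (S1 := Cmod_segment (r * w) (r * z) s Hs).
    assert (S2 := Cmod_segment (r * w - z0) (r * z - z0) s Hs).
    replace (r * w - z0 + s * (r * z - z0 - (r * w - z0)))%C
      with (r * w + s * (r * z - r * w) - z0)%C in S2 by ring.
    assert (D1 : unit_disc (r * w + s * (r * z - r * w))) 
      by (eapply Rle_lt_trans; [exact S1|apply convex_combination_lt; auto]).
    split.
    - rewrite H1e by auto. apply is_Cderive_ext_loc with phi unit_disc; auto using open_unit_disc.
      intros v Hv. symmetry; auto.
    - left. apply Hd1; [apply subset_closure; auto|].
      eapply Rle_lt_trans; [exact S2|apply convex_combination_lt; auto]. }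
  assert (Hrp : Cmod (r * z - r * w) = r * p).
  { replace (r * z - r * w)%C with (r * (z - w))%C by ring.
    rewrite Cmod_mult, Cmod_R, Rabs_pos_eq; [reflexivity|unfold r; lra]. }
  assert (B2 : m * (r * p) - m / 2 * (r * p) <= Cmod (Phi (r * z)%C - Phi (r * w)%C)).
  { assert (T := Cmod_triangle_rev (Phi1 z0 * (r * z - r * w)) (Phi1 z0 * (r * z - r * w) - (Phi (r * z) - Phi (r * w)))%C).
    replace (Phi1 z0 * (r * z - r * w) - (Phi1 z0 * (r * z - r * w) - (Phi (r * z) - Phi (r * w))))%C
      with (Phi (r * z) - Phi (r * w))%C in T by ring.
    rewrite (Cmod_sub_comm (Phi1 z0 * (r * z - r * w))) in T.
    rewrite Cmod_mult, Hrp in T. fold m in T. rewrite Hrp in B1. lra. }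
  assert (U1 : Cmod (Phi (r * z)%C - Phi z) < m * p / 16) by (apply Hu; lra).
  assert (U2 : Cmod (Phi (r * w)%C - Phi w) < m * p / 16) by (apply Hu; lra).
  assert (B3 : Cmod (Phi (r * z)%C - Phi (r * w)%C) < m * p / 8).
  { replace (Phi (r * z) - Phi (r * w))%C with ((Phi (r * z) - Phi z) + (Phi w - Phi (r * w)))%C
      by (rewrite E; ring).
    eapply Rle_lt_trans; [apply Cmod_triangle|]. rewrite (Cmod_sub_comm (Phi w)). lra. }
  assert (Hr2 : 1 / 2 <= r) by (unfold r; lra).
  assert (0 < m * p) by (apply Rmult_lt_0_compat; auto). nra.
Qed.

(** Otherwise [psi] would be continuous at [Phi z], and $v=\psi(\phi(v))$ would tend to
    $\psi(\Phi(z))$ as $v\to z$. That limit lies in the open disc, whereas $|z|=1$. *)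
Lemma circle_image_outside (Omega : C -> Prop) (phi psi Phi : C -> C) (z : C) :
  holomorphic Omega psi -> (forall w, Omega w -> unit_disc (psi w)) ->
  (forall z, unit_disc z -> Omega (phi z)) -> (forall z, unit_disc z -> psi (phi z) = z) ->
  continuous_on (closure unit_disc) Phi -> (forall z, unit_disc z -> Phi z = phi z) ->
  unit_circle z -> ~ Omega (Phi z).
Proof.
  intros Hpsi Hpsid Hmap Hinv Hc He Hz HO.
  assert (Hd := Hpsid _ HO). unfold unit_disc, unit_circle in *.
  set (e := (1 - Cmod (psi (Phi z))) / 2).
  assert (He0 : 0 < e) by (unfold e; lra).
  destruct (Hpsi _ HO) as [l Hl].
  destruct (is_Cderive_continuous psi (Phi z) l Hl e He0) as [d [Hd0 H1]].
  rewrite continuous_on_Cmod in Hc.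
  assert (Hzc : closure unit_disc z) by (apply closure_unit_disc; lra).
  destruct (Hc z Hzc d Hd0) as [d' [Hd0' H2]].
  destruct (proj1 (closure_Cmod _ _) Hzc (Rmin d' e)) as [v [Hv Hvz]]; [apply Rmin_glb_lt; auto|].
  destruct (Rmin_Rgt_l _ _ _ Hvz) as [V1 V2].
  assert (H3 := H2 v (subset_closure _ _ Hv) V1). rewrite He in H3 by exact Hv.
  assert (H4 := H1 (phi v) H3). rewrite Hinv in H4 by exact Hv.
  assert (T1 := Cmod_triangle_rev z v). rewrite (Cmod_sub_comm z v) in T1.
  assert (T2 := Cmod_triangle_rev v (psi (Phi z))). unfold e in *. lra.
Qed.

(** The image of the closed disc is compact, hence closed, and it contains [Omega]. *)
Lemma closure_image (Omega : C -> Prop) (phi psi Phi : C -> C) (w : C) :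
  (forall w, Omega w -> unit_disc (psi w)) -> (forall w, Omega w -> phi (psi w) = w) ->
  continuous_on (closure unit_disc) Phi -> (forall z, unit_disc z -> Phi z = phi z) ->
  closure Omega w -> exists z, Cmod z <= 1 /\ Phi z = w.
Proof.
  intros Hpsid Hinv Hc He Hw. apply NNPP. intros Hn.
  destruct (compact_dist_lower_bound (fun z => Cmod z <= 1) Phi w compact_closed_disc) as [d [Hd H]].
  - apply continuous_on_subset with (2 := Hc). intros z Hz. apply closure_unit_disc; exact Hz.
  - intros z Hz E. apply Hn. exists z; auto.
  - destruct (proj1 (closure_Cmod _ _) Hw d Hd) as [v [Hv Hvw]].
    assert (Hdv := Hpsid v Hv). assert (K := H (psi v) (Rlt_le _ _ Hdv)).
    rewrite He, Hinv in K by assumption. lra.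
Qed.

Lemma boundary_image (Omega : C -> Prop) (phi psi Phi : C -> C) (w : C) :
  open Omega ->
  (forall z, unit_disc z -> Omega (phi z)) ->
  (forall w, Omega w -> unit_disc (psi w)) -> (forall w, Omega w -> phi (psi w) = w) ->
  continuous_on (closure unit_disc) Phi -> (forall z, unit_disc z -> Phi z = phi z) ->
  boundary Omega w -> exists z, unit_circle z /\ Phi z = w.
Proof.
  intros HO Hmap Hpsid Hinv Hc He [Hw1 Hw2].
  destruct (closure_image Omega phi psi Phi w) as [z [Hz E]]; try assumption.
  exists z. split; [|exact E]. unfold unit_circle.
  destruct (Rle_lt_or_eq_dec _ _ Hz) as [Hlt|]; [exfalso|assumption].
  rewrite He in E by exact Hlt. assert (HOw : Omega w) by (rewrite <- E; apply Hmap; exact Hlt).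
  destruct (open_Cmod Omega w HO HOw) as [d [Hd H]].
  destruct (proj1 (closure_Cmod _ _) Hw2 d Hd) as [v [Hv Hvw]]. apply Hv, H, Hvw.
Qed.

Lemma not_boundary_of_open (Omega : C -> Prop) (w : C) : open Omega -> Omega w -> ~ boundary Omega w.
Proof.
  intros HO Hw [_ Hb]. destruct (open_Cmod Omega w HO Hw) as [d [Hd H]].
  destruct (proj1 (closure_Cmod _ _) Hb d Hd) as [v [Hv Hvw]]. apply Hv, H, Hvw.
Qed.

(** The simple zero at the centre is divided out. On the circle the argument of [Phi - phi 0] is
    then [t] plus that of [q], and [q] can be contracted to the centre without meeting zero. *)
Lemma difference_quotient_extension (phi phi1 Phi : C -> C) :
  (forall z, unit_disc z -> is_Cderive phi z (phi1 z)) ->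
  continuous_on (closure unit_disc) Phi -> (forall z, unit_disc z -> Phi z = phi z) ->
  (forall z, Cmod z <= 1 -> z <> 0%C -> Phi z <> phi 0%C) -> phi1 0%C <> 0%C ->
  exists q : C -> C, continuous_on (closure unit_disc) q /\
    (forall z, Cmod z <= 1 -> q z <> 0%C) /\
    forall z, (Phi z - phi 0 = z * q z \/ z = 0)%C.
Proof.
  intros Hd Hc He Hne H1.
  assert (D0 : unit_disc 0) by (unfold unit_disc; rewrite Cmod_0; lra).
  exists (fun z => if Ceq_dec z 0 then phi1 0%C else (Phi z - phi 0%C) * / z)%C.
  split; [|split].
  - apply continuous_on_Cmod. intros z Hz e He0.
    destruct (Ceq_dec z 0) as [->|Hz0].
    + destruct (proj1 (is_Cderive_Cmod _ _ _) (Hd 0%C D0) (e / 2)) as [d [Hd0 H]]; [lra|].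
      exists (Rmin d 1). split; [apply Rmin_glb_lt; lra|]. intros w Hw Hwz.
      destruct (Rmin_Rgt_l _ _ _ Hwz) as [W1 W2].
      destruct (Ceq_dec w 0) as [->|Hw0].
      * replace (phi1 0 - phi1 0)%C with (RtoC 0) by ring. rewrite Cmod_0. exact He0.
      * assert (K := H w W1). replace (w - 0)%C with w in * by ring.
        rewrite He by exact W2.
        assert (Hp : 0 < Cmod w) by (apply Cmod_gt_0; exact Hw0).
        replace ((phi w - phi 0) * / w - phi1 0)%C with ((phi w - phi 0 - phi1 0 * w) * / w)%C
          by (field; exact Hw0).
        rewrite Cmod_mult, Cmod_inv by exact Hw0.
        apply Rle_lt_trans with (e / 2 * Cmod w * / Cmod w).
        -- apply Rmult_le_compat_r; [left; apply Rinv_0_lt_compat; exact Hp|exact K].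
        -- rewrite Rmult_assoc, Rinv_r by lra. lra.
    + assert (Hcz : continuous_on (fun z : C => closure unit_disc z /\ z <> 0%C) (fun z : C => (Phi z - phi 0%C) * / z)%C).
      { apply continuous_on_Cmult.
        - apply (continuous_on_Cplus _ Phi (fun _ => - phi 0)%C); [|apply continuous_on_const].
          apply continuous_on_subset with (2 := Hc). tauto.
        - apply continuous_on_Cmod. intros v [_ Hv] e' He'.
          destruct (is_Cderive_continuous _ _ _ (is_Cderive_inv v Hv) e' He') as [d [Hd0 H]].
          exists d. split; auto. }
      rewrite continuous_on_Cmod in Hcz.
      destruct (Hcz z (conj Hz Hz0) e He0) as [d [Hd0 H]].
      assert (Hp : 0 < Cmod z) by (apply Cmod_gt_0; exact Hz0).
      exists (Rmin d (Cmod z)). split; [apply Rmin_glb_lt; assumption|]. intros w Hw Hwz.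
      destruct (Rmin_Rgt_l _ _ _ Hwz) as [W1 W2].
      destruct (Ceq_dec w 0) as [->|Hw0].
      * exfalso. replace (0 - z)%C with (- z)%C in W2 by ring. rewrite Cmod_opp in W2. lra.
      * apply H; auto.
  - intros z Hz. destruct (Ceq_dec z 0) as [_|Hz0]; [exact H1|].
    apply Cmult_neq_0; [apply Cminus_eq_contra; apply Hne; assumption|].
    intros E. apply C1_nz. rewrite <- (Cinv_r z Hz0), E. ring.
  - intros z. destruct (Ceq_dec z 0) as [E|Hz0]; [right; exact E|left].
    field. exact Hz0.
Qed.

(** Extends the radial parameter from $[0,1]$ to the real line, so that the polar homotopy stays in
    the closed disc and is defined for all parameters. *)
Definition clamp (s : R) : R := Rmax 0 (Rmin 1 s).

Lemma clamp_bounds (s : R) : 0 <= clamp s <= 1.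
Proof.
  unfold clamp. split; [apply Rmax_l|]. apply Rmax_lub; [lra|apply Rmin_l].
Qed.

Lemma clamp_lipschitz (s t : R) : Rabs (clamp s - clamp t) <= Rabs (s - t).
Proof.
  unfold clamp, Rmax, Rmin.
  destruct (Rle_dec 1 s); destruct (Rle_dec 1 t);
  repeat destruct (Rle_dec 0 _); unfold Rabs; repeat destruct (Rcase_abs _); lra.
Qed.

Lemma jointly_continuous_polar (q : C -> C) :
  continuous_on (closure unit_disc) q -> jointly_continuous (fun s t => q (clamp s * cis t)%C).
Proof.
  intros Hq s t e He. rewrite continuous_on_Cmod in Hq.
  assert (Hin : forall s t, closure unit_disc (clamp s * cis t)).
  { intros x y. apply closure_unit_disc. assert (H := clamp_bounds x).
    rewrite Cmod_polar; lra. }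
  destruct (Hq _ (Hin s t) e He) as [d [Hd H]].
  exists (d / 4). split; [lra|]. intros s' t' Hs' Ht'. apply H; [apply Hin|].
  replace (clamp s' * cis t' - clamp s * cis t)%C
    with (clamp s' * (cis t' - cis t) + RtoC (clamp s' - clamp s) * cis t)%C by (rewrite RtoC_minus; ring).
  eapply Rle_lt_trans; [apply Cmod_triangle|].
  rewrite !Cmod_mult, Cmod_cis, !Cmod_R.
  assert (H1 := clamp_lipschitz s' s). assert (H2 := cis_lipschitz t' t).
  assert (H3 := clamp_bounds s'). rewrite (Rabs_pos_eq (clamp s')) by lra.
  assert (H4 := Cmod_ge_0 (cis t' - cis t)).
  assert (clamp s' * Cmod (cis t' - cis t) <= 1 * Cmod (cis t' - cis t)) by (apply Rmult_le_compat_r; lra).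
  lra.
Qed.

(** Stated for any Jordan curve [J] that carries the boundary values and misses [phi 0]; the domain
    itself does not enter. *)
Lemma injective_on_circle (phi phi1 Phi Phi1 : C -> C) (J : C -> Prop) :
  C1_closed_disc phi phi1 Phi Phi1 ->
  (forall z, unit_circle z -> Phi1 z <> 0%C) -> phi1 0%C <> 0%C ->
  (forall z, Cmod z <= 1 -> z <> 0%C -> Phi z <> phi 0%C) ->
  jordan_curve J -> (forall z, unit_circle z -> J (Phi z)) -> ~ J (phi 0%C) ->
  forall z w, unit_circle z -> unit_circle w -> Phi z = Phi w -> z = w.
Proof.
  intros HC H1n H10 Hne [b [Hbc [Hbi HbJ]]] HJ HJ0.
  pose proof HC as [Hd [Hc [He _]]]. assert (HPI := PI_RGT_0).
  assert (Hex : forall t, exists z, unit_circle z /\ b z = Phi (cis t)).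
  { intros t. apply HbJ. apply HJ. apply Cmod_cis. }
  (* The boundary path read in the parameter circle of the Jordan curve. Injectivity of [b] forces
     the choice, and compactness makes it continuous. *)
  set (beta := fun t => proj1_sig (constructive_indefinite_description _ (Hex t))).
  assert (Hbeta : forall t, unit_circle (beta t) /\ b (beta t) = Phi (cis t)).
  { intros t. unfold beta. destruct (constructive_indefinite_description _ (Hex t)) as [z Hz]. exact Hz. }
  assert (HPc := continuous_on_disc_unit_circle Phi Hc).
  assert (Hbetac : forall t, continuous beta t).
  { intros t. apply continuous_C_eps. intros e He0. destruct (Hbeta t) as [B1 B2].
    destruct (compact_inverse_continuous unit_circle b (beta t) e compact_unit_circle Hbc) as [d [Hd0 H]]; auto.
    destruct (proj1 (continuous_C_eps _ _) (HPc t) d Hd0) as [d' [Hd0' H']].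
    exists d'. split; [exact Hd0'|]. intros s Hs. destruct (Hbeta s) as [S1 S2].
    apply H; [exact S1|]. rewrite S2, B2. apply H'. exact Hs. }
  destruct (argument_lift (fun s t => beta (s * t)) 0 (2 * PI)) as [theta [Hth _]].
  { apply (jointly_continuous_product beta). exact Hbetac. }
  { intros s t E. assert (K := proj1 (Hbeta (s * t))). unfold unit_circle in K.
    rewrite E, Cmod_0 in K. lra. }
  { intros t. now rewrite !Rmult_0_l. }
  assert (Hthc : forall t, 0 <= t <= 2 * PI -> continuous theta t) by (intros t Ht; apply (Hth t Ht)).
  assert (Hthe : forall t, 0 <= t <= 2 * PI -> beta t = cis (theta t)).
  { intros t Ht. destruct (Hth t Ht) as [_ E]. rewrite Rmult_1_l in E.
    rewrite (proj1 (Hbeta t)), Cmult_1_l in E. exact E. }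
  assert (Hinj : injective_on theta 0 (2 * PI)).
  { apply continuous_locally_injective_injective; [exact Hthc|].
    intros x Hx.
    destruct (disc_extension_locally_injective phi phi1 Phi Phi1 (cis x)) as [d [Hd0 Hloc]]; try assumption.
    { rewrite Cmod_cis. lra. }
    { apply H1n. apply Cmod_cis. }
    assert (Hr1 := Rmin_l (d / 2) 1). assert (Hr2 := Rmin_r (d / 2) 1).
    (* Here [d / 2] pays for the Lipschitz constant 2 of [cis], and 1 gives $|s-t|<2<2\pi$, so that
       [cis s = cis t] forces [s = t]. *)
    exists (Rmin (d / 2) 1). split; [apply Rmin_glb_lt; lra|].
    intros s t Hs Ht Hsx Htx E.
    assert (Ecis : cis s = cis t).
    { apply Hloc; try (rewrite Cmod_cis; lra).
      - eapply Rle_lt_trans; [apply cis_lipschitz|]. lra.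
      - eapply Rle_lt_trans; [apply cis_lipschitz|]. lra.
      - rewrite <- (proj2 (Hbeta s)), <- (proj2 (Hbeta t)), !Hthe, E by assumption. reflexivity. }
    apply cis_eq_inv in Ecis. destruct Ecis as [k Hk].
    apply Rabs_def2 in Hsx. apply Rabs_def2 in Htx.
    assert (HPI2 := PI2_1).
    assert (Hk0 : k = 0%Z).
    { assert (-1 < k < 1)%Z; [|lia]. split; apply lt_IZR; nra. }
    rewrite Hk0, Rmult_0_r in Hk. lra. }
  assert (Hk : exists k : Z, theta (2 * PI) - theta 0 = 2 * PI * IZR k).
  { apply cis_eq_inv. rewrite <- !Hthe by lra.
    apply Hbi; [apply Hbeta|apply Hbeta|]. rewrite (proj2 (Hbeta _)), (proj2 (Hbeta 0)).
    rewrite cis_2PI, cis_0. reflexivity. }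
  destruct Hk as [k Hk].
  destruct (difference_quotient_extension phi phi1 Phi) as [q [Hqc [Hq0 Hq]]]; try assumption.
  (* The homotopy shrinks the circle to the centre, where [q] is constant in [t]. The angles 0 and
     $2\pi$ agree at every radius, hence [lambda] has equal end values. *)
  destruct (argument_lift (fun s t => q (clamp s * cis t)%C) 0 (2 * PI)) as [lambda [Hlam Hlamper]].
  { apply jointly_continuous_polar. exact Hqc. }
  { intros s t. apply Hq0. assert (H := clamp_bounds s).
    rewrite Cmod_polar; lra. }
  { intros t. unfold clamp. rewrite Rmin_right, Rmax_left by lra. f_equal. ring. }
  assert (Hclamp1 : clamp 1 = 1) by (unfold clamp; rewrite Rmin_left, Rmax_right; lra).
  assert (Hdeg : Rabs (theta (2 * PI) - theta 0) = 2 * PI).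
  { assert (HPq : forall t, (Phi (cis t) - phi 0)%C = (cis t * q (cis t))%C).
    { intros t. destruct (Hq (cis t)) as [E|E]; [exact E|]. exfalso. apply (cis_nonzero t E). }
    apply (lift_degree_unit (fun s => b (cis s)) (fun t => Phi (cis t)) (phi 0%C) theta lambda k).
    - intros s. apply continuous_C_eps. intros e He0. rewrite continuous_on_Cmod in Hbc.
      destruct (Hbc (cis s) (Cmod_cis s) e He0) as [d [Hd0 H]].
      exists (d / 2). split; [lra|]. intros t Ht. apply H; [apply Cmod_cis|].
      eapply Rle_lt_trans; [apply cis_lipschitz|]. lra.
    - intros s. rewrite cis_plus, cis_2PI, Cmult_1_r. reflexivity.
    - intros s E. apply HJ0. apply HbJ. exists (cis s). split; [apply Cmod_cis|exact E].
    - exact Hthc.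
    - exact Hinj.
    - exact Hk.
    - intros t Ht. rewrite <- Hthe by exact Ht. symmetry. apply Hbeta.
    - intros t Ht. apply (Hlam t Ht).
    - apply Hlamper; try lra. intros s. rewrite cis_2PI, cis_0. reflexivity.
    - intros t Ht. destruct (Hlam t Ht) as [_ E]. rewrite Hclamp1, Cmult_1_l in E.
      rewrite HPq, Cmod_mult, Cmod_cis, Rmult_1_l, cis_plus. rewrite E at 1. ring. }
  intros z w Hz Hw E.
  destruct (unit_circle_cis z Hz) as [s [Hs ->]]. destruct (unit_circle_cis w Hw) as [t [Ht ->]].
  apply (unit_degree_lift_injective theta); try assumption.
  rewrite <- !Hthe by assumption.
  apply Hbi; [apply Hbeta|apply Hbeta|]. rewrite (proj2 (Hbeta s)), (proj2 (Hbeta t)). exact E.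
Qed.

(** * The decomposition *)

Lemma bdval_comp (G1 G2 : C -> Prop) (f m : C -> C) (z : C) :
  (forall z, G1 z -> G2 (m z)) -> extends_continuously G2 f -> extends_continuously G1 m ->
  closure G1 z -> bdval G1 (fun z => f (m z)) z = bdval G2 f (bdval G1 m z).
Proof.
  intros HG Hf Hm Hz.
  apply extends_continuously_bdval in Hf. apply extends_continuously_bdval in Hm.
  destruct Hf as [HF Hf]. destruct Hm as [HM Hm].
  assert (HGM : forall w, G1 w -> G2 (bdval G1 m w)) by (intros w Hw; rewrite Hm; auto).
  apply (bdval_extension G1 (fun z => f (m z)) (fun z => bdval G2 f (bdval G1 m z))).
  - apply continuous_on_Ccomp with (closure G2); [exact HF|exact HM|].
    intros w Hw. apply closure_map with G1; assumption.
  - intros w Hw. rewrite Hm, Hf; auto.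
  - exact Hz.
Qed.

Lemma bdval_plus (G : C -> Prop) (f g : C -> C) (z : C) :
  extends_continuously G f -> extends_continuously G g -> closure G z ->
  bdval G (fun z => f z + g z)%C z = (bdval G f z + bdval G g z)%C.
Proof.
  intros Hf Hg Hz.
  apply extends_continuously_bdval in Hf. apply extends_continuously_bdval in Hg.
  destruct Hf as [HF Hf]. destruct Hg as [HK Hg].
  apply (bdval_extension G (fun z => f z + g z)%C (fun z => bdval G f z + bdval G g z)%C).
  - apply continuous_on_Cplus; assumption.
  - intros w Hw. rewrite Hf, Hg; auto.
  - exact Hz.
Qed.

Lemma bdval_scal (G : C -> Prop) (c : C) (f : C -> C) (z : C) :
  extends_continuously G f -> closure G z ->
  bdval G (fun z => c * f z)%C z = (c * bdval G f z)%C.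
Proof.
  intros Hf Hz. apply extends_continuously_bdval in Hf. destruct Hf as [HF Hf].
  apply (bdval_extension G (fun z => c * f z)%C (fun z => c * bdval G f z)%C).
  - apply (continuous_on_Cmult (closure G) (fun _ => c) (bdval G f)); [|exact HF].
    apply continuous_on_const.
  - intros w Hw. rewrite Hf; auto.
  - exact Hz.
Qed.

(** Order one suffices for uniqueness and is read off for any [G] directly from holomorphy and the
    first two extensions. *)
Lemma A_infty_smooth_upto_1 (G : C -> Prop) (f : C -> C) : A_infty G f -> smooth_upto G 1 f.
Proof.
  intros [Hf Hext]. split; [apply (Hext 0%nat)|].
  exists (C_derive f). split; [|apply (Hext 1%nat)].
  intros z Hz. apply C_derive_correct; [exact z|]. apply Hf. exact Hz.
Qed.

(** Two points of the open disc are separated by [psi]; a point of the open disc and one of the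
    circle by membership of their images in [Omega]; two circle points by [injective_on_circle]. The
    extension is then injective on a compact set, and its inverse is continuous. *)
Lemma inverse_extends (Omega : C -> Prop) (phi psi : C -> C) :
  open Omega -> jordan_curve (boundary Omega) -> A_infty unit_disc phi ->
  (forall z, unit_circle z -> bdval unit_disc (C_derive phi) z <> 0%C) ->
  (forall z, unit_disc z -> Omega (phi z)) -> holomorphic Omega psi ->
  (forall w, Omega w -> unit_disc (psi w)) -> (forall z, unit_disc z -> psi (phi z) = z) ->
  (forall w, Omega w -> phi (psi w) = w) -> (forall z, unit_disc z -> C_derive phi z <> 0%C) ->
  extends_continuously Omega psi /\
  forall z, unit_circle z -> bdval Omega psi (bdval unit_disc phi z) = z.
Proof.
  intros HO HJ [Hphi Hext] Hder Hmap Hpsi Hpsid Hinv1 Hinv2 Hder0.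
  destruct (extends_continuously_bdval _ _ (Hext 0%nat)) as [Hc He].
  destruct (extends_continuously_bdval _ _ (Hext 1%nat)) as [H1c H1e].
  change (C_derive_n phi 0) with phi in *. change (C_derive_n phi 1) with (C_derive phi) in *.
  set (Phi := bdval unit_disc phi) in *. set (Phi1 := bdval unit_disc (C_derive phi)) in *.
  assert (D0 : unit_disc 0) by (unfold unit_disc; rewrite Cmod_0; lra).
  assert (Hout : forall z, unit_circle z -> ~ Omega (Phi z)).
  { intros z Hz. apply (circle_image_outside Omega phi psi Phi z); assumption. }
  assert (Hcl : forall z, Cmod z <= 1 -> closure Omega (Phi z)).
  { intros z Hz. apply closure_map with unit_disc; [exact Hc| |apply closure_unit_disc; exact Hz].
    intros w Hw. rewrite He; auto. }
  assert (Hcases : forall z, Cmod z <= 1 -> unit_disc z \/ unit_circle z).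
  { intros z Hz. unfold unit_disc, unit_circle. lra. }
  assert (Hcirc : forall z w, unit_circle z -> unit_circle w -> Phi z = Phi w -> z = w).
  { apply (injective_on_circle phi (C_derive phi) Phi Phi1 (boundary Omega)); try assumption.
    - apply C1_closed_disc_bdval; [|exact (Hext 0%nat)|exact (Hext 1%nat)].
      intros z Hz. apply C_derive_correct; [exact z|]. apply Hphi. exact Hz.
    - apply Hder0. exact D0.
    - intros z Hz Hz0 E. destruct (Hcases z Hz) as [Hd|Hd].
      + apply Hz0. rewrite He in E by exact Hd. rewrite <- (Hinv1 z Hd), E. apply Hinv1. exact D0.
      + apply (Hout z Hd). rewrite E. apply Hmap. exact D0.
    - intros z Hz. split; [apply Hcl; unfold unit_circle in Hz; lra|].
      apply subset_closure. apply Hout. exact Hz.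
    - apply not_boundary_of_open; auto. }
  assert (Hinj : forall z w, Cmod z <= 1 -> Cmod w <= 1 -> Phi z = Phi w -> z = w).
  { intros z w Hz Hw E. destruct (Hcases z Hz) as [Zd|Zc]; destruct (Hcases w Hw) as [Wd|Wc].
    - rewrite !He in E by assumption. rewrite <- (Hinv1 z Zd), E. apply Hinv1. exact Wd.
    - exfalso. apply (Hout w Wc). rewrite <- E, He by exact Zd. apply Hmap. exact Zd.
    - exfalso. apply (Hout z Zc). rewrite E, He by exact Wd. apply Hmap. exact Wd.
    - apply Hcirc; assumption. }
  (* Off the closure of [Omega] the value of [Psi] is arbitrary and never consulted. *)
  set (Psi := fun w => epsilon (inhabits (RtoC 0)) (fun z => Cmod z <= 1 /\ Phi z = w)).
  assert (HPsi : forall w, closure Omega w -> Cmod (Psi w) <= 1 /\ Phi (Psi w) = w).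
  { intros w Hw. apply (epsilon_spec (inhabits (RtoC 0)) (fun z => Cmod z <= 1 /\ Phi z = w)).
    apply (closure_image Omega phi psi Phi w); assumption. }
  assert (HPsic : continuous_on (closure Omega) Psi).
  { apply continuous_on_Cmod. intros w Hw e He0. destruct (HPsi w Hw) as [P1 P2].
    destruct (compact_inverse_continuous (fun z => Cmod z <= 1) Phi (Psi w) e compact_closed_disc) as [d [Hd H]].
    - apply continuous_on_subset with (2 := Hc). intros z Hz. apply closure_unit_disc; exact Hz.
    - intros z Hz E. apply Hinj; assumption.
    - exact He0.
    - exists d. split; [exact Hd|]. intros v Hv Hvw. destruct (HPsi v Hv) as [Q1 Q2].
      apply H; [exact Q1|]. rewrite Q2, P2. exact Hvw. }
  assert (HPsie : forall w, Omega w -> Psi w = psi w).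
  { intros w Hw. destruct (HPsi w (subset_closure _ _ Hw)) as [P1 P2].
    assert (Hd := Hpsid w Hw).
    apply Hinj; [exact P1|unfold unit_disc in Hd; lra|]. rewrite P2, He by exact Hd.
    symmetry. apply Hinv2. exact Hw. }
  split; [exists Psi; split; assumption|].
  intros z Hz. assert (Hz1 : Cmod z <= 1) by (unfold unit_circle in Hz; lra).
  rewrite (bdval_extension Omega psi Psi (Phi z) HPsic HPsie (Hcl z Hz1)).
  destruct (HPsi (Phi z) (Hcl z Hz1)) as [P1 P2]. apply Hinj; assumption.
Qed.

Lemma is_Cderive_inverse (G : C -> Prop) (phi psi : C -> C) (w a b : C) :
  open G -> G w -> (forall v, G v -> phi (psi v) = v) ->
  is_Cderive phi (psi w) a -> is_Cderive psi w b -> (a * b)%C = 1%C.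
Proof.
  intros HG Hw Hinv Ha Hb.
  apply (is_Cderive_unique (fun v => v) w); [|apply is_Cderive_id].
  apply is_Cderive_ext_loc with (fun v => phi (psi v)) G; try assumption.
  apply is_Cderive_comp; assumption.
Qed.

(** A bootstrap: if [psi] has order [n] up to the boundary, so does its derivative
    $(1/\phi')\circ\psi$, and [psi] gains an order. *)
Lemma inverse_smooth_upto (Omega : C -> Prop) (phi psi : C -> C) (n : nat) :
  open Omega -> A_infty unit_disc phi ->
  (forall z, closure unit_disc z -> bdval unit_disc (C_derive phi) z <> 0%C) ->
  holomorphic Omega psi -> (forall w, Omega w -> unit_disc (psi w)) ->
  (forall w, Omega w -> phi (psi w) = w) -> extends_continuously Omega psi ->
  smooth_upto Omega n psi.
Proof.
  intros HO Hphi Hder Hpsi Hpsid Hinv Hext.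
  assert (Hd : forall z, unit_disc z -> is_Cderive phi z (C_derive phi z)).
  { intros z Hz. apply C_derive_correct; [exact z|]. apply Hphi. exact Hz. }
  induction n as [|n IH]; [exact Hext|].
  split; [exact Hext|]. exists (fun w => / C_derive phi (psi w))%C. split.
  - intros w Hw. destruct (Hpsi w Hw) as [l Hl].
    assert (E := is_Cderive_inverse Omega phi psi w _ l HO Hw Hinv (Hd _ (Hpsid w Hw)) Hl).
    assert (Hnz : C_derive phi (psi w) <> 0%C).
    { intros E0. rewrite E0, Cmult_0_l in E. apply C1_nz. symmetry. exact E. }
    replace (/ C_derive phi (psi w))%C with l; [exact Hl|].
    apply Cmult_reg_r with (C_derive phi (psi w)); [exact Hnz|].
    rewrite Cinv_l by exact Hnz. rewrite Cmult_comm. exact E.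
  - apply (smooth_upto_comp Omega unit_disc n (fun z => / C_derive phi z)%C psi); [exact Hpsid| |exact IH].
    apply smooth_upto_inv; [exact Hder|].
    destruct (A_infty_disc_smooth_upto phi (S n) Hphi) as [_ [phi1 [H1 H2]]].
    apply smooth_upto_ext with phi1; [apply open_unit_disc| |exact H2].
    intros z Hz. apply (is_Cderive_unique phi z); auto.
Qed.

Lemma is_Cseries_conj (a : nat -> C) (l : C) :
  is_Cseries a l -> is_Cseries (fun n => Cconj (a n)) (Cconj l).
Proof.
  intros Ha e He. destruct (Ha e He) as [N0 H]. exists N0. intros N HN.
  replace (sum_n (fun n => Cconj (a n)) N) with (Cconj (sum_n a N)).
  - rewrite <- Cminus_conj, Cmod_conj. apply H. exact HN.
  - clear. induction N as [|N IH]; [now rewrite !sum_O|].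
    rewrite !sum_Sn, <- IH. apply Cplus_conj.
Qed.

(** The second sequence is conjugated and starts at frequency $-1$, because the negative part is to
    be written as the conjugate of $z$ times a power series. *)
Lemma fourier_rapid (U : nat -> R -> C) :
  (forall k, periodic (U k)) -> (forall k t, is_Rderive (U k) t (U (S k) t)) ->
  rapid (fun n => fourier (U 0%nat) (Z.of_nat n)) /\
  rapid (fun n => Cconj (fourier (U 0%nat) (- Z.of_nat (S n)))).
Proof.
  intros HP HU. split; intros k; destruct (fourier_decay U HP HU k) as [M HM].
  (* The decay bound carries the weight $|n|^k$, the sequence the weight $(n+1)^k$. For $n\ge1$
     their ratio is at most $2^k$; the coefficient at 0 is added separately. *)
  - exists (Cmod (fourier (U 0%nat) 0) + 2 ^ k * M). intros n.
    assert (H2 : 0 < 2 ^ k) by (apply pow_lt; lra).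
    assert (Hn0 : forall n, 0 <= Cmod (fourier (U 0%nat) n) * Rabs (IZR n) ^ k).
    { intros m. apply Rmult_le_pos; [apply Cmod_ge_0|]. apply pow_le, Rabs_pos. }
    assert (HM0 : 0 <= M) by (eapply Rle_trans; [apply (Hn0 0%Z)|apply HM]).
    destruct n as [|n].
    + simpl Z.of_nat. simpl INR. rewrite Rplus_0_l, pow1, Rmult_1_r.
      assert (0 <= 2 ^ k * M) by (apply Rmult_le_pos; lra). lra.
    + specialize (HM (Z.of_nat (S n))). rewrite <- INR_IZR_INZ in HM.
      assert (Hn := pos_INR n). assert (HS : INR (S n) = INR n + 1) by apply S_INR.
      rewrite Rabs_pos_eq in HM by lra.
      assert (Hpow : (INR (S n) + 1) ^ k <= 2 ^ k * INR (S n) ^ k).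
      { rewrite <- Rpow_mult_distr. apply pow_incr. lra. }
      assert (Hc := Cmod_ge_0 (fourier (U 0%nat) (Z.of_nat (S n)))).
      assert (Hc0 := Cmod_ge_0 (fourier (U 0%nat) 0)).
      eapply Rle_trans; [apply Rmult_le_compat_l; [exact Hc|exact Hpow]|].
      replace (Cmod (fourier (U 0%nat) (Z.of_nat (S n))) * (2 ^ k * INR (S n) ^ k))
        with (2 ^ k * (Cmod (fourier (U 0%nat) (Z.of_nat (S n))) * INR (S n) ^ k)) by ring.
      assert (2 ^ k * (Cmod (fourier (U 0%nat) (Z.of_nat (S n))) * INR (S n) ^ k) <= 2 ^ k * M)
        by (apply Rmult_le_compat_l; lra). lra.
  - exists M. intros n. specialize (HM (- Z.of_nat (S n))%Z).
    rewrite opp_IZR, Rabs_Ropp, <- INR_IZR_INZ, Rabs_pos_eq in HM by apply pos_INR.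
    rewrite Cmod_conj, <- S_INR. exact HM.
Qed.

(** On the circle $e^{-i(k+1)t}=\overline{z\cdot z^k}$, which turns the negative frequencies into a
    conjugate. The explicit factor [z] makes the conjugated function vanish at 0. *)
Lemma smooth_circle_decomposition (u : C -> C) :
  smooth_circle u -> exists c d : nat -> C, rapid c /\ rapid d /\
    forall z, unit_circle z -> u z = (power_series c z + Cconj (z * power_series d z))%C.
Proof.
  intros Hu.
  (* The successive derivatives of $t\mapsto u(e^{it})$, assembled from those of the real and
     imaginary parts. *)
  set (U := fun (k : nat) (t : R) =>
    (Derive_n (fun s => Re (u (cis s))) k t, Derive_n (fun s => Im (u (cis s))) k t) : C).
  assert (HU : forall k t, is_Rderive (U k) t (U (S k) t)).
  { intros k t. apply is_Rderive_parts. destruct (Hu (S k) t) as [H1 H2].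
    split; apply Derive_correct; [exact H1|exact H2]. }
  assert (Hcis : forall t, cis (t + 2 * PI) = cis t).
  { intros t. rewrite cis_plus, cis_2PI. apply Cmult_1_r. }
  assert (HP : forall k, periodic (U k)).
  { intros k t. unfold U. rewrite <- !Derive_n_comp_trans.
    f_equal; apply Derive_n_ext; intros s; rewrite Hcis; reflexivity. }
  assert (HU0 : forall t, U 0%nat t = u (cis t)).
  { intros t. unfold U. simpl. symmetry. apply surjective_pairing. }
  destruct (fourier_rapid U HP HU) as [Hc Hd].
  set (c := fun n => fourier (U 0%nat) (Z.of_nat n)) in *.
  set (d := fun n => Cconj (fourier (U 0%nat) (- Z.of_nat (S n)))) in *.
  exists c, d. split; [exact Hc|]. split; [exact Hd|].
  intros z Hz. destruct (unit_circle_cis z Hz) as [t [_ ->]]. rewrite <- HU0.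
  assert (Hle : Cmod (cis t) <= 1) by (rewrite Cmod_cis; lra).
  assert (S1 := is_Cseries_power_series c (cis t) Hc Hle).
  assert (S2 := is_Cseries_power_series d (cis t) Hd Hle).
  apply (is_Cseries_scal (cis t)) in S2. apply is_Cseries_conj in S2.
  assert (S3 := is_Cseries_plus _ _ _ _ S1 S2).
  apply is_Cseries_unique with (2 := S3).
  intros e He.
  destruct (fourier_inversion (U 0%nat) (U 1%nat) t e) as [N0 H].
  - apply HP.
  - apply HU.
  - intros s. eapply is_Rderive_continuous. apply HU.
  - apply HP.
  - exact He.
  - exists N0. intros N HN. specialize (H N HN).
    rewrite (sum_n_plus (G := C_AbelianMonoid)).
    rewrite (sum_n_ext (fun n => c n * cis t ^ n)%C (fun k => fourier (U 0%nat) (Z.of_nat k) * cis (INR k * t))%C)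
      by (intros k; rewrite cis_INR; reflexivity).
    rewrite (sum_n_ext (fun n => Cconj (cis t * (d n * cis t ^ n)))%C
      (fun k => fourier (U 0%nat) (- Z.of_nat (S k)) * cis (- INR (S k) * t))%C).
    + exact H.
    + intros k. unfold d. rewrite !Cmult_conj, Cconj_conj.
      replace (- INR (S k) * t) with (- (INR (S k) * t)) by ring.
      rewrite cis_opp, cis_INR, Cpow_S, Cmult_conj.
      match goal with |- @eq _ ?x ?y => change (@eq C x y) end. ring.
Qed.

Theorem theorem14 (Omega : C -> Prop) (phi : C -> C)
    (HOmega : jordan_domain Omega)
    (Hphi : riemann_map Omega phi)
    (Hphi_smooth : A_infty unit_disc phi)
    (Hphi_deriv : forall z : C, unit_circle z -> bdval unit_disc (C_derive phi) z <> 0%C)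
    (f : C -> C) (Hf : smooth_boundary phi f) :
  exists g h : C -> C,
    decomposition Omega (phi 0%C) f g h /\
    forall g' h' : C -> C,
      decomposition Omega (phi 0%C) f g' h' ->
      forall w : C, Omega w -> g' w = g w /\ h' w = h w.
Proof.
  destruct HOmega as [[HO _] [_ HJ]].
  destruct Hphi as [Hphi [Hmap [psi [Hpsi [Hpsid [Hinv1 Hinv2]]]]]].
  assert (D0 : unit_disc 0) by (unfold unit_disc; rewrite Cmod_0; lra).
  assert (Hd : forall z, unit_disc z -> is_Cderive phi z (C_derive phi z)).
  { intros z Hz. apply C_derive_correct; [exact z|]. apply Hphi. exact Hz. }
  (* Inside the disc the derivative cannot vanish, by differentiating $\psi\circ\phi=\mathrm{id}$;
     the hypothesis on $\phi'$ covers the circle. *)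
  assert (Hd0 : forall z, unit_disc z -> C_derive phi z <> 0%C).
  { intros z Hz E. destruct (Hpsi (phi z) (Hmap z Hz)) as [l Hl].
    assert (K := is_Cderive_inverse unit_disc psi phi z l _ open_unit_disc Hz Hinv1 Hl (Hd z Hz)).
    rewrite E, Cmult_0_r in K. apply C1_nz. symmetry. exact K. }
  destruct (inverse_extends Omega phi psi) as [Hpsi_ext Hpsi_bd]; try assumption.
  assert (Hext0 := proj2 Hphi_smooth 0%nat). assert (Hext1 := proj2 Hphi_smooth 1%nat).
  simpl in Hext0, Hext1.
  assert (Hder_cl : forall z, closure unit_disc z -> bdval unit_disc (C_derive phi) z <> 0%C).
  { intros z Hz. apply closure_unit_disc in Hz. destruct (Rle_lt_or_eq_dec _ _ Hz) as [Hlt|Heq].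
    - rewrite (proj2 (extends_continuously_bdval _ _ Hext1)) by exact Hlt. apply Hd0. exact Hlt.
    - apply Hphi_deriv. exact Heq. }
  assert (Hpsi_smooth : forall n, smooth_upto Omega n psi).
  { intros n. apply (inverse_smooth_upto Omega phi psi n); assumption. }
  destruct (extends_continuously_bdval _ _ Hext0) as [Hc He].
  assert (Hbd : forall w, boundary Omega w -> exists z, unit_circle z /\ bdval unit_disc phi z = w).
  { intros w. apply (boundary_image Omega phi psi); assumption. }
  assert (Hbd' : forall z, unit_circle z -> boundary Omega (bdval unit_disc phi z)).
  { intros z Hz. split.
    - apply closure_map with unit_disc; [exact Hc| |apply closure_unit_disc; unfold unit_circle in Hz; lra].
      intros v Hv. rewrite He by exact Hv. apply Hmap. exact Hv.
    - apply subset_closure. apply (circle_image_outside Omega phi psi); assumption. }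
  destruct (smooth_circle_decomposition (fun z => f (bdval unit_disc phi z)) Hf)
    as [c [d [Hcr [Hdr Hdec]]]].
  set (G := power_series c). set (H := fun z => (z * power_series d z)%C).
  assert (HG : forall n, smooth_upto unit_disc n G) by (intros n; apply power_series_smooth_upto; exact Hcr).
  assert (HH : forall n, smooth_upto unit_disc n H).
  { intros n. apply smooth_upto_mult; [apply smooth_upto_id|apply power_series_smooth_upto; exact Hdr]. }
  (* A function on the disc transported by [psi] has at $\phi(z)$ the boundary value [K z]. This
     reduces the identity on the boundary of [Omega] to the one on the circle. *)
  assert (Hval : forall K z, continuous_on (closure unit_disc) K -> (forall n, smooth_upto unit_disc n K) ->
    unit_circle z -> bdval Omega (fun w => K (psi w)) (bdval unit_disc phi z) = K z).
  { intros K z HKc HK Hz. rewrite (bdval_comp Omega unit_disc K psi);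
      [|exact Hpsid|exact (HK 0%nat)|exact Hpsi_ext|apply (Hbd' z Hz)].
    rewrite Hpsi_bd by exact Hz. apply bdval_extension; [exact HKc|reflexivity|].
    apply closure_unit_disc. unfold unit_circle in Hz. lra. }
  assert (HGc := power_series_continuous_on c Hcr : continuous_on (closure unit_disc) G).
  assert (HHc : continuous_on (closure unit_disc) H).
  { apply (continuous_on_Cmult _ (fun z => z)); [|apply power_series_continuous_on; exact Hdr].
    apply continuous_on_id. }
  set (g := fun w => G (psi w)). set (h := fun w => H (psi w)).
  assert (Hdecomp : decomposition Omega (phi 0%C) f g h).
  { split; [|split; [|split]].
    - apply smooth_upto_A_infty; [exact HO|]. intros n. apply (smooth_upto_comp Omega unit_disc n G psi); auto.
    - apply smooth_upto_A_infty; [exact HO|]. intros n. apply (smooth_upto_comp Omega unit_disc n H psi); auto.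
    - unfold h, H. rewrite Hinv1 by exact D0. apply Cmult_0_l.
    - intros w Hw. destruct (Hbd w Hw) as [z [Hz <-]]. unfold g, h.
      rewrite (Hval G), (Hval H) by assumption. apply Hdec. exact Hz. }
  exists g, h. split; [exact Hdecomp|].
  intros g' h' [Hg' [Hh' [Hh0' Hb']]] w Hw.
  destruct Hdecomp as [Hg [Hh [Hh0 Hb]]].
  assert (Hphi1 := A_infty_disc_smooth_upto phi 1 Hphi_smooth).
  (* The difference of two competing functions is pulled back by [phi]. It is written with a factor
     $-1$ so that the sum and product rules for smoothness and boundary values apply. *)
  assert (Hpull : forall k k', A_infty Omega k -> A_infty Omega k' ->
    smooth_upto unit_disc 1 (fun z => k' (phi z) + (-1) * k (phi z))%C /\
    forall z, unit_circle z -> bdval unit_disc (fun z => k' (phi z) + (-1) * k (phi z))%C z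
       = (bdval Omega k' (bdval unit_disc phi z) + (-1) * bdval Omega k (bdval unit_disc phi z))%C).
  { intros k k' Hk Hk'.
    assert (S1 := smooth_upto_comp unit_disc Omega 1 k phi Hmap (A_infty_smooth_upto_1 _ _ Hk) Hphi1).
    assert (S2 := smooth_upto_comp unit_disc Omega 1 k' phi Hmap (A_infty_smooth_upto_1 _ _ Hk') Hphi1).
    assert (S3 := smooth_upto_mult _ _ _ _ (smooth_upto_const unit_disc 1 (-1)) S1).
    split; [exact (smooth_upto_plus _ _ _ _ S2 S3)|].
    intros z Hz. assert (Hzc : closure unit_disc z) by (apply closure_unit_disc; unfold unit_circle in Hz; lra).
    rewrite (bdval_plus unit_disc (fun z => k' (phi z)) (fun z => (-1) * k (phi z))%C);
      [|exact (smooth_upto_extends _ _ _ S2)|exact (smooth_upto_extends _ _ _ S3)|exact Hzc].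
    rewrite (bdval_scal unit_disc (-1) (fun z => k (phi z)));
      [|exact (smooth_upto_extends _ _ _ S1)|exact Hzc].
    rewrite (bdval_comp unit_disc Omega k phi), (bdval_comp unit_disc Omega k' phi);
      try assumption; [reflexivity|exact (proj2 Hk' 0%nat)|exact (proj2 Hk 0%nat)]. }
  destruct (Hpull g g' Hg Hg') as [Gs Gb]. destruct (Hpull h h' Hh Hh') as [Hs Hsb].
  destruct (disc_conj_decomposition_unique _ _ Gs Hs) with (z := psi w) as [E1 E2].
  - intros z Hz. rewrite Gb, Hsb by exact Hz.
    assert (B1 := Hb _ (Hbd' z Hz)). assert (B2 := Hb' _ (Hbd' z Hz)).
    rewrite B1 in B2. rewrite Cplus_conj, Cmult_conj.
    replace (Cconj (-1)) with (RtoC (-1)) by (unfold Cconj, RtoC; simpl; f_equal; ring).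
    set (x1 := bdval Omega g _) in *. set (x2 := bdval Omega g' _) in *.
    set (y1 := Cconj (bdval Omega h _)) in *. set (y2 := Cconj (bdval Omega h' _)) in *.
    transitivity ((x2 + y2) - (x1 + y1))%C; [ring|]. rewrite B2. ring.
  - rewrite Hh0, Hh0'. ring.
  - apply Hpsid. exact Hw.
  - rewrite Hinv2 in E1, E2 by exact Hw. split.
    + transitivity (g' w + -1 * g w + g w)%C; [ring|]. rewrite E1. ring.
    + transitivity (h' w + -1 * h w + h w)%C; [ring|]. rewrite E2. ring.
Qed.
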